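(* Let $(b_s)_{s\ge 1}$ be a non-increasing summable sequence of positive numbers. The following conditions are equivalent: (a) every atomic singular inner function with point masses $(b_s)_{s\ge1}$ is easily wepable; (b) $b_s\asymp\sum_{k\ge s}b_k$, $s\ge 1$; that is, there is a constant $C>0$ such that $\sum_{k\ge s}b_k\le C\,b_s$ for all $s\ge 1$.
   Context: $\mathbb D$ is the open unit disc and $\mathbb T=\partial\mathbb D$. An atomic singular inner function with point masses $(b_s)_{s\ge1}$ is a function $S_\mu(z)=\exp\left(-\int_{\mathbb T}\frac{\xi+z}{\xi-z}\,d\mu(\xi)\right)$, $z\in\mathbb D$, where $\mu=\sum_{s\ge1}b_s\delta_{x_s}$ for some sequence $(x_s)_{s\ge1}$ of pairwise distinct points of $\mathbb T$ ($\delta_x$ is the unit point mass at $x$; no restriction on the location of the points). A bounded analytic function $I$ on $\mathbb D$ is inner if it has radial limits of modulus $1$ at almost every point of $\mathbb T$. Let $\rho(z,w)=\left|\frac{z-w}{1-\overline w z}\right|$, let $Z(I)$ be the zero set of $I$ in $\mathbb D$, and $\rho(z,Z(I))=\inf_{w\in Z(I)}\rho(z,w)$ (if $Z(I)=\varnothing$, this infimum is $+\infty$). An inner function $I$ satisfies the Weak Embedding Property (WEP) if for every $\varepsilon>0$, $\eta_I(\varepsilon):=\inf\{|I(z)|: z\in\mathbb D,\ \rho(z,Z(I))>\varepsilon\}>0$ (infimum over the empty set is $+\infty$). An inner function $S$ is easily wepable if there exist a constant $m<1$ and a Blaschke product $B$ such that $SB$ satisfies the WEP and $Z(B)\subset\{z\in\mathbb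 D:|S(z)|<m\}$. *)

(* Defs.v *)
From HB Require Import structures.
From mathcomp Require Import all_boot all_order all_algebra.
From mathcomp Require Import complex.
From mathcomp Require Import all_classical all_reals all_analysis.
Set Implicit Arguments.
Unset Strict Implicit.
Unset Printing Implicit Defensive.
Import Order.TTheory GRing.Theory Num.Theory.
Import numFieldNormedType.Exports.
Import ComplexField.Normc.
Local Open Scope classical_set_scope.
Local Open Scope ring_scope.
Local Open Scope complex_scope.

(* The real-valued modulus is [normc]; the canonical norm of R[i] takes its
   values in R[i]. A function on the disc is represented by a function on R[i]
   whose values outside the disc are irrelevant. *)

(* R[i] receives the topology of its modulus, as a normed module over itself. *)
HB.instance Definition _ (R : realType) := NormedModule.copy R[i] R[i]^o.

Section Disc.
Variable R : realType.
Local Notation C := R[i].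
Implicit Types (I S B : C -> C) (z w : C).

Definition unit_disc : set C := [set z | normc z < 1].

Definition unit_circle : set C := [set z | normc z = 1].

Definition cis (t : R) : C := cos t +i* sin t.

Definition cexp z : C := (expR (complex.Re z))%:C * cis (complex.Im z).

Definition holomorphic_on_disc I :=
  forall z, unit_disc z -> derivable I z 1.

(* Almost every point of the circle is meant for arc length, that is, for the
   Lebesgue measure in the angle t. *)
Definition inner I :=
  [/\ holomorphic_on_disc I,
      exists M : R, forall z, unit_disc z -> normc (I z) <= M &
      {ae @lebesgue_measure R, forall t : R, 0 <= t < 2 * pi ->
        exists2 l : C, unit_circle l &
          I (r%:C * cis t) @[r --> (1 : R)^'-] --> l}].

Definition zero_set I : set C := [set z | unit_disc z /\ I z = 0].

Definition rho z w : R := normc ((z - w) / (1 - w^* * z)).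

Definition rho_set z (Z : set C) : \bar R :=
  ereal_inf [set (rho z w)%:E | w in Z].

Definition wep_eta I (eps : R) : \bar R :=
  ereal_inf [set (normc (I z))%:E | z in
    [set z | unit_disc z /\ (eps%:E < rho_set z (zero_set I))%E]].

Definition WEP I :=
  inner I /\ forall eps : R, 0 < eps -> (0 < wep_eta I eps)%E.

Definition blaschke_factor w z : C :=
  if w == 0 then z else (normc w)%:C / w * ((w - z) / (1 - w^* * z)).

(* [a n = None] stands for an absent factor, so that the zeros listed by [a],
   with multiplicity, may form an infinite, a finite or an empty sequence. *)
Definition blaschke_product B :=
  exists a : nat -> option C,
    [/\ forall n w, a n = Some w -> unit_disc w,
        cvgn (series (fun n => if a n is Some w then 1 - normc w else 0 : R)) &
        forall z, unit_disc z ->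
          (\prod_(0 <= n < N)
             (if a n is Some w then blaschke_factor w z else 1 : C))
            @[N --> \oo] --> B z].

Definition easily_wepable S :=
  inner S /\
  exists (m : R) (B : C -> C),
    [/\ m < 1, blaschke_product B, WEP (fun z => S z * B z) &
        zero_set B `<=` [set z | unit_disc z /\ normc (S z) < m]].

Definition borelC := g_sigma_algebraType (@open C).

Definition herglotz_integral (mu : {measure set borelC -> \bar R}) z : C :=
  Rintegral mu (unit_circle : set borelC)
    (fun xi : borelC => complex.Re (((xi : C) + z) / ((xi : C) - z)))
  +i* Rintegral mu (unit_circle : set borelC)
    (fun xi : borelC => complex.Im (((xi : C) + z) / ((xi : C) - z))).

Definition singular_function (mu : {measure set borelC -> \bar R}) z : C :=
  cexp (- herglotz_integral mu z).

Definition is_atomic_measure (b : nat -> R) (x : nat -> C)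
    (mu : {measure set borelC -> \bar R}) :=
  forall A : set borelC, measurable A ->
    mu A = (\sum_(0 <= s <oo) (b s)%:E * \d_(x s : borelC) A)%E.

Definition atomic_singular_inner (b : nat -> R) S :=
  exists (x : nat -> C) (mu : {measure set borelC -> \bar R}),
    [/\ forall s, unit_circle (x s), injective x, is_atomic_measure b x mu &
        forall z, unit_disc z -> S z = singular_function mu z].

End Disc.

(* Main.v *)
Require Import Defs.
From HB Require Import structures.
From mathcomp Require Import all_boot all_order all_algebra.
From mathcomp Require Import complex.
From mathcomp Require Import all_classical all_reals all_analysis.
From mathcomp Require Import measurable_realfun.
From mathcomp Require Import ring lra zify.
Set Implicit Arguments.
Unset Strict Implicit.
Unset Printing Implicit Defensive.
Import Order.TTheory GRing.Theory Num.Theory.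
Import numFieldNormedType.Exports.
Import ComplexField.Normc.
Local Open Scope classical_set_scope.
Local Open Scope ring_scope.

(** Let [P] be the Poisson integral of the measure, so that [|S| = exp (- P)].
    The weak embedding property of [S B] says that away from the zeros of [B]
    the sum [P] is bounded above and [|B|] is bounded below, and the zeros of
    [B] are only allowed where [P] is not small.

    Heavy tails. If the tail condition fails there are disjoint blocks of
    consecutive masses, the [k]-th one with a total mass [M k] that exceeds its
    largest element by a factor as large as desired. Place the masses of the
    block end to end, with density [k + 1], on an arc of length [M k / (k + 1)].
    Then [P] is of order [k + 1] on the box over the arc, at all heights between
    this length and a tiny fraction of it ([cluster_poisson_lower]), so [S] is
    small there and [B] must have a zero near each point of a grid in the box,
    in as many generations as desired. These zeros make [B] small at the height
    [(k + 1) M k] over the arc ([blaschke_grid_upper]), so that [B] also has a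
    zero near that point. But this point is so high that the block looks light
    from it: [P] is of order [1 / (k + 1)] there ([poisson_above_cluster]), and
    [|S|] tends to one on these zeros of [B], which contradicts [|S| < m < 1].
    This is [heavy_tails_not_wepable].

    Light tails. Under the tail condition the masses decay geometrically: with
    [beta = b ^ (1 / 8)], the sequence [beta] is halved every [L] steps
    ([beta_halving]), and the masses below [y] add up to at most [K y]
    ([sum_small_le]). For each [j] consider a lattice of mesh [1 / (j + 1)], in
    the pseudo-hyperbolic sense, consisting of equidistributed points on circles
    whose heights [1 - |z|] form a geometric progression. The zeros of [B] are
    the points of the lattices with [P] larger than a threshold, which is at
    least [8] and increases fast with [j]. If [z] is far from the zeros, then a
    sufficiently fine lattice has a point close to [z] which was not selected,
    so [P z] is bounded by Harnack's inequality ([net_poisson_bound]). It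
    remains to bound [|B z|] below, that is to bound the sum of [1 - rho z a ^
    2] over the selected points [a] in terms of a bound for [P z]
    ([blaschke_lower], [interior_sum]). By pigeonhole a selected point of height
    [Y ^ 8] lies within [theta * beta s ^ 5 * Y ^ 3] of some atom heavier than
    its height, with [theta] of order [tau ^ (- 1 / 2)] ([heavy_atom]);
    equidistribution bounds the number of such points on each circle
    ([lattice_count]), and the sums over the circles and over the atoms are
    geometric ([lattice_sum]). The same count verifies Frostman's criterion at
    every boundary point whose distance to the atom [s] is at least a constant
    multiple of [beta s] ([boundary_sum]), hence at almost every boundary point
    ([ae_circle_avoid]), which shows that [S B] is inner. This is
    [light_tails_wepable]. *)

(** * The modulus and the pseudo-hyperbolic distance *)

Section ComplexModulus.
Variable R : realType.
Local Notation C := R[i].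
Implicit Types z w u v : C.

Lemma normc_ge0 z : 0 <= normc z.
Proof. by case: z => a b; exact: sqrtr_ge0. Qed.

Lemma normc_sqr z : normc z ^+ 2 = complex.Re z ^+ 2 + complex.Im z ^+ 2.
Proof. by case: z => a b /=; rewrite sqr_sqrtr// addr_ge0 ?sqr_ge0. Qed.

Lemma normc_triangle z w : normc (z + w) <= normc z + normc w.
Proof. exact: (@le_normcD R z w). Qed.

Lemma normc_opp z : normc (- z) = normc z.
Proof. exact: (@normcN R z). Qed.

Lemma normc_distC z w : normc (z - w) = normc (w - z).
Proof. by rewrite -normc_opp opprB. Qed.

Lemma normc_triangleB z w : normc (z - w) <= normc z + normc w.
Proof. by rewrite -(normc_opp w); exact: normc_triangle. Qed.

Lemma normc_dist_triangle u z w : normc (z - w) <= normc (z - u) + normc (u - w).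
Proof. by rewrite -[z - w](subrKA u); exact: normc_triangle. Qed.

Lemma normc_lower z w : normc z - normc w <= normc (z - w).
Proof. by rewrite lerBlDr -{1}[z](subrK w); exact: normc_triangle. Qed.

Lemma normc_eq0 z : (normc z == 0) = (z == 0).
Proof. by apply/eqP/eqP => [/eq0_normc//|->]; rewrite normc0. Qed.

Lemma normc_gt0 z : (0 < normc z) = (z != 0).
Proof. by rewrite lt_def normc_ge0 normc_eq0 andbT. Qed.

Lemma normc_real (r : R) : normc (r%:C)%C = `|r|.
Proof. by rewrite /= expr0n/= addr0 sqrtr_sqr. Qed.

Lemma normc_natr n : normc (n%:R : C) = n%:R.
Proof. by rewrite (@normcMn R 1 n) normc1. Qed.

Lemma normcX z n : normc (z ^+ n) = normc z ^+ n.
Proof. by elim: n => [|n ih]; rewrite ?expr0 ?normc1// !exprS normcM ih. Qed.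

Lemma normc_div z w : normc (z / w) = normc z / normc w.
Proof. by rewrite normcM normcV. Qed.

Lemma normc_conj z : normc (z^*)%C = normc z.
Proof. by case: z => a b /=; rewrite sqrrN. Qed.

Lemma normc_Re z : `|complex.Re z| <= normc z.
Proof. by case: z => a b /=; rewrite -sqrtr_sqr ler_wsqrtr// lerDl sqr_ge0. Qed.

Lemma normc_Im z : `|complex.Im z| <= normc z.
Proof. by case: z => a b /=; rewrite -sqrtr_sqr ler_wsqrtr// lerDr sqr_ge0. Qed.

Lemma normc_le_ReIm z : normc z <= `|complex.Re z| + `|complex.Im z|.
Proof.
rewrite -(@ler_pXn2r _ 2)// ?nnegrE ?addr_ge0 ?normc_ge0// normc_sqr.
rewrite -(real_normK (num_real (complex.Re z))).
rewrite -(real_normK (num_real (complex.Im z))) sqrrD addrAC lerDl.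
by rewrite mulrn_wge0// mulr_ge0.
Qed.

Lemma normc_prod n (f : nat -> C) :
  normc (\prod_(0 <= k < n) f k) = \prod_(0 <= k < n) normc (f k).
Proof. by rewrite (big_morph (@normc R) (@normcM R) (@normc1 R)). Qed.

Lemma kernel_neq0 z w : normc z <= 1 -> normc w < 1 -> 1 - (w^*)%C * z != 0.
Proof.
move=> z1 w1; apply/eqP => /eqP; rewrite subr_eq0 => /eqP e.
have : normc ((w^*)%C * z) = 1 by rewrite -e normc1.
rewrite normcM normc_conj => e1.
suff : normc w * normc z < 1 by rewrite e1 ltxx.
by rewrite (le_lt_trans _ w1)// ler_piMr ?normc_ge0.
Qed.

(** The gap [1 - |z|] is the distance to the circle, and the kernel of [w] at [z]
    is never smaller: this is the basic lower bound for denominators. *)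
Lemma kernel_lower z w : normc w <= 1 -> 1 - normc z <= normc (1 - (w^*)%C * z).
Proof.
move=> w1; apply: le_trans (normc_lower _ _).
by rewrite normc1 lerD2l lerN2 normcM normc_conj ler_piMl ?normc_ge0.
Qed.

Lemma kernel_sym z w : normc (1 - (w^*)%C * z) = normc (1 - (z^*)%C * w).
Proof. by rewrite -normc_conj rmorphB rmorph1 rmorphM /= conjcK mulrC. Qed.

(** The identity behind every formula for [1 - rho ^ 2]: both sides are the same
    quadratic polynomial in the coordinates. *)
Lemma normc_kernelE z w :
  normc (1 - (w^*)%C * z) ^+ 2 =
  normc (z - w) ^+ 2 + (1 - normc z ^+ 2) * (1 - normc w ^+ 2).
Proof. by rewrite !normc_sqr; case: z w => a b [c d] /=; ring. Qed.

Lemma rho_ge0 z w : 0 <= rho z w.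
Proof. exact: normc_ge0. Qed.

Lemma rho_sqr z w : normc z < 1 -> normc w < 1 ->
  1 - rho z w ^+ 2 =
  (1 - normc z ^+ 2) * (1 - normc w ^+ 2) / normc (1 - (w^*)%C * z) ^+ 2.
Proof.
move=> z1 w1; rewrite /rho normc_div expr_div_n.
have d0 : normc (1 - (w^*)%C * z) ^+ 2 != 0.
  by rewrite expf_neq0// normc_eq0 kernel_neq0// ltW.
by rewrite -[X in X - _](divff d0) -mulrBl normc_kernelE addrAC subrr add0r.
Qed.

Lemma rho_le1 z w : normc z < 1 -> normc w < 1 -> rho z w <= 1.
Proof.
move=> z1 w1; rewrite -(@ler_pXn2r _ 2)// ?nnegrE ?rho_ge0//.
rewrite expr1n -subr_ge0 rho_sqr// divr_ge0 ?sqr_ge0// mulr_ge0//.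
  by rewrite subr_ge0 expr_le1// ?normc_ge0 ?ltW.
by rewrite subr_ge0 expr_le1// ?normc_ge0 ?ltW.
Qed.

Lemma normc_blaschke_factor w z :
  normc (blaschke_factor w z) = rho z w.
Proof.
rewrite /blaschke_factor /rho; case: eqVneq => [->|w0].
  by rewrite rmorph0 mul0r !subr0 divr1.
rewrite normcM normc_div normc_real ger0_norm ?normc_ge0//.
rewrite divff ?normc_eq0// mul1r !normc_div.
by rewrite normc_distC.
Qed.

End ComplexModulus.

(** * Bounded partial sums and complex limits *)

Section Summation.
Variable R : realType.
Local Notation C := R[i].

(** Boundedness of the partial sums, which for nonnegative terms is convergence
    of the series and is stable under comparison without any limit. *)
Definition summable_seq (c : nat -> R) :=
  exists M : R, forall n, \sum_(0 <= k < n) c k <= M.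

Lemma sum_nat_widen (c : nat -> R) (c0 : forall k, 0 <= c k) m n p q :
  (p <= m)%N -> (n <= q)%N -> \sum_(m <= k < n) c k <= \sum_(p <= k < q) c k.
Proof.
move=> pm nq; have [nm|mn] := leqP n m; first by rewrite big_geq// sumr_ge0.
rewrite [leRHS](@big_cat_nat _ _ _ m)//=; last exact: (leq_trans (ltnW mn)).
rewrite (@big_cat_nat _ _ _ n m q)//=; last exact: ltnW.
by rewrite addrA addrC ler_wpDl ?sumr_ge0// ler_wpDl ?sumr_ge0.
Qed.

Lemma summable_cvg (c : nat -> R) : (forall k, 0 <= c k) ->
  summable_seq c -> cvgn (series c).
Proof.
move=> c0 [M cM]; apply: nondecreasing_is_cvgn.
  by apply/nondecreasing_seqP => n; rewrite /series/= big_nat_recr//= lerDl.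
by exists M => _ [n _ <-]; rewrite /series/= cM.
Qed.

Lemma cvg_summable (c : nat -> R) : (forall k, 0 <= c k) ->
  cvgn (series c) -> summable_seq c.
Proof.
move=> c0 cc; exists (limn (series c)) => n.
apply: (@nondecreasing_cvgn_le _ (series c)) => //.
by apply/nondecreasing_seqP => m; rewrite /series/= big_nat_recr//= lerDl.
Qed.

Lemma summable_tail (c : nat -> R) : (forall k, 0 <= c k) -> summable_seq c ->
  forall e, 0 < e -> exists N, forall m n, (N <= m)%N ->
    \sum_(m <= k < n) c k < e.
Proof.
move=> c0 cs e e0; have cc := summable_cvg c0 cs.
have /cvgrPdist_lt/(_ e e0)[N _ HN] := cc.
exists N => m n Nm.
have le_lim q : series c q <= limn (series c).
  apply: (@nondecreasing_cvgn_le _ (series c)) => //.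
  by apply/nondecreasing_seqP => k; rewrite /series/= big_nat_recr//= lerDl.
have [nm|mn] := leqP n m; first by rewrite big_geq.
have -> : \sum_(m <= k < n) c k = series c n - series c m.
  rewrite /series/= (@big_cat_nat _ _ _ m 0 n)//=; last exact: ltnW.
  by rewrite addrAC subrr add0r.
apply: le_lt_trans (HN m Nm) => /=; rewrite ger0_norm ?subr_ge0//.
by rewrite lerD2r.
Qed.

Lemma summable_le (c d : nat -> R) : (forall k, c k <= d k) ->
  summable_seq d -> summable_seq c.
Proof.
by move=> cd [M dM]; exists M => n; rewrite (le_trans _ (dM n))// ler_sum.
Qed.

Lemma summable_scale (c : nat -> R) (r : R) : 0 <= r ->
  summable_seq c -> summable_seq (fun k => r * c k).
Proof.
by move=> r0 [M cM]; exists (r * M) => n; rewrite -mulr_sumr ler_wpM2l.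
Qed.

(** The norm of the complex numbers takes complex values; this form of
    convergence involves the real modulus only. *)
Lemma cvgC_eps (u : nat -> C) (l : C) :
  (u @ \oo --> l) <->
  (forall e : R, 0 < e -> exists N, forall n, (N <= n)%N -> normc (u n - l) < e).
Proof.
split => [/cvgrPdist_lt ul e e0|ul].
  have /ul[N _ HN] : (0 : C) < (e%:C)%C by rewrite ltcR.
  by exists N => n /HN /=; rewrite normc_distC -ltcR.
apply/cvgrPdist_lt => -[e i] /[!ltcE]/= /andP[/eqP-> e0].
have [N HN] := ul e e0.
exists N => // n /= /HN; rewrite normc_distC -ltcR.
by [].
Qed.

Lemma cvgC_unique (u : nat -> C) (l l' : C) :
  u @ \oo --> l -> u @ \oo --> l' -> l = l'.
Proof.
move=> /cvgC_eps ul /cvgC_eps ul'; apply/eqP; rewrite -subr_eq0 -normc_eq0.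
apply: contraT => h; have e0 : 0 < normc (l - l') / 2.
  by rewrite divr_gt0// lt_def h normc_ge0.
have [N HN] := ul _ e0; have [N' HN'] := ul' _ e0.
have := HN _ (leq_maxl N N'); have := HN' _ (leq_maxr N N').
move: (u _) => v h1 h2.
have := normc_dist_triangle v l l'; rewrite (normc_distC l v) => h3.
have := le_lt_trans h3 (ltrD h2 h1); by rewrite -splitr ltxx.
Qed.

Lemma normc_cvg (u : nat -> C) (l : C) : u @ \oo --> l ->
  (fun n => normc (u n)) @ \oo --> normc l.
Proof.
move=> /cvgC_eps ul; apply/cvgrPdist_lt => e /ul[N HN].
exists N => // n /= /HN; apply: le_lt_trans.
rewrite ler_norml lerNl opprB normc_lower/=.
by rewrite normc_distC normc_lower.
Qed.

Lemma cvgC_of_Re_Im (u : nat -> C) (a b : R) :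
  (fun n => complex.Re (u n)) @ \oo --> a ->
  (fun n => complex.Im (u n)) @ \oo --> b -> u @ \oo --> (a +i* b)%C.
Proof.
move=> /cvgrPdist_lt ua /cvgrPdist_lt ub; apply/cvgC_eps => e e0.
have e2 : 0 < e / 2 by rewrite divr_gt0.
have [N _ HN] := ua _ e2; have [N' _ HN'] := ub _ e2.
exists (maxn N N') => // n; rewrite geq_max => /andP[/HN/= h1 /HN'/= h2].
apply: le_lt_trans (normc_le_ReIm _) _.
rewrite [e]splitr ltrD//.
  by move: h1; rewrite distrC; case: (u n).
by move: h2; rewrite distrC; case: (u n).
Qed.

(** The increments of [u] are dominated by a summable sequence, so each
    coordinate plus the partial sums of that sequence is monotone bounded. *)
Lemma cvgC_of_increments (u : nat -> C) (c : nat -> R) :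
  (forall n, normc (u n.+1 - u n) <= c n) -> summable_seq c ->
  exists l : C, u @ \oo --> l.
Proof.
move=> uc sc; have c0 k : 0 <= c k by exact: le_trans (normc_ge0 _) (uc k).
have [M cM] := sc.
have H (v : nat -> R) : (forall n, `|v n.+1 - v n| <= c n) -> cvgn v.
  move=> vc; have -> : v = (v \+ series c) \- series c.
    by apply/funext => n /=; rewrite addrK.
  apply: is_cvgB; last exact: summable_cvg.
  apply: nondecreasing_is_cvgn.
    apply/nondecreasing_seqP => n; rewrite /= /series/= big_nat_recr//= addrA.
    by move: (vc n); rewrite ler_norml => /andP[h _]; lra.
  exists (v 0%N + M + M) => _ [n _ <-] /=.
  rewrite lerD//; last by rewrite /series/= cM.
  rewrite -lerBlDl (le_trans _ (cM n))// -telescope_sumr//.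
  by apply: ler_sum => k _; exact: le_trans (ler_norm _) (vc k).
have /cvg_ex[a ua] : cvgn (fun n => complex.Re (u n)).
  apply: H => n; apply: le_trans (uc n).
  by apply: le_trans (normc_Re _); case: (u n.+1) => ? ?; case: (u n).
have /cvg_ex[b ub] : cvgn (fun n => complex.Im (u n)).
  apply: H => n; apply: le_trans (uc n).
  by apply: le_trans (normc_Im _); case: (u n.+1) => ? ?; case: (u n).
by exists (a +i* b)%C; exact: cvgC_of_Re_Im.
Qed.

Lemma normc_lim_le (u : nat -> C) (l z : C) (M : R) : u @ \oo --> l ->
  (exists N, forall n, (N <= n)%N -> normc (u n - z) <= M) -> normc (l - z) <= M.
Proof.
move=> /cvgC_eps ul [N HN]; apply/ler_addgt0Pr => e /ul[N' HN'].
have := HN (maxn N N') (leq_maxl _ _).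
have := HN' (maxn N N') (leq_maxr _ _).
move: (u _) => v; rewrite normc_distC => h1 h2.
apply: le_trans (normc_dist_triangle v _ _) _.
by rewrite addrC lerD// ltW.
Qed.

End Summation.

(** * Infinite products of functions bounded by one *)

Section InfiniteProducts.
Variable R : realType.
Local Notation C := R[i].
Implicit Types (f : nat -> C) (c : nat -> R).

Lemma normc_prod_le1 f m n : (forall k, normc (f k) <= 1) ->
  normc (\prod_(m <= k < n) f k) <= 1.
Proof.
move=> f1; elim/big_ind : _ => [|x y x1 y1|//]; first by rewrite normc1.
by rewrite normcM mulr_ile1 ?normc_ge0.
Qed.

(** As all factors have modulus at most one, an infinite product behaves like a
    series: each new factor moves the partial product by at most its own
    deviation from one. *)
Lemma prod_dist_le f c m n : (forall k, normc (f k) <= 1) ->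
  (forall k, normc (1 - f k) <= c k) -> (m <= n)%N ->
  normc (\prod_(0 <= k < n) f k - \prod_(0 <= k < m) f k)
    <= \sum_(m <= k < n) c k.
Proof.
move=> f1 fc; elim: n => [|n ih].
  by rewrite leqn0 => /eqP->; rewrite subrr normc0 big_geq.
rewrite leq_eqVlt => /predU1P[->|]; first by rewrite subrr normc0 big_geq.
rewrite ltnS => mn; rewrite [leRHS]big_nat_recr//= addrC.
apply: le_trans (normc_dist_triangle (\prod_(0 <= k < n) f k) _ _) _.
rewrite lerD ?ih// big_nat_recr//= -[X in _ - X]mulr1 -mulrBr normcM.
rewrite normc_distC (le_trans _ (fc n))// ler_piMl ?normc_ge0//.
exact: normc_prod_le1.
Qed.

Lemma prod_cvg f c : (forall k, normc (f k) <= 1) ->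
  (forall k, normc (1 - f k) <= c k) -> summable_seq c ->
  exists l : C, (\prod_(0 <= k < n) f k) @[n --> \oo] --> l.
Proof.
move=> f1 fc sc; apply: cvgC_of_increments sc => n.
by apply: le_trans (prod_dist_le f1 fc (leqnSn n)) _; rewrite big_nat1.
Qed.

Lemma prod_lim_dist f c (l : C) m (e : R) : (forall k, normc (f k) <= 1) ->
  (forall k, normc (1 - f k) <= c k) ->
  (forall n, \sum_(m <= k < n) c k <= e) ->
  (\prod_(0 <= k < n) f k) @[n --> \oo] --> l ->
  normc (l - \prod_(0 <= k < m) f k) <= e.
Proof.
move=> f1 fc ce fl; apply: normc_lim_le fl _; exists m => n mn.
by apply: le_trans (ce n); exact: prod_dist_le.
Qed.

(** The elementary inequality [prod (1 - c k) >= 1 - sum (c k)], with the moduli of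
    the factors in place of [1 - c k]. *)
Lemma normc_prod_lower f c m n : (forall k, normc (f k) <= 1) ->
  (forall k, normc (1 - f k) <= c k) -> (m <= n)%N ->
  1 - \sum_(m <= k < n) c k <= normc (\prod_(m <= k < n) f k).
Proof.
move=> f1 fc; elim: n => [|n ih].
  by rewrite leqn0 => /eqP->; rewrite !big_geq// subr0 normc1.
rewrite leq_eqVlt => /predU1P[->|]; first by rewrite !big_geq// subr0 normc1.
rewrite ltnS => mn; have := ih mn; rewrite !big_nat_recr//= normcM.
have := normc_prod_le1 m n f1; move: (normc (\prod_(m <= _ < n) _)) => p p1.
have := fc n; have := normc_lower (1 : C) (1 - f n); rewrite normc1 subKr.
have := f1 n; have := normc_ge0 (f n).
move: (normc (f n)) (normc (1 - f n)) (\sum_(_ <= _ < _) _) => u v s.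
move=> u0 u1 uv vc sp; suff : p - p * u <= 1 - u by lra.
by rewrite -subr_ge0; have := mulr_ge0 (_ : 0 <= 1 - p) (_ : 0 <= 1 - u); lra.
Qed.

(** Beyond an index where the tail of the deviations is at most one half, the
    factors multiply to a modulus of at least one half. *)
Lemma prod_lim_neq0 f c (l : C) : (forall k, normc (f k) <= 1) ->
  (forall k, normc (1 - f k) <= c k) -> summable_seq c ->
  (forall k, f k != 0) ->
  (\prod_(0 <= k < n) f k) @[n --> \oo] --> l -> l != 0.
Proof.
move=> f1 fc sc f0 fl; have c0 k : 0 <= c k := le_trans (normc_ge0 _) (fc k).
have half0 : (0 : R) < 1 / 2 by rewrite divr_gt0.
have [N HN] := summable_tail c0 sc half0.
have p0 : 0 < normc (\prod_(0 <= k < N) f k).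
  by rewrite normc_gt0 prodf_seq_neq0; apply/allP => k _; rewrite f0.
set p := normc _ in p0.
apply/eqP => l0; have p2 : 0 < p / 2 by rewrite divr_gt0.
have [N' HN'] := (cvgC_eps _ _).1 fl _ p2.
have := HN' (maxn N N') (leq_maxr _ _); rewrite l0 subr0.
rewrite (@big_cat_nat _ _ _ N)//= ?leq_maxl// normcM -/p.
rewrite ltr_pM2l// ltNge.
have := normc_prod_lower f1 fc (leq_maxl N N').
have := HN N (maxn N N') (leqnn _); move=> h1 h2.
suff -> : (2^-1 : R) <= normc (\prod_(N <= k < maxn N N') f k) by [].
lra.
Qed.

End InfiniteProducts.

Section DerivableProducts.
Variable R : realType.
Local Notation C := R[i].

(** A quadratic remainder is more than differentiability asks for, but it has an
    explicit constant, so that it can be carried through infinite products. *)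
Lemma derivable_of_second_order (F : C -> C) (z A : C) (E r : R) : 0 < r ->
  (forall w : C, normc (w - z) < r ->
     normc (F w - F z - A * (w - z)) <= E * normc (w - z) ^+ 2) ->
  derivable F z 1.
Proof.
move=> r0 HF; apply/cvg_ex; exists A; apply/cvgrPdist_lt => -[e i].
rewrite ltcE /= => /andP[/eqP-> e0].
have E1 : 0 < `|E| + 1 by rewrite ltr_wpDl.
have m0 : 0 < Num.min r (e / (`|E| + 1)) by rewrite lt_min r0 divr_gt0.
rewrite near_withinE; apply/nbhs_normP.
exists ((Num.min r (e / (`|E| + 1)))%:C)%C; first by rewrite /= ltcR.
move=> h /=; rewrite sub0r normrN => hm h0.
have nh : normc h < Num.min r (e / (`|E| + 1)) by rewrite -ltcR.
rewrite -[X in X < _]/((normc (A - h^-1 * (F (h * 1 + z) - F z)))%:C)%C ltcR.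
have := HF (h + z); rewrite addrK mulr1.
move: nh; rewrite lt_min => /andP[hr he] /(_ hr) Hb.
have n0 : 0 < normc h by rewrite normc_gt0.
have -> : A - h^-1 * (F (h + z) - F z) = - (h^-1 * (F (h + z) - F z - A * h)).
  by field.
rewrite normc_opp normcM normcV mulrC ltr_pdivrMr//.
apply: le_lt_trans Hb _; rewrite expr2 mulrA ltr_pM2r//.
apply: le_lt_trans (_ : (`|E| + 1) * normc h < _).
  by rewrite ler_wpM2r ?normc_ge0// (le_trans (ler_norm _))// lerDl.
by rewrite mulrC -ltr_pdivlMr.
Qed.

(** The partial products satisfy a second-order Taylor estimate whose constant
    grows by a multiple of [c k] at each factor, hence stays bounded; the
    estimate passes to the limit. *)
Lemma derivable_prod (f : nat -> C -> C) (F : C -> C) (z : C) (d : nat -> C)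
    (c : nat -> R) (r : R) : 0 < r <= 1 ->
  (forall w : C, normc (w - z) < r -> normc w < 1) ->
  (forall k (w : C), normc w < 1 -> normc (f k w) <= 1) ->
  (forall k, normc (1 - f k z) <= c k) ->
  (forall k, normc (d k) <= c k) ->
  (forall k (w : C), normc (w - z) < r ->
     normc (f k w - f k z - d k * (w - z)) <= c k * normc (w - z) ^+ 2) ->
  (forall w : C, normc w < 1 -> (\prod_(0 <= k < n) f k w) @[n --> \oo] --> F w) ->
  summable_seq c -> derivable F z 1.
Proof.
move=> /andP[r0 r1] rD f1 fc dc fd fF sc.
have c0 k : 0 <= c k := le_trans (normc_ge0 _) (dc k).
have z1 : normc z < 1 by apply: rD; rewrite subrr normc0.
pose p n w := \prod_(0 <= k < n) f k w.
(* [A n] is the derivative at [z] of the [n]-th partial product, by the product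
   rule. *)
pose fix A n := if n is m.+1 then A m * f m z + p m z * d m else 0 : C.
have p1 n w : normc w < 1 -> normc (p n w) <= 1.
  by move=> w1; apply: normc_prod_le1 => k; exact: f1.
have AS n : A n.+1 = A n * f n z + p n z * d n by [].
have Ac n : normc (A n) <= \sum_(0 <= k < n) c k.
  elim: n => [|n ih]; first by rewrite big_geq// normc0.
  rewrite AS big_nat_recr//= (le_trans (normc_triangle _ _))// lerD//.
    by rewrite normcM (le_trans _ ih)// ler_piMr ?normc_ge0 ?f1.
  by rewrite normcM (le_trans _ (dc n))// ler_piMl ?normc_ge0 ?p1.
have [M cM] := sc.
have M0 : 0 <= M by apply: le_trans (cM 0%N); rewrite big_geq.
have [L AL] : exists L : C, A @ \oo --> L.
  apply: (@cvgC_of_increments _ _ (fun n => (M + 1) * c n)).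
    move=> n; rewrite AS.
    have -> : A n * f n z + p n z * d n - A n = A n * (f n z - 1) + p n z * d n.
      by ring.
    rewrite (le_trans (normc_triangle _ _))// [leRHS]mulrDl mul1r.
    rewrite lerD// normcM.
      by rewrite ler_pM ?normc_ge0 ?(le_trans (Ac n))// normc_distC.
    by rewrite (le_trans _ (dc n))// ler_piMl ?normc_ge0 ?p1.
  by apply: summable_scale => //; rewrite addr_ge0.
have pE n w : normc (w - z) < r ->
    normc (p n w - p n z - A n * (w - z)) <=
    (2 * M + 1) * (\sum_(0 <= k < n) c k) * normc (w - z) ^+ 2.
  move=> wr; elim: n => [|n ih].
    by rewrite /p !big_geq// subrr mul0r subrr normc0 mulr0 mul0r.
  have pS v : p n.+1 v = p n v * f n v by rewrite /p big_nat_recr.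
  rewrite AS !pS big_nat_recr//=.
  (* The remainder of the product splits into the remainder of the previous partial
     product, a product of two first-order increments, and the remainder of the new
     factor. *)
  have -> : p n w * f n w - p n z * f n z - (A n * f n z + p n z * d n) * (w - z)
      = (p n w - p n z - A n * (w - z)) * f n w
        + (A n * (w - z) * (f n w - f n z)
        + p n z * (f n w - f n z - d n * (w - z))) by ring.
  rewrite [X in _ <= X * _]mulrDr [leRHS]mulrDl (le_trans (normc_triangle _ _))// lerD//.
    by rewrite normcM (le_trans _ ih)// ler_piMr ?normc_ge0 ?f1// rD.
  rewrite (le_trans (normc_triangle _ _))// [X in _ <= X * _]mulrDl [leRHS]mulrDl.
  rewrite lerD//; last first.
    by rewrite mul1r normcM (le_trans _ (fd n w wr))// ler_piMl ?normc_ge0 ?p1.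
  have fw : normc (f n w - f n z) <= 2 * c n * normc (w - z).
    have -> : f n w - f n z = (f n w - f n z - d n * (w - z)) + d n * (w - z).
      by rewrite subrK.
    rewrite (le_trans (normc_triangle _ _))// normcM.
    have := fd n w wr; have := dc n; have := normc_ge0 (w - z); have := c0 n.
    move: (normc (w - z)) wr (normc (d n)) (normc (_ - _ - _)) => h wr x y cn0 h0 xc yc.
    have hh : h ^+ 2 <= h by rewrite expr2 ler_piMr//; lra.
    have h1 : c n * h ^+ 2 <= c n * h by rewrite ler_wpM2l.
    have h2 : x * h <= c n * h by rewrite ler_wpM2r.
    lra.
  rewrite !normcM -mulrA.
  apply: le_trans (_ : M * (normc (w - z) * (2 * c n * normc (w - z))) <= _).
    by rewrite ler_pM ?normc_ge0 ?mulr_ge0 ?normc_ge0 ?(le_trans (Ac n))//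
      ler_wpM2l ?normc_ge0.
  by rewrite le_eqVlt; apply/orP; left; apply/eqP; ring.
apply: (@derivable_of_second_order F z L ((2 * M + 1) * M) r) => // w wr.
have w1 := rD w wr.
suff pL : (p n w - p n z - A n * (w - z)) @[n --> \oo] --> F w - F z - L * (w - z).
  rewrite -[X in normc X]subr0; apply: normc_lim_le pL _; exists 0%N => n _.
  rewrite subr0 (le_trans (pE n w wr))// ler_wpM2r ?sqr_ge0//.
  by rewrite ler_wpM2l// addr_ge0// mulr_ge0.
apply/cvgC_eps => e e0.
have e3 : 0 < e / 3 by rewrite divr_gt0.
have [N1 H1] := (cvgC_eps _ _).1 (fF w w1) _ e3.
have [N2 H2] := (cvgC_eps _ _).1 (fF z z1) _ e3.
have [N3 H3] := (cvgC_eps _ _).1 AL _ e3.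
exists (maxn N1 (maxn N2 N3)) => n; rewrite !geq_max => /and3P[/H1 h1 /H2 h2 /H3 h3].
have -> : p n w - p n z - A n * (w - z) - (F w - F z - L * (w - z)) =
  (p n w - F w) - (p n z - F z) - (A n - L) * (w - z) by ring.
apply: le_lt_trans (normc_triangleB _ _) _.
apply: le_lt_trans (lerD (normc_triangleB _ _) (lexx _)) _.
rewrite normcM.
have : normc (A n - L) * normc (w - z) <= normc (A n - L).
  by rewrite ler_piMr ?normc_ge0// (le_trans (ltW wr)).
rewrite -/(p n w) -/(p n z) in h1 h2; lra.
Qed.

End DerivableProducts.

Section RadialLimits.
Variable R : realType.
Local Notation C := R[i].
Implicit Types (g : R -> C) (l : C).

Lemma cvgC_left1_eps g l :
  (g r @[r --> (1 : R)^'-] --> l) <->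
  (forall e, 0 < e -> exists2 d, 0 < d &
     forall r, 1 - d < r -> r < 1 -> normc (g r - l) < e).
Proof.
split => [/cvgrPdist_lt gl e e0|gl].
  have /gl : (0 : C) < (e%:C)%C by rewrite ltcR.
  rewrite near_withinE => /nbhs_normP[d /= d0 Hd].
  exists d => // r r1 r2.
  rewrite normc_distC -ltcR; apply: (Hd r) => //=.
  by rewrite ltr_norml; apply/andP; split; lra.
apply/cvgrPdist_lt => -[e i] /[!ltcE]/= /andP[/eqP-> e0].
have [d d0 Hd] := gl e e0.
rewrite near_withinE; apply/nbhs_normP; exists d => //= r /=.
rewrite ltr_norml => /andP[r1 r2] r3.
rewrite -[X in X < _]/((normc (l - g r))%:C)%C ltcR normc_distC.
by apply: Hd => //; lra.
Qed.

(** Products of radial limits, from the bounds by one that hold in the disc. *)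
Lemma radial_limitM (g1 g2 : R -> C) l1 l2 :
  (forall r, 0 <= r < 1 -> normc (g2 r) <= 1) -> normc l1 <= 1 ->
  g1 r @[r --> (1 : R)^'-] --> l1 -> g2 r @[r --> (1 : R)^'-] --> l2 ->
  (g1 r * g2 r) @[r --> (1 : R)^'-] --> l1 * l2.
Proof.
move=> b2 b1 /cvgC_left1_eps h1 /cvgC_left1_eps h2; apply/cvgC_left1_eps => e e0.
have e2 : 0 < e / 2 by rewrite divr_gt0.
have [d1 d10 H1] := h1 _ e2; have [d2 d20 H2] := h2 _ e2.
exists (Num.min 1 (Num.min d1 d2)); first by rewrite !lt_min ltr01 d10.
move=> r rd r1.
have [r0 rd1 rd2] : [/\ 0 <= r, 1 - d1 < r & 1 - d2 < r].
  move: rd; rewrite ltrBlDr -ltrBlDl !lt_min.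
  by move=> /and3P[? ? ?]; split; lra.
have -> : g1 r * g2 r - l1 * l2 = (g1 r - l1) * g2 r + l1 * (g2 r - l2) by ring.
rewrite (le_lt_trans (normc_triangle _ _))// [ltRHS]splitr !normcM ltr_leD//.
  apply: le_lt_trans (H1 r rd1 r1).
  by rewrite ler_piMr ?normc_ge0 ?b2 ?r0.
by apply: le_trans (ltW (H2 r rd2 r1)); rewrite ler_piMl ?normc_ge0.
Qed.

Lemma normc_circle_scale (r : R) (u : C) : 0 <= r -> normc u = 1 ->
  normc ((r%:C)%C * u) = r.
Proof. by move=> r0 u1; rewrite normcM u1 mulr1 normc_real ger0_norm. Qed.

(** Uniform smallness of the tails along the radius lets the radial limit be
    taken factor by factor. *)
Lemma radial_limit_prod (f : nat -> C -> C) (F : C -> C) (u : C) (l : nat -> C)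
    (c : nat -> R) : normc u = 1 ->
  (forall k (w : C), normc w < 1 -> normc (f k w) <= 1) ->
  (forall k r, 0 <= r < 1 -> normc (1 - f k ((r%:C)%C * u)) <= c k) ->
  (forall k, f k ((r%:C)%C * u) @[r --> (1 : R)^'-] --> l k) ->
  (forall k, normc (l k) = 1) ->
  (forall w : C, normc w < 1 -> (\prod_(0 <= k < n) f k w) @[n --> \oo] --> F w) ->
  summable_seq c ->
  exists2 L : C, normc L = 1 & F ((r%:C)%C * u) @[r --> (1 : R)^'-] --> L.
Proof.
move=> u1 f1 fc fl l1 fF sc.
have ru r : 0 <= r < 1 -> normc ((r%:C)%C * u) < 1.
  by move=> /andP[r0 r1]; rewrite normc_circle_scale.
have lc k : normc (1 - l k) <= c k.
  apply/ler_addgt0Pr => e e0.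
  have [d d0 Hd] := (cvgC_left1_eps _ _).1 (fl k) _ e0.
  pose r := Num.max 0 (1 - d / 2).
  have r01 : 0 <= r < 1.
    by rewrite /r le_max lexx/= gt_max ltr01/= ltrBlDr ltrDl divr_gt0.
  have := Hd r _ (andP r01).2; have /= := fc k r r01.
  have rd : 1 - d < r by rewrite lt_max; apply/orP; right; lra.
  move=> h1 /(_ rd) h2.
  apply: le_trans (normc_dist_triangle (f k ((r%:C)%C * u)) _ _) _.
  by rewrite lerD// ltW.
have c0 k : 0 <= c k := le_trans (normc_ge0 _) (lc k).
have l1' k : normc (l k) <= 1 by rewrite l1.
have [L lL] := prod_cvg l1' lc sc; exists L.
  have := normc_cvg lL; under eq_fun do rewrite normc_prod big1//.
  by move=> h; apply: (cvg_unique _ h (cvg_cst _)); exact: Rhausdorff.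
apply/cvgC_left1_eps => e e0; have e3 : 0 < e / 3 by rewrite divr_gt0.
have [N HN] := summable_tail c0 sc e3.
have HN' n : \sum_(N <= k < n) c k <= e / 3 by rewrite ltW ?HN.
have : (\prod_(0 <= k < N) f k ((r%:C)%C * u)) @[r --> (1 : R)^'-]
    --> \prod_(0 <= k < N) l k.
  elim: (N) => [|n ih].
    apply/cvgC_left1_eps => e' e'0; exists 1 => // r _ _.
    by rewrite !big_geq// subrr normc0.
  have -> : \prod_(0 <= k < n.+1) l k = \prod_(0 <= k < n) l k * l n.
    by rewrite big_nat_recr.
  have -> : (fun r : R => \prod_(0 <= k < n.+1) f k ((r%:C)%C * u)) =
      (fun r : R => \prod_(0 <= k < n) f k ((r%:C)%C * u) * f n ((r%:C)%C * u)).
    by apply/funext => r; rewrite big_nat_recr.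
  apply: (radial_limitM _ _ ih (fl n)); last exact: normc_prod_le1.
  by move=> r r01; rewrite f1 ?ru.
move=> /cvgC_left1_eps/(_ _ e3)[d d0 Hd].
exists (Num.min d 1); first by rewrite lt_min d0 ltr01.
move=> r rd r1.
have [r0 rd1] : 0 <= r /\ 1 - d < r.
  by move: rd; rewrite ltrBlDr -ltrBlDl lt_min => /andP[? ?]; split; lra.
have r01 : 0 <= r < 1 by rewrite r0.
have A := prod_lim_dist (fun k => f1 k _ (ru r r01)) (fun k => fc k r r01)
  HN' (fF _ (ru r r01)).
have B := prod_lim_dist l1' lc HN' lL.
have D := Hd r rd1 r1.
apply: le_lt_trans (normc_dist_triangle (\prod_(0 <= k < N) f k ((r%:C)%C * u)) _ _) _.
have := normc_dist_triangle (\prod_(0 <= k < N) l k)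
  (\prod_(0 <= k < N) f k ((r%:C)%C * u)) L.
rewrite (normc_distC L) in B; lra.
Qed.

End RadialLimits.

(** * Atomic singular functions *)

Section ComplexExponential.
Variable R : realType.
Local Notation C := R[i].

Lemma sin_abs_le (y : R) : `|sin y| <= `|y|.
Proof.
wlog y0 : y / 0 <= y.
  move=> H; have [/H//|/ltW y0] := leP 0 y.
  by rewrite -normrN -sinN -[leRHS]normrN H// oppr_ge0.
have [c _] := MVT_segment y0 (fun x _ => @is_derive_sin R x)
  (continuous_subspaceT (@continuous_sin R)).
rewrite sin0 !subr0 => ->; rewrite normrM ler_piMl//.
by rewrite cos_max.
Qed.

Lemma one_sub_cos_le (y : R) : `|cos y - 1| <= y ^+ 2.
Proof.
have e : 1 - cos y = 2 * sin (y / 2) ^+ 2.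
  have -> : y = (y / 2) *+ 2 by rewrite mulr2n -splitr.
  rewrite cos_mulr2n -mulr_natr -[in RHS](mulr_natr (y / 2)) mulfK ?pnatr_eq0//.
  by rewrite sin2cos2; ring.
have c1 : 0 <= 1 - cos y by rewrite subr_ge0 cos_le1.
rewrite distrC ger0_norm// e.
have := sin_abs_le (y / 2); rewrite -(@ler_pXn2r _ 2)// ?nnegrE//.
rewrite !real_normK ?num_real// => h; have := sqr_ge0 y.
by rewrite expr_div_n in h; lra.
Qed.

Lemma sin_sub_le (y : R) : `|y| <= 1 -> `|sin y - y| <= y ^+ 2.
Proof.
wlog y0 : y / 0 <= y.
  move=> H; have [/H//|/ltW y0 y1] := leP 0 y.
  have -> : sin y - y = - (sin (- y) - - y) by rewrite sinN; ring.
  by rewrite normrN -sqrrN H ?oppr_ge0// normrN.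
rewrite ger0_norm// => y1.
have [c] := MVT_segment y0 (fun x _ => @is_derive_sin R x)
  (continuous_subspaceT (@continuous_sin R)).
rewrite in_itv/= => /andP[c0 cy]; rewrite sin0 !subr0 => ->.
have -> : cos c * y - y = (cos c - 1) * y by ring.
rewrite normrM (ger0_norm y0) expr2 ler_wpM2r//.
apply: le_trans (one_sub_cos_le c) _; rewrite expr2.
apply: le_trans (_ : y * 1 <= _); last by rewrite mulr1.
by rewrite ler_pM// (le_trans cy).
Qed.

Lemma expR_sub_le (x : R) : `|x| <= 1 / 2 -> `|expR x - 1 - x| <= 2 * x ^+ 2.
Proof.
move=> x1; have := expR_ge1Dx x; have := expR_ge1Dx (- x).
rewrite expRN; have := expR_gt0 x; move: (expR x) => e e0 h1 h2.
rewrite ger0_norm; last lra.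
move: x1; rewrite ler_norml => /andP[xl xu].
have h3 : e * (1 - x) <= 1.
  by rewrite -[leRHS](mulfV (lt0r_neq0 e0)) ler_wpM2l// ltW.
nra.
Qed.

Lemma cisD (s t : R) : cis (s + t) = cis s * cis t.
Proof. by rewrite /cis cosD sinD; simpc; congr (_ +i* _)%C; ring. Qed.

Lemma normc_cis (t : R) : normc (cis t) = 1.
Proof. by rewrite /= cos2Dsin2 sqrtr1. Qed.

Lemma cexpD (z w : C) : cexp (z + w) = cexp z * cexp w.
Proof.
rewrite /cexp; case: z w => a b [c d] /=.
by rewrite expRD cisD rmorphM/= mulrACA.
Qed.

Lemma cexp0 : cexp 0 = 1 :> C.
Proof. by rewrite /cexp /cis /= expR0 cos0 sin0 rmorph1 mul1r. Qed.

Lemma normc_cexp (z : C) : normc (cexp z) = expR (complex.Re z).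
Proof.
by rewrite /cexp normcM normc_cis mulr1 normc_real ger0_norm ?expR_ge0.
Qed.

(** The Taylor estimates of the exponential of a real number, of the cosine and of
    the sine are combined coordinate by coordinate. *)
Lemma cexp_second_order (v : C) : normc v <= 1 / 2 ->
  normc (cexp v - 1 - v) <= 8 * normc v ^+ 2.
Proof.
case: v => x y; set v := (x +i* y)%C => v1.
have xv : `|x| <= normc v by exact: (normc_Re v).
have yv : `|y| <= normc v by exact: (normc_Im v).
move: (normc v) (normc_ge0 v) v1 xv yv => n n0 n1 xn yn.
apply: le_trans (normc_le_ReIm _) _.
have x2 : x ^+ 2 <= n ^+ 2.
  by rewrite -(real_normK (num_real x)) ler_pXn2r// nnegrE.
have y2 : y ^+ 2 <= n ^+ 2.
  by rewrite -(real_normK (num_real y)) ler_pXn2r// nnegrE.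
have hx := expR_sub_le (le_trans xn n1).
have hc := one_sub_cos_le y.
have hs : `|sin y - y| <= y ^+ 2 by apply: sin_sub_le; lra.
have hs' := sin_abs_le y.
have e2 : expR x <= 2.
  move: hx; rewrite ler_norml => /andP[_ hx]; move: xn; rewrite ler_norml => /andP[_ xn].
  have : x ^+ 2 <= (1 / 2) ^+ 2 by apply: le_trans x2 _; rewrite ler_pXn2r ?nnegrE//; lra.
  lra.
have e1 : `|expR x - 1| <= 2 * n.
  have -> : expR x - 1 = (expR x - 1 - x) + x by ring.
  rewrite (le_trans (ler_normD _ _))//.
  have : n ^+ 2 <= n * (1 / 2) by rewrite expr2 ler_wpM2l.
  lra.
rewrite /v /cexp /cis /=; simpc => /=.
have -> : expR x * cos y - 1 - x = (expR x - 1 - x) + expR x * (cos y - 1) by ring.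
have -> : expR x * sin y - y = (sin y - y) + (expR x - 1) * sin y by ring.
have A : `|expR x - 1 - x + expR x * (cos y - 1)| <= 4 * n ^+ 2.
  rewrite (le_trans (ler_normD _ _))// normrM (ger0_norm (expR_ge0 _)).
  have : expR x * `|cos y - 1| <= 2 * n ^+ 2.
    by rewrite ler_pM ?expR_ge0// (le_trans hc).
  lra.
have B : `|sin y - y + (expR x - 1) * sin y| <= 3 * n ^+ 2.
  rewrite (le_trans (ler_normD _ _))// normrM.
  have : `|expR x - 1| * `|sin y| <= 2 * n * n by rewrite ler_pM// (le_trans hs').
  have -> : 2 * n * n = 2 * n ^+ 2 by ring.
  lra.
have := sqr_ge0 n; lra.
Qed.

(** In the left half-plane the exponential is bounded by one, so the estimate
    holds for [v] of any size. *)
Lemma cexp_deviation (v : C) : complex.Re v <= 0 ->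
  normc (1 - cexp v) <= 4 * normc v.
Proof.
case: v => x y; set v := (x +i* y)%C => vx; have x0 : x <= 0 := vx.
have xv : `|x| <= normc v by exact: (normc_Re v).
have yv : `|y| <= normc v by exact: (normc_Im v).
move: (normc v) xv yv => n xn yn.
apply: le_trans (normc_le_ReIm _) _.
rewrite /cexp /cis /=; simpc => /=.
have e1 : expR x <= 1 by rewrite -expR0 ler_expR.
have e0 := expR_ge0 x; have ex := expR_ge1Dx x.
have hs : `|expR x * sin y| <= `|y|.
  rewrite normrM (ger0_norm e0) (le_trans _ (sin_abs_le y))//.
  by rewrite ler_piMl.
have hc : `|1 - expR x * cos y| <= `|x| + 2 * `|y|.
  have -> : 1 - expR x * cos y = (1 - expR x) + expR x * (1 - cos y) by ring.
  rewrite (le_trans (ler_normD _ _))// lerD//.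
    by rewrite ger0_norm ?(ler0_norm x0); lra.
  rewrite normrM (ger0_norm e0).
  apply: le_trans (_ : `|1 - cos y| <= _); first by rewrite ler_piMl.
  have [y2|y2] := leP 1 `|y|.
    by have := cos_geN1 y; have := cos_le1 y => h1 h2; rewrite ger0_norm; lra.
  rewrite distrC (le_trans (one_sub_cos_le y))//.
  rewrite -(real_normK (num_real y)) expr2.
  have : `|y| * `|y| <= `|y| * 1 by rewrite ler_wpM2l// ltW.
  have := normr_ge0 y; lra.
rewrite normrN; lra.
Qed.

Lemma cexp_cvg (u : nat -> C) (v : C) :
  (fun n => complex.Re (u n)) @ \oo --> complex.Re v ->
  (fun n => complex.Im (u n)) @ \oo --> complex.Im v ->
  (cexp (u n)) @[n --> \oo] --> cexp v.
Proof.
move=> ua ub.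
have -> : cexp v = ((expR (complex.Re v) * cos (complex.Im v))
    +i* (expR (complex.Re v) * sin (complex.Im v)))%C.
  by rewrite /cexp /cis; simpc.
apply: cvgC_of_Re_Im.
  have -> : (fun n => complex.Re (cexp (u n))) =
     (fun n => expR (complex.Re (u n)) * cos (complex.Im (u n))).
    by apply/funext => n; rewrite /cexp /cis /=; simpc.
  apply: cvgM; apply: continuous_cvg => //.
    exact: continuous_expR.
  exact: continuous_cos.
have -> : (fun n => complex.Im (cexp (u n))) =
   (fun n => expR (complex.Re (u n)) * sin (complex.Im (u n))).
  by apply/funext => n; rewrite /cexp /cis /=; simpc.
apply: cvgM; apply: continuous_cvg => //.
  exact: continuous_expR.
exact: continuous_sin.
Qed.

End ComplexExponential.

Section AtomicIntegrals.
Variable R : realType.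
Local Notation C := R[i].

(** The Borel sets are generated by the open sets of a norm with complex values;
    this criterion lets the real modulus decide which sets are open. *)
Lemma openC_of_eps (A : set C) :
  (forall w, A w -> exists2 e, 0 < e & forall v : C, normc (v - w) < e -> A v) ->
  open A.
Proof.
move=> H; rewrite openE => w /H[e e0 He].
apply/nbhs_normP; exists (e%:C)%C; first by rewrite /= ltcR.
by move=> v /= vw; apply: He; rewrite normc_distC -ltcR.
Qed.

Lemma circle_measurable : measurable (@unit_circle R : set (borelC R)).
Proof.
rewrite -[X in measurable X]setCK; apply: measurableC.
apply: sub_sigma_algebra; apply: openC_of_eps => w /= w1.
exists `|normc w - 1|; first by rewrite normr_gt0 subr_eq0; apply/eqP.
move=> v vw v1; have {}v1 : normc v = 1 := v1.
move: vw; rewrite normc_distC -v1 ltNge => /negP; apply.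
by rewrite ler_norml normc_lower lerNl opprB andbT normc_distC normc_lower.
Qed.

Definition herglotz_kernel (z xi : C) : C := (xi + z) / (xi - z).

Lemma circle_sub_lower (z xi : C) : normc xi = 1 -> 1 - normc z <= normc (xi - z).
Proof. by move=> <-; exact: normc_lower. Qed.

Lemma circle_sub_gt0 (z xi : C) : normc z < 1 -> normc xi = 1 ->
  0 < normc (xi - z).
Proof. by move=> z1 x1; apply: lt_le_trans (circle_sub_lower z x1); rewrite subr_gt0. Qed.

Lemma herglotz_kernel_bound (z xi : C) : normc z < 1 -> normc xi = 1 ->
  normc (herglotz_kernel z xi) <= 2 / (1 - normc z).
Proof.
move=> z1 x1; rewrite normc_div ler_pM ?invr_ge0 ?normc_ge0//.
  by apply: le_trans (normc_triangle _ _) _; rewrite x1; lra.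
by rewrite lef_pV2 ?posrE ?circle_sub_gt0 ?subr_gt0// circle_sub_lower.
Qed.

(** Continuity of the kernel in the boundary variable, from the explicit formula
    for its increments. *)
Lemma herglotz_kernel_eps (z w : C) (e : R) : 0 < e -> w != z ->
  exists2 d, 0 < d & forall v, normc (v - w) < d ->
    v != z /\ normc (herglotz_kernel z v - herglotz_kernel z w) < e.
Proof.
move=> e0 wz; set a := normc (w - z).
have a0 : 0 < a by rewrite normc_gt0 subr_eq0.
pose m := 4 * (normc z + 1).
have m0 : 0 < m by rewrite mulr_gt0// ltr_wpDl// normc_ge0.
exists (Num.min (a / 2) (e * a ^+ 2 / m)).
  by rewrite lt_min !divr_gt0// mulr_gt0// exprn_gt0.
move=> v; rewrite lt_min => /andP[v1 v2].
have av : a / 2 < normc (v - z).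
  have := normc_dist_triangle v w z; rewrite (normc_distC w v) -/a; lra.
have vz : v != z by rewrite -subr_eq0 -normc_gt0; apply: lt_trans av; rewrite divr_gt0.
split=> //.
have -> : herglotz_kernel z v - herglotz_kernel z w =
    2 * z * (w - v) / ((v - z) * (w - z)).
  rewrite /herglotz_kernel; field; by rewrite !subr_eq0 wz vz.
rewrite normc_div !normcM -/a (normc_distC w).
have -> : normc (2 : C) = 2 by exact: normc_natr.
rewrite ltr_pdivrMr ?mulr_gt0//; last by apply: lt_trans av; rewrite divr_gt0.
move: v2; rewrite ltr_pdivlMr// => v2.
have h1 : e * a * (a / 2) <= e * (normc (v - z) * a).
  by rewrite -mulrA ler_wpM2l ?(ltW e0)// mulrC ler_wpM2r// ltW.
have h2 : 2 * normc z * normc (v - w) <= normc (v - w) * m / 2.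
  rewrite /m; have := normc_ge0 (v - w); have := normc_ge0 z; nra.
rewrite expr2 in v2; lra.
Qed.

(** Stated for a Lipschitz function [p] so that it covers the real and imaginary
    parts at once: the preimages of open half-lines are open. *)
Lemma measurable_herglotz (z : C) (p : C -> R) : normc z < 1 ->
  (forall u v, `|p u - p v| <= normc (u - v)) ->
  measurable_fun (@unit_circle R : set (borelC R))
    (fun xi : borelC R => p (herglotz_kernel z xi)).
Proof.
move=> z1 pL; pose U : set (borelC R) := [set xi : C | xi != z].
have mU : measurable U.
  apply: sub_sigma_algebra; apply: openC_of_eps => w wz.
  by have [d d0 H] := herglotz_kernel_eps ltr01 wz; exists d => // v /H[].
apply: (@measurable_funS _ _ _ _ U) => //.
  move=> w /= w1; rewrite /U/=; apply: contraTneq z1 => <-.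
  by rewrite w1 ltxx.
move=> _; apply: (measurability _ (RGenOInfty.measurableE R)) => //.
move=> _ [_ [a ->] <-]; apply: sub_sigma_algebra; apply: openC_of_eps => w.
rewrite /= in_itv/= andbT => -[wz aw].
have e0 : 0 < p (herglotz_kernel z w) - a by rewrite subr_gt0.
have [d d0 H] := herglotz_kernel_eps e0 wz; exists d => // v /H[vz vw].
split=> //; rewrite in_itv/= andbT.
have := le_lt_trans (pL _ _) vw; rewrite ltr_norml => /andP[h _]; lra.
Qed.

Section AtomicMeasure.
Variables (b : nat -> R) (x : nat -> C) (mu : {measure set borelC R -> \bar R}).
Hypotheses (b_ge0 : forall s, 0 <= b s) (b_sum : summable_seq b).
Hypotheses (x_circle : forall s, normc (x s) = 1) (mu_atomic : is_atomic_measure b x mu).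

Let m s := mscale (NngNum (b_ge0 s)) (dirac (x s : borelC R)).

Lemma atomic_measureE A : measurable A -> mu A = mseries m 0 A.
Proof.
move=> mA; rewrite (mu_atomic mA) /mseries.
by apply: eq_eseriesr => s _; rewrite /m /mscale.
Qed.

(** On the circle the atomic measure is the series of the scaled Dirac masses, and
    a nonnegative integral commutes with a series of measures. *)
Lemma integral_atomic_ge0 (g : borelC R -> R) (M : R) :
  measurable_fun (@unit_circle R : set (borelC R)) g ->
  (forall xi : C, normc xi = 1 -> 0 <= g xi <= M) ->
  exists2 l : R, (fun n => \sum_(0 <= s < n) b s * g (x s)) @ \oo --> l &
    (\int[mu]_(xi in (@unit_circle R : set (borelC R))) (g xi)%:E)%E = l%:E.
Proof.
move=> mg gM.
have mC := circle_measurable.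
have mgE : measurable_fun (@unit_circle R : set (borelC R)) (fun xi => (g xi)%:E).
  exact/measurable_EFinP.
have [l bl] : exists l : R, (fun n => \sum_(0 <= s < n) b s * g (x s)) @ \oo --> l.
  apply/cvg_ex; apply: summable_cvg => [s|].
    by rewrite mulr_ge0//; have /andP[] := gM _ (x_circle s).
  apply: (@summable_le _ _ (fun s => M * b s)).
    by move=> s; rewrite mulrC ler_wpM2r//; have /andP[] := gM _ (x_circle s).
  apply: summable_scale => //.
  by have /andP[g0 gM0] := gM _ (x_circle 0%N); exact: le_trans g0 gM0.
exists l => //.
rewrite (@eq_measure_integral _ _ _ _ (mseries m 0)); last first.
  by move=> A mA _; exact: atomic_measureE.
rewrite ge0_integral_measure_series//; last first.
  by move=> xi xi1; rewrite lee_fin; have /andP[] := gM _ xi1.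
have E s : (\int[m s]_(xi in (@unit_circle R : set (borelC R))) (g xi)%:E)%E =
    (b s * g (x s))%:E.
  rewrite ge0_integral_mscale//; last first.
    by move=> xi xi1; rewrite lee_fin; have /andP[] := gM _ xi1.
  rewrite integral_dirac// diracE mem_set; last exact: x_circle.
  by rewrite mul1e -EFinM.
rewrite (eq_eseriesr (fun s _ => E s)).
apply: cvg_lim; first exact: ereal_hausdorff.
under eq_fun do rewrite sumEFin.
exact: cvg_comp bl _.
Qed.

(** The positive and negative parts are integrated separately and have finite
    integrals, being bounded. *)
Lemma Rintegral_atomic (f : borelC R -> R) (M : R) :
  measurable_fun (@unit_circle R : set (borelC R)) f ->
  (forall xi : C, normc xi = 1 -> `|f xi| <= M) ->
  (fun n => \sum_(0 <= s < n) b s * f (x s)) @ \oo -->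
    Rintegral mu (@unit_circle R : set (borelC R)) f.
Proof.
move=> mf fM.
have mx (h : borelC R -> R) : measurable_fun (@unit_circle R : set (borelC R)) h ->
    measurable_fun (@unit_circle R : set (borelC R)) (fun xi => Num.max (h xi) 0).
  by move=> mh; apply: measurable_maxr => //; exact: measurable_cst.
have M1 (xi : C) : normc xi = 1 -> 0 <= Num.max (f xi) 0 <= M.
  move=> /fM; rewrite le_max lexx orbT ge_max => h.
  by rewrite (le_trans (ler_norm _) h) (le_trans _ h).
have M2 (xi : C) : normc xi = 1 -> 0 <= Num.max (- f xi) 0 <= M.
  move=> /fM; rewrite -normrN le_max lexx orbT ge_max => h.
  by rewrite (le_trans (ler_norm _) h) (le_trans _ h).
have [l1 h1 e1] := integral_atomic_ge0 (mx _ mf) M1.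
have [l2 h2 e2] := integral_atomic_ge0 (mx _ (measurable_funN mf)) M2.
rewrite /Rintegral integralE.
have -> : (\int[mu]_(xi in (@unit_circle R : set (borelC R)))
   ((fun xi => (f xi)%:E)^\+ xi))%E = l1%:E.
  by rewrite -e1; apply: eq_integral => xi _; rewrite funeposE -EFin_max.
have -> : (\int[mu]_(xi in (@unit_circle R : set (borelC R)))
   ((fun xi => (f xi)%:E)^\- xi))%E = l2%:E.
  by rewrite -e2; apply: eq_integral => xi _; rewrite funenegE -EFin_max.
rewrite -EFinB /=.
have -> : (fun n => \sum_(0 <= s < n) b s * f (x s)) =
  (fun n => \sum_(0 <= s < n) b s * Num.max (f (x s)) 0) \-
  (fun n => \sum_(0 <= s < n) b s * Num.max (- f (x s)) 0).
  apply/funext => n /=; rewrite -sumrB; apply: eq_bigr => s _.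
  rewrite -mulrBr; congr (_ * _); have [f0|f0] := leP 0 (f (x s)).
    by rewrite max_r ?subr0// oppr_le0.
  by rewrite max_l ?sub0r ?opprK// oppr_ge0 ltW.
exact: cvgB.
Qed.

End AtomicMeasure.
End AtomicIntegrals.

Section AtomicSingularFunction.
Variable R : realType.
Local Notation C := R[i].

Definition poisson (z xi : C) : R := (1 - normc z ^+ 2) / normc (xi - z) ^+ 2.

Lemma poisson_ge0 (z xi : C) : normc z < 1 -> 0 <= poisson z xi.
Proof.
move=> z1; rewrite divr_ge0 ?sqr_ge0// subr_ge0 expr_le1// ?normc_ge0//.
exact: ltW.
Qed.

Lemma Re_herglotz_kernel (z xi : C) : normc z < 1 -> normc xi = 1 ->
  complex.Re (herglotz_kernel z xi) = poisson z xi.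
Proof.
move=> z1 x1; have := circle_sub_gt0 z1 x1; rewrite /poisson /herglotz_kernel.
have := normc_sqr xi; rewrite x1 expr1n !normc_sqr.
have -> : 0 < normc (xi - z) = (0 < normc (xi - z) ^+ 2).
  by rewrite exprn_even_gt0//= lt_def normc_ge0 andbT.
rewrite normc_sqr; case: z xi {z1 x1} => a b [c d] /= e h.
have h0 : (c - a) ^+ 2 + (d - b) ^+ 2 != 0 by rewrite gt_eqF.
rewrite mulrN opprK !mulrA -mulrDl; congr (_ / _).
by rewrite e; ring.
Qed.

(** The singular inner function of the single mass [b s] at [x s]. *)
Definition atom_factor (b : nat -> R) (x : nat -> C) (s : nat) (z : C) : C :=
  cexp (- ((b s)%:C%C * herglotz_kernel z (x s))).

Lemma prod_atom_factor b x n z : \prod_(0 <= s < n) atom_factor b x s z =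
  cexp (- \sum_(0 <= s < n) (b s)%:C%C * herglotz_kernel z (x s)).
Proof.
elim: n => [|n ih]; first by rewrite !big_geq// oppr0 cexp0.
by rewrite !big_nat_recr//= opprD cexpD ih.
Qed.

Lemma normc_atom_factor b x s z : normc z < 1 -> normc (x s) = 1 ->
  normc (atom_factor b x s z) = expR (- (b s * poisson z (x s))).
Proof.
move=> z1 x1; rewrite normc_cexp -Re_herglotz_kernel//.
by case: (herglotz_kernel _ _) => u v /=; rewrite mul0r subr0.
Qed.

Section Fixed.
Variables (b : nat -> R) (x : nat -> C).
Hypotheses (b_ge0 : forall s, 0 <= b s) (b_sum : summable_seq b).
Hypothesis x_circle : forall s, normc (x s) = 1.

Lemma normc_Re_dist (u v : C) : `|complex.Re u - complex.Re v| <= normc (u - v).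
Proof. by apply: le_trans (normc_Re _); case: u v => ? ? []. Qed.

Lemma normc_Im_dist (u v : C) : `|complex.Im u - complex.Im v| <= normc (u - v).
Proof. by apply: le_trans (normc_Im _); case: u v => ? ? []. Qed.

Lemma herglotz_integral_cvg (mu : {measure set borelC R -> \bar R}) z :
  is_atomic_measure b x mu -> normc z < 1 ->
  (fun n => \sum_(0 <= s < n) b s * complex.Re (herglotz_kernel z (x s)))
    @ \oo --> complex.Re (herglotz_integral mu z) /\
  (fun n => \sum_(0 <= s < n) b s * complex.Im (herglotz_kernel z (x s)))
    @ \oo --> complex.Im (herglotz_integral mu z).
Proof.
move=> mub z1; split.
- apply: (Rintegral_atomic b_ge0 b_sum x_circle mub (M := 2 / (1 - normc z))).
    exact: (measurable_herglotz z1 normc_Re_dist).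
  move=> xi xi1; apply: le_trans (normc_Re _) _.
  exact: herglotz_kernel_bound.
- apply: (Rintegral_atomic b_ge0 b_sum x_circle mub (M := 2 / (1 - normc z))).
    exact: (measurable_herglotz z1 normc_Im_dist).
  move=> xi xi1; apply: le_trans (normc_Im _) _.
  exact: herglotz_kernel_bound.
Qed.

Lemma Re_sum n z : complex.Re (- \sum_(0 <= s < n) (b s)%:C%C * herglotz_kernel z (x s))
  = - \sum_(0 <= s < n) b s * complex.Re (herglotz_kernel z (x s)).
Proof.
elim: n => [|n ih]; first by rewrite !big_geq// oppr0.
rewrite !big_nat_recr//= !opprD -ih; move: (\sum_(_ <= _ < _) _) => [u v].
by case: (herglotz_kernel _ _) => p q /=; rewrite mul0r subr0.
Qed.

Lemma Im_sum n z : complex.Im (- \sum_(0 <= s < n) (b s)%:C%C * herglotz_kernel z (x s))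
  = - \sum_(0 <= s < n) b s * complex.Im (herglotz_kernel z (x s)).
Proof.
elim: n => [|n ih]; first by rewrite !big_geq// oppr0.
rewrite !big_nat_recr//= !opprD -ih; move: (\sum_(_ <= _ < _) _) => [u v].
by case: (herglotz_kernel _ _) => p q /=; rewrite mul0r addr0.
Qed.

(** The Herglotz integral is the sum of the contributions of the atoms, and the
    exponential turns sums into products: from here on the singular function is
    an infinite product, like a Blaschke product. *)
Lemma singular_prod_cvg (mu : {measure set borelC R -> \bar R}) z :
  is_atomic_measure b x mu -> normc z < 1 ->
  (\prod_(0 <= s < n) atom_factor b x s z) @[n --> \oo] --> singular_function mu z.
Proof.
move=> mub z1; have [hR hI] := herglotz_integral_cvg mub z1.
under eq_fun do rewrite prod_atom_factor.
apply: cexp_cvg.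
  by under eq_fun do rewrite Re_sum; exact: cvgN.
by under eq_fun do rewrite Im_sum; exact: cvgN.
Qed.

(** The real part of the Herglotz kernel is the Poisson kernel, so smallness of the
    singular function is largeness of a Poisson sum. *)
Lemma normc_singular (mu : {measure set borelC R -> \bar R}) z :
  is_atomic_measure b x mu -> normc z < 1 ->
  exists2 P : R, (fun n => \sum_(0 <= s < n) b s * poisson z (x s)) @ \oo --> P &
    normc (singular_function mu z) = expR (- P).
Proof.
move=> mub z1; have [hR _] := herglotz_integral_cvg mub z1.
exists (complex.Re (herglotz_integral mu z)); last by rewrite normc_cexp.
by under eq_fun do under eq_bigr do rewrite -Re_herglotz_kernel//.
Qed.

End Fixed.

Lemma atomic_measure_exists (b : nat -> R) (x : nat -> C) :
  (forall s, 0 <= b s) ->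
  exists mu : {measure set borelC R -> \bar R}, is_atomic_measure b x mu.
Proof.
move=> b0.
pose m s : {measure set borelC R -> \bar R} :=
  mscale (NngNum (b0 s)) (dirac (x s : borelC R)).
exists (mseries m 0) => A mA.
by rewrite /= /mseries; apply: eq_eseriesr => s _; rewrite /m /= /mscale.
Qed.

End AtomicSingularFunction.

(** * Derivatives and radial limits of Blaschke and singular products *)

Section BlaschkeFactors.
Variable R : realType.
Local Notation C := R[i].
Implicit Types (a w z : C).

(** With [|a|^2] written as [a] times its conjugate, the numerator of the deviation
    factors as [1 - |a|] times a quantity of modulus at most [2 |a|]. *)
Lemma blaschke_factor_deviation a z : normc a < 1 -> normc z <= 1 ->
  normc (1 - blaschke_factor a z) <= 2 * (1 - normc a) / normc (1 - (a^*)%C * z).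
Proof.
move=> a1 z1; rewrite /blaschke_factor; case: eqVneq => [->|a0].
  rewrite rmorph0 mul0r subr0 normc0 subr0 normc1 divr1 mulr1.
  by rewrite (le_trans (normc_triangleB _ _))// normc1; lra.
have k0 : 1 - (a^*)%C * z != 0 by rewrite kernel_neq0.
have na0 : normc a != 0 by rewrite normc_eq0.
have e : (normc a)%:C%C ^+ 2 = a * (a^*)%C.
  rewrite -rmorphXn/= normc_sqr; case: (a) => p q; simpc.
  by congr (_ +i* _)%C; ring.
have -> : 1 - (normc a)%:C%C / a * ((a - z) / (1 - (a^*)%C * z)) =
    (1 - (normc a)%:C%C) * (a + (normc a)%:C%C * z) / a / (1 - (a^*)%C * z).
  have : (a^*)%C = (normc a)%:C%C ^+ 2 / a by rewrite e mulrC mulKf.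
  move=> h; move: k0; rewrite h => k0; field; rewrite a0 /=.
  move: k0; apply: contra => /eqP h2; apply/eqP.
  have -> : 1 - (normc a)%:C%C ^+ 2 / a * z = (a - (normc a)%:C%C ^+ 2 * z) / a.
    by field.
  by rewrite h2 mul0r.
rewrite !normc_div ler_pM2r ?invr_gt0 ?normc_gt0// normcM.
have -> : 1 - (normc a)%:C%C = (1 - normc a)%:C%C by rewrite rmorphB.
rewrite normc_real ger0_norm ?subr_ge0 ?(ltW a1)// -mulrA mulrC.
rewrite ler_pM2r ?subr_gt0// ler_pdivrMr ?normc_gt0//.
apply: le_trans (normc_triangle _ _) _; rewrite normcM normc_real.
rewrite (ger0_norm (normc_ge0 a)).
have : normc a * normc z <= normc a by rewrite ler_piMr ?normc_ge0.
lra.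
Qed.

(** The difference quotients of a Blaschke factor are explicit: its increment is
    a multiple of [1 - |a|^2], divided by a product of two kernels. *)
Lemma blaschke_factor_second_order a z : normc a < 1 -> normc z < 1 ->
  exists2 d, normc d <= 4 * (1 - normc a) / (1 - normc z) ^+ 3 &
  forall w, normc (w - z) < (1 - normc z) / 2 ->
    normc (blaschke_factor a w - blaschke_factor a z - d * (w - z)) <=
    4 * (1 - normc a) / (1 - normc z) ^+ 3 * normc (w - z) ^+ 2.
Proof.
move=> a1 z1; set q := 1 - normc z.
have q0 : 0 < q by rewrite subr_gt0.
have q1 : q <= 1 by rewrite /q; have := normc_ge0 z; lra.
have wD w : normc (w - z) < q / 2 -> q / 2 <= 1 - normc w.
  by move=> h; have := normc_lower w z; rewrite /q in h *; lra.
have q3 : q ^+ 3 <= q ^+ 2 by rewrite exprS ler_piMl// sqr_ge0.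
have q31 : q ^+ 3 <= 1 by rewrite exprn_ile1// ltW.
have [->|a0] := eqVneq a 0.
  exists 1; first by rewrite normc1 normc0 subr0 mulr1 ler_pdivlMr ?exprn_gt0//; lra.
  move=> w _; rewrite /blaschke_factor eqxx mul1r subrr normc0.
  by rewrite subr0 mulr_ge0 ?sqr_ge0// divr_ge0 ?exprn_ge0 ?mulr1// ltW.
have k0 w : normc w < 1 -> 1 - (a^*)%C * w != 0.
  by move=> w1; rewrite kernel_neq0// ltW.
have [lam lam1 e] : exists2 lam : C, normc lam = 1 &
    forall w, blaschke_factor a w = lam * ((a - w) / (1 - (a^*)%C * w)).
  exists ((normc a)%:C%C / a).
    by rewrite normc_div normc_real ger0_norm ?normc_ge0// divff// normc_eq0.
  by move=> w; rewrite /blaschke_factor (negPf a0).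
have A : normc (a * (a^*)%C - 1) <= 2 * (1 - normc a).
  have -> : a * (a^*)%C - 1 = (normc a ^+ 2 - 1)%:C%C.
    rewrite normc_sqr; case: (a) => p r; simpc.
    by congr (_ +i* _)%C; ring.
  rewrite normc_real ler0_norm ?subr_le0 ?expr_le1 ?normc_ge0 ?(ltW a1)//.
  by have := normc_ge0 a; move: (normc a) a1 => u; nra.
have Kz : q <= normc (1 - (a^*)%C * z) by apply: kernel_lower; exact: ltW.
exists (lam * (a * (a^*)%C - 1) / (1 - (a^*)%C * z) ^+ 2).
  rewrite normc_div normcM lam1 mul1r normcX.
  apply: (@le_trans _ _ (2 * (1 - normc a) / q ^+ 2)).
    rewrite ler_pM ?normc_ge0 ?invr_ge0 ?sqr_ge0// lef_pV2 ?posrE ?exprn_gt0//.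
      by rewrite ler_pXn2r ?nnegrE ?normc_ge0// ltW.
    by rewrite normc_gt0 k0.
  rewrite ler_pM ?invr_ge0 ?sqr_ge0 ?mulr_ge0 ?subr_ge0 ?(ltW a1)//.
    by rewrite ler_wpM2r ?subr_ge0 ?(ltW a1)//; lra.
  by rewrite lef_pV2 ?posrE ?exprn_gt0.
move=> w wr; have qw := wD w wr.
have w1 : normc w < 1 by lra.
have Kw : q / 2 <= normc (1 - (a^*)%C * w).
  by apply: le_trans qw _; apply: kernel_lower; exact: ltW.
have -> : blaschke_factor a w - blaschke_factor a z -
    lam * (a * (a^*)%C - 1) / (1 - (a^*)%C * z) ^+ 2 * (w - z) =
    lam * (a * (a^*)%C - 1) * (a^*)%C * (w - z) ^+ 2 /
      ((1 - (a^*)%C * w) * (1 - (a^*)%C * z) ^+ 2).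
  by rewrite !e; field; rewrite !k0.
rewrite normc_div (normcM _ ((w - z) ^+ 2)) (normcM _ (a^*)%C) (normcM lam).
rewrite (normcM _ ((1 - (a^*)%C * z) ^+ 2)) lam1 mul1r !normcX normc_conj.
rewrite [leLHS]mulrAC ler_wpM2r ?sqr_ge0//.
apply: (@le_trans _ _ (2 * (1 - normc a) / (q / 2 * q ^+ 2))).
  rewrite ler_pM ?invr_ge0 ?mulr_ge0 ?normc_ge0 ?sqr_ge0//.
    by apply: le_trans A; rewrite ler_piMr ?normc_ge0// ltW.
  have kw0 : 0 < q / 2 * q ^+ 2 by rewrite !mulr_gt0 ?invr_gt0 ?exprn_gt0.
  have le : q / 2 * q ^+ 2 <= normc (1 - (a^*)%C * w) * normc (1 - (a^*)%C * z) ^+ 2.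
    rewrite ler_pM ?divr_ge0 ?sqr_ge0 ?(ltW q0)// ler_pXn2r ?nnegrE ?normc_ge0//.
    exact: ltW.
  by rewrite lef_pV2 ?posrE// (lt_le_trans kw0).
rewrite le_eqVlt; apply/orP; left; apply/eqP; field.
by rewrite gt_eqF.
Qed.

End BlaschkeFactors.

Section BlaschkeProducts.
Variable R : realType.
Local Notation C := R[i].

Definition opt_factor (o : option C) (z : C) : C :=
  if o is Some w then blaschke_factor w z else 1.

Definition opt_gap (o : option C) : R := if o is Some w then 1 - normc w else 0.

Variables (a : nat -> option C) (B : C -> C).
Hypothesis a_disc : forall n w, a n = Some w -> normc w < 1.
Hypothesis a_sum : summable_seq (opt_gap \o a).

Lemma opt_gap_ge0 n : 0 <= opt_gap (a n).
Proof. by rewrite /opt_gap; case E: (a n) => [w|//]; rewrite subr_ge0 ltW// (a_disc E). Qed.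

Lemma opt_factor_le1 n z : normc z < 1 -> normc (opt_factor (a n) z) <= 1.
Proof.
move=> z1; rewrite /opt_factor; case E: (a n) => [w|]; last by rewrite normc1.
by rewrite normc_blaschke_factor rho_le1// (a_disc E).
Qed.

Lemma opt_factor_deviation n z : normc z < 1 ->
  normc (1 - opt_factor (a n) z) <= 2 / (1 - normc z) * opt_gap (a n).
Proof.
move=> z1; rewrite /opt_factor /opt_gap; case E: (a n) => [w|].
  have w1 := a_disc E.
  apply: le_trans (blaschke_factor_deviation w1 (ltW z1)) _.
  rewrite [leRHS]mulrAC ler_wpM2l ?mulr_ge0 ?subr_ge0 ?(ltW w1)//.
  rewrite lef_pV2 ?posrE ?subr_gt0 ?normc_gt0 ?kernel_neq0 ?(ltW z1)//.
  by rewrite kernel_lower// ltW.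
by rewrite subrr normc0 mulr0.
Qed.

Lemma opt_factor_cvg z : normc z < 1 ->
  exists l : C, (\prod_(0 <= n < N) opt_factor (a n) z) @[N --> \oo] --> l.
Proof.
move=> z1; apply: (prod_cvg (c := fun n => 2 / (1 - normc z) * opt_gap (a n))).
- by move=> k; exact: opt_factor_le1.
- by move=> k; exact: opt_factor_deviation.
- by apply: summable_scale => //; rewrite divr_ge0// subr_ge0 ltW.
Qed.

Hypothesis B_lim : forall z, normc z < 1 ->
  (\prod_(0 <= n < N) opt_factor (a n) z) @[N --> \oo] --> B z.

Lemma blaschke_le1 z : normc z < 1 -> normc (B z) <= 1.
Proof.
move=> z1; rewrite -[B z]subr0; apply: (normc_lim_le (B_lim z1)).
by exists 0%N => n _; rewrite subr0; apply: normc_prod_le1 => k; exact: opt_factor_le1.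
Qed.

(** The factors are nonzero outside the listed points and their deviations are
    summable, so an infinite product of them does not vanish. *)
Lemma blaschke_zeroP z : normc z < 1 -> (B z = 0 <-> exists n, a n = Some z).
Proof.
move=> z1; split => [Bz|[n an]].
  apply/not_existsP => H; move/eqP: Bz; apply/negP.
  apply: (prod_lim_neq0 (fun k => opt_factor_le1 k z1)
    (fun k => opt_factor_deviation k z1) _ _ (B_lim z1)).
    by apply: summable_scale => //; rewrite divr_ge0// subr_ge0 ltW.
  move=> k; rewrite /opt_factor; case E: (a k) => [w|]; last exact: oner_neq0.
  rewrite -normc_eq0 normc_blaschke_factor /rho normc_eq0 mulf_neq0//.
    by rewrite subr_eq0; apply/eqP => zw; apply: (H k); rewrite E zw.
  by rewrite invr_neq0// kernel_neq0 ?(ltW z1)// (a_disc E).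
apply: (cvgC_unique (B_lim z1)); apply/cvgC_eps => e e0; exists n.+1 => m nm.
rewrite (_ : \prod_(_ <= _ < _) _ = 0) ?subrr ?normc0//.
apply/eqP; rewrite prodf_seq_eq0; apply/hasP; exists n.
  by rewrite mem_index_iota.
by rewrite /= an /= -normc_eq0 normc_blaschke_factor /rho subrr mul0r normc0.
Qed.

(** The factors have uniform second-order expansions whose constants are multiples
    of the gaps [1 - |a k|], which are summable. *)
Lemma blaschke_derivable z : normc z < 1 -> derivable B z 1.
Proof.
move=> z1; set q := 1 - normc z.
have q0 : 0 < q by rewrite subr_gt0.
have q1 : q <= 1 by rewrite /q; have := normc_ge0 z; lra.
have q3 : q ^+ 3 <= q by rewrite exprS ler_piMr ?(ltW q0)// exprn_ile1// ltW.
have H k : exists d : C, normc d <= 4 / q ^+ 3 * opt_gap (a k) /\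
    forall w : C, normc (w - z) < q / 2 ->
    normc (opt_factor (a k) w - opt_factor (a k) z - d * (w - z)) <=
    4 / q ^+ 3 * opt_gap (a k) * normc (w - z) ^+ 2.
  rewrite /opt_factor /opt_gap; case E: (a k) => [v|].
    have [d d1 d2] := blaschke_factor_second_order (a_disc E) z1.
    by exists d; rewrite mulrAC; split.
  exists 0; rewrite normc0 mulr0; split=> // w _.
  by rewrite (_ : _ - _ = 0) ?normc0 ?mul0r//; ring.
have [d Hd] := choice H.
apply: (@derivable_prod R (fun k => opt_factor (a k)) B z d
  (fun k => 4 / q ^+ 3 * opt_gap (a k)) (q / 2)) => //.
- by apply/andP; split; lra.
- by move=> w wz; have := normc_lower w z; rewrite /q in wz *; lra.
- by move=> k w w1; exact: opt_factor_le1.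
- move=> k; apply: le_trans (opt_factor_deviation k z1) _.
  rewrite ler_wpM2r ?opt_gap_ge0// -/q ler_pM ?invr_ge0 ?(ltW q0)//.
    by rewrite ler_nat.
  by rewrite lef_pV2 ?posrE ?exprn_gt0.
- by move=> k; have [] := Hd k.
- by move=> k w wz; have [_] := Hd k; exact.
- by apply: summable_scale => //; rewrite divr_ge0 ?exprn_ge0 ?(ltW q0).
Qed.

(** On the circle [u] is the inverse of its conjugate, so the kernel has the modulus
    of [u - r w]; the displacement from [r w] to [w] is at most [1 - r], which is in
    turn at most the modulus of the kernel. *)
Lemma radial_kernel_lower (u w : C) (r : R) : normc u = 1 -> normc w <= 1 ->
  0 <= r < 1 -> normc (u - w) <= 2 * normc (1 - (w^*)%C * (r%:C%C * u)).
Proof.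
move=> u1 w1 /andP[r0 r1].
have e : normc (1 - (w^*)%C * (r%:C%C * u)) = normc (u - r%:C%C * w).
  have uu : u * (u^*)%C = 1.
    have := normc_sqr u; rewrite u1; case: (u) => p q /= h; simpc.
    by congr (_ +i* _)%C; [rewrite -!expr2 -h expr1n|ring].
  have -> : u - r%:C%C * w = u * ((1 - (w^*)%C * (r%:C%C * u))^*)%C.
    rewrite rmorphB rmorph1 !rmorphM /= conjcK mulrBr mulr1; congr (_ - _).
    have -> : (r -i* 0)%C = r%:C%C by rewrite oppr0.
    by rewrite -[LHS]mulr1 -uu; ring.
  by rewrite normcM u1 mul1r normc_conj.
rewrite e; have := normc_dist_triangle (r%:C%C * w) u w.
have := kernel_lower (r%:C%C * u) w1; rewrite e normc_circle_scale//.
have -> : r%:C%C * w - w = (r - 1)%:C%C * w by rewrite rmorphB/= mulrBl rmorph1 mul1r.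
rewrite normcM normc_real ler0_norm ?subr_le0 ?(ltW r1)// opprB.
have : (1 - r) * normc w <= 1 - r by rewrite ler_piMr// subr_ge0 ltW.
lra.
Qed.

(** Frostman's criterion: absolute summability of the gaps over the distances to
    [u] dominates the factors uniformly on the radius ending at [u]. *)
Lemma blaschke_radial_limit (u : C) : normc u = 1 ->
  summable_seq (fun k => if a k is Some w then (1 - normc w) / normc (u - w) else 0) ->
  exists2 L : C, normc L = 1 & B (r%:C%C * u) @[r --> (1 : R)^'-] --> L.
Proof.
move=> u1 su.
have uw k w : a k = Some w -> 0 < normc (u - w).
  by move=> /a_disc w1; rewrite (lt_le_trans _ (normc_lower _ _))// u1 subr_gt0.
apply: (@radial_limit_prod R (fun k => opt_factor (a k)) B u
  (fun k => opt_factor (a k) u)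
  (fun k => 4 * (if a k is Some w then (1 - normc w) / normc (u - w) else 0))) => //.
- by move=> k w w1; exact: opt_factor_le1.
- move=> k r r01; have r1 := andP r01; rewrite /opt_factor.
  case E: (a k) => [w|]; last by rewrite subrr normc0 mulr0.
  have w1 := a_disc E.
  have ru : normc (r%:C%C * u) < 1 by rewrite normc_circle_scale//; case: r1.
  apply: le_trans (blaschke_factor_deviation w1 (ltW ru)) _.
  have := radial_kernel_lower u1 (ltW w1) r01; have := uw k w E.
  have : 0 < normc (1 - (w^*)%C * (r%:C%C * u)).
    by rewrite normc_gt0 kernel_neq0 ?(ltW ru).
  move: (normc (1 - _)) (normc (u - w)) => K D K0 D0 DK.
  rewrite ler_pdivrMr// mulrA mulrAC -mulrA.
  have -> : 4 * (1 - normc w) * (K / D) = 2 * (1 - normc w) * (2 * K / D) by ring.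
  by rewrite ler_peMr ?mulr_ge0 ?subr_ge0 ?(ltW w1)// ler_pdivlMr// mul1r.
- move=> k; rewrite /opt_factor; case E: (a k) => [w|]; last first.
    by apply/cvgC_left1_eps => e e0; exists 1 => // r _ _; rewrite subrr normc0.
  have w1 := a_disc E.
  have ku : 0 < normc (1 - (w^*)%C * u) by rewrite normc_gt0 kernel_neq0// u1.
  apply/cvgC_left1_eps => e e0.
  have D0 : 0 < e * (normc (1 - (w^*)%C * u) * (1 - normc w)) / 4.
    by rewrite !divr_gt0// !mulr_gt0// subr_gt0.
  exists (Num.min 1 (e * (normc (1 - (w^*)%C * u) * (1 - normc w)) / 4)).
    by rewrite lt_min ltr01.
  move=> r rd r1.
  have [r0 rd1] : 0 < r /\ 1 - r < e * (normc (1 - (w^*)%C * u) * (1 - normc w)) / 4.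
    by move: rd; rewrite ltrBlDr -ltrBlDl lt_min => /andP[? ?]; split; lra.
  have ru : normc (r%:C%C * u) < 1 by rewrite normc_circle_scale// ltW.
  have ru_u : normc (r%:C%C * u - u) = 1 - r.
    rewrite -[X in _ - X]mul1r -mulrBl normcM u1 mulr1 -(rmorph1 (real_complex R)).
    by rewrite -rmorphB normc_real ler0_norm ?opprB// subr_le0 ltW.
  have k1 : 1 - normc w <= normc (1 - (w^*)%C * (r%:C%C * u)).
    by rewrite kernel_sym kernel_lower// ltW.
  have k10 : 0 < normc (1 - (w^*)%C * (r%:C%C * u)) by rewrite (lt_le_trans _ k1)// subr_gt0.
  have -> : blaschke_factor w (r%:C%C * u) - blaschke_factor w u =
      (if w == 0 then 1 else (normc w)%:C%C / w) *
      ((if w == 0 then 1 else w * (w^*)%C - 1) * (r%:C%C * u - u)) /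
       ((1 - (w^*)%C * u) * (1 - (w^*)%C * (r%:C%C * u))).
    rewrite /blaschke_factor; have [->|w0] := eqVneq w 0.
      by rewrite rmorph0 !mul0r !subr0 !mul1r divr1.
    by field; rewrite w0 -!normc_gt0 ku k10.
  rewrite normc_div !normcM ru_u.
  have -> : normc (if w == 0 then 1 else (normc w)%:C%C / w) = 1.
    case: eqVneq => [_|w0]; first by rewrite normc1.
    by rewrite normc_div normc_real ger0_norm ?normc_ge0// divff// normc_eq0.
  have : normc (if w == 0 then 1 else w * (w^*)%C - 1) <= 2.
    case: eqVneq => [_|w0]; first by rewrite normc1; lra.
    rewrite (le_trans (normc_triangleB _ _))// normc1 normcM normc_conj.
    have : normc w * normc w <= 1 by rewrite mulr_ile1 ?normc_ge0 ?ltW.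
    lra.
  rewrite mul1r => b2; rewrite ltr_pdivrMr ?mulr_gt0//.
  apply: (@le_lt_trans _ _ (2 * (1 - r))).
    by rewrite ler_wpM2r// subr_ge0 ltW.
  apply: (@lt_le_trans _ _ (e * (normc (1 - (w^*)%C * u) * (1 - normc w)))).
    by have := mulr_gt0 e0 (mulr_gt0 ku (_ : 0 < 1 - normc w)); rewrite subr_gt0 => /(_ w1); lra.
  by rewrite ler_wpM2l ?(ltW e0)// ler_wpM2l ?normc_ge0.
- move=> k; rewrite /opt_factor; case E: (a k) => [w|]; last by rewrite normc1.
  have w1 := a_disc E.
  have := normc_kernelE u w; rewrite u1 expr1n subrr mul0r addr0 => h.
  rewrite normc_blaschke_factor /rho normc_div.
  have : normc (1 - (w^*)%C * u) = normc (u - w).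
    by apply/eqP; rewrite -(@eqrXn2 _ 2)// ?normc_ge0// h.
  by move=> ->; rewrite divff// gt_eqF// (uw k).
- exact: summable_scale.
Qed.

End BlaschkeProducts.

Section AtomFactors.
Variable R : realType.
Local Notation C := R[i].

Lemma herglotz_kernel_increment (xi z w : C) : xi != z -> xi != w ->
  herglotz_kernel w xi - herglotz_kernel z xi = 2 * xi * (w - z) / ((xi - w) * (xi - z)).
Proof.
by move=> xz xw; rewrite /herglotz_kernel; field; rewrite !subr_eq0 xz xw.
Qed.

(** At a boundary point other than the atom the factor of the atom is unimodular. *)
Lemma herglotz_kernel_circle (xi u : C) : normc xi = 1 -> normc u = 1 ->
  complex.Re (herglotz_kernel u xi) = 0.
Proof.
move=> x1 u1; have := normc_sqr xi; have := normc_sqr u; rewrite x1 u1 expr1n.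
rewrite /herglotz_kernel; case: xi u {x1 u1} => a b [c d] /= h1 h2.
rewrite mulrN opprK !mulrA -mulrDl -!(mulrC ((_ ^+ 2 + _ ^+ 2)^-1)).
have -> : (a + c) * (a - c) + (b + d) * (b - d) = (a ^+ 2 + b ^+ 2) - (c ^+ 2 + d ^+ 2).
  by ring.
by rewrite -h1 -h2 subrr mulr0.
Qed.

(** The increment of the exponent is controlled by the explicit increment of the
    kernel; the restriction on [w] keeps it below [1 / 2], in the range of the
    second-order estimate for the exponential. *)
Lemma atom_factor_second_order (b M : R) (xi z : C) : 0 <= b <= M ->
  normc xi = 1 -> normc z < 1 ->
  exists2 d, normc d <= (128 * M + 8) / (1 - normc z) ^+ 4 * b &
  forall w, normc (w - z) < (1 - normc z) ^+ 2 / (8 * (M + 1)) ->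
    normc (cexp (- (b%:C%C * herglotz_kernel w xi)) -
           cexp (- (b%:C%C * herglotz_kernel z xi)) - d * (w - z)) <=
    (128 * M + 8) / (1 - normc z) ^+ 4 * b * normc (w - z) ^+ 2.
Proof.
move=> /andP[b0 bM] x1 z1; set q := 1 - normc z.
have M0 : 0 <= M := le_trans b0 bM.
have q0 : 0 < q by rewrite subr_gt0.
have q1 : q <= 1 by rewrite /q; have := normc_ge0 z; lra.
have rq : q ^+ 2 / (8 * (M + 1)) <= q / 2.
  rewrite ler_pdivrMr; last by rewrite mulr_gt0// ltr_wpDl.
  have : q ^+ 2 <= q by rewrite expr2 ler_piMr// ltW.
  have : 0 <= q * M by rewrite mulr_ge0// ltW.
  lra.
have xz : q <= normc (xi - z) by exact: circle_sub_lower.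
have xz0 : xi != z by rewrite -subr_eq0 -normc_gt0 (lt_le_trans q0).
pose g w := cexp (- (b%:C%C * herglotz_kernel w xi)).
have gz1 : normc (g z) <= 1.
  rewrite normc_cexp -expR0 ler_expR.
  have := Re_herglotz_kernel z1 x1; case: (herglotz_kernel _ _) => u v /= ->.
  by rewrite mul0r subr0 oppr_le0 mulr_ge0// poisson_ge0.
have nb : normc (b%:C%C) = b by rewrite normc_real ger0_norm.
exists (g z * (- (b%:C%C * (2 * xi)) / (xi - z) ^+ 2)).
  rewrite normcM normc_div normc_opp normcX (normcM (b%:C%C)) (normcM 2) x1 mulr1 normc_natr nb.
  apply: (@le_trans _ _ (1 * (b * 2 / q ^+ 2))).
    rewrite ler_pM ?normc_ge0 ?divr_ge0 ?mulr_ge0 ?normc_ge0//.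
    rewrite ler_wpM2l ?mulr_ge0// lef_pV2 ?posrE ?exprn_gt0 ?(lt_le_trans q0)//.
    by rewrite ler_pXn2r ?nnegrE ?normc_ge0// ltW.
  rewrite mul1r (_ : b * 2 / q ^+ 2 = 2 / q ^+ 2 * b); last by ring.
  rewrite ler_wpM2r//.
  rewrite ler_pM ?invr_ge0 ?sqr_ge0//.
    by rewrite -[X in X <= _]add0r lerD ?mulr_ge0// ler_nat.
  by rewrite lef_pV2 ?posrE ?exprn_gt0// ler_wiXn2l// ltW.
move=> w wr; have wr2 := lt_le_trans wr rq.
have w1 : normc w < 1 by have := normc_lower w z; rewrite /q in wr2; lra.
have xw : q / 2 <= normc (xi - w).
  by apply: le_trans (circle_sub_lower w x1); have := normc_lower w z; rewrite /q in wr2 *; lra.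
have xw0 : xi != w by rewrite -subr_eq0 -normc_gt0 (lt_le_trans _ xw)// divr_gt0.
pose v := - (b%:C%C * (herglotz_kernel w xi - herglotz_kernel z xi)).
have vE : v = - (b%:C%C * (2 * xi * (w - z) / ((xi - w) * (xi - z)))).
  by rewrite /v herglotz_kernel_increment.
have nv : normc v <= 4 * b * normc (w - z) / q ^+ 2.
  rewrite vE normc_opp normcM nb normc_div !normcM x1 mulr1 normc_natr.
  have -> : 4 * b * normc (w - z) / q ^+ 2 = b * (2 * normc (w - z) / (q / 2 * q)).
    by field; rewrite gt_eqF.
  rewrite ler_wpM2l// ler_wpM2l ?mulr_ge0 ?normc_ge0//.
  have qq : 0 < q / 2 * q by rewrite !mulr_gt0// invr_gt0.
  have le : q / 2 * q <= normc (xi - w) * normc (xi - z).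
    by rewrite ler_pM// ?divr_ge0// ltW.
  by rewrite lef_pV2 ?posrE// (lt_le_trans qq).
have v2 : normc v <= 1 / 2.
  apply: le_trans nv _; rewrite ler_pdivrMr ?exprn_gt0//.
  move: wr; rewrite ltr_pdivlMr; last by rewrite mulr_gt0// ltr_wpDl.
  have : b * normc (w - z) <= M * normc (w - z) by rewrite ler_wpM2r ?normc_ge0.
  have := normc_ge0 (w - z); lra.
have gw : g w = g z * cexp v.
  rewrite /g -cexpD; congr cexp; rewrite /v; ring.
rewrite -/(g w) -/(g z) gw.
have -> : g z * cexp v - g z - g z * (- (b%:C%C * (2 * xi)) / (xi - z) ^+ 2) * (w - z)
   = g z * ((cexp v - 1 - v) + - (b%:C%C * (2 * xi * (w - z) ^+ 2) /
       ((xi - w) * (xi - z) ^+ 2))).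
  by rewrite vE; field; rewrite !subr_eq0 xw0 xz0.
rewrite normcM; apply: le_trans (_ : 1 * _ <= _).
  by apply: ler_pM gz1 (normc_triangle _ _); exact: normc_ge0.
rewrite mul1r normc_opp normc_div.
rewrite (normcM _ (2 * xi * _)) (normcM (2 * xi)) (normcM 2) x1 mulr1 normc_natr nb.
rewrite (normcM _ ((xi - z) ^+ 2)) !normcX.
have A := cexp_second_order v2.
have A2 : normc v ^+ 2 <= 16 * M * b * normc (w - z) ^+ 2 / q ^+ 4.
  apply: le_trans (_ : (4 * b * normc (w - z) / q ^+ 2) ^+ 2 <= _).
    rewrite ler_pXn2r ?nnegrE ?normc_ge0// divr_ge0 ?sqr_ge0//.
    by rewrite !mulr_ge0 ?normc_ge0.
  have -> : (4 * b * normc (w - z) / q ^+ 2) ^+ 2 =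
     b * (16 * b * normc (w - z) ^+ 2 / q ^+ 4) by field; rewrite gt_eqF.
  have -> : 16 * M * b * normc (w - z) ^+ 2 / q ^+ 4 =
     M * (16 * b * normc (w - z) ^+ 2 / q ^+ 4) by field; rewrite gt_eqF.
  rewrite ler_wpM2r// divr_ge0 ?exprn_ge0 ?(ltW q0)//.
  by rewrite !mulr_ge0 ?normc_ge0.
have B : b * (2 * normc (w - z) ^+ 2) / (normc (xi - w) * normc (xi - z) ^+ 2) <=
    8 * b * normc (w - z) ^+ 2 / q ^+ 4.
  apply: (@le_trans _ _ (b * (2 * normc (w - z) ^+ 2) / (q / 2 * q ^+ 2))).
    have qq : 0 < q / 2 * q ^+ 2 by rewrite !mulr_gt0// ?invr_gt0 ?exprn_gt0.
    have le : q / 2 * q ^+ 2 <= normc (xi - w) * normc (xi - z) ^+ 2.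
      rewrite ler_pM ?divr_ge0 ?sqr_ge0 ?(ltW q0)//.
      by rewrite ler_pXn2r ?nnegrE ?normc_ge0// ltW.
    rewrite ler_wpM2l ?mulr_ge0 ?normc_ge0//.
    by rewrite lef_pV2 ?posrE// (lt_le_trans qq).
  have -> : b * (2 * normc (w - z) ^+ 2) / (q / 2 * q ^+ 2) =
    4 * b * normc (w - z) ^+ 2 / q ^+ 3 by field; rewrite gt_eqF.
  rewrite ler_pM ?mulr_ge0 ?normc_ge0 ?invr_ge0 ?exprn_ge0 ?(ltW q0)//.
    rewrite ler_wpM2r ?mulr_ge0 ?normc_ge0// ler_wpM2r// ler_nat//.
  by rewrite lef_pV2 ?posrE ?exprn_gt0// ler_wiXn2l// ltW.
have -> : (128 * M + 8) / q ^+ 4 * b * normc (w - z) ^+ 2 =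
  8 * (16 * M * b * normc (w - z) ^+ 2 / q ^+ 4) + 8 * b * normc (w - z) ^+ 2 / q ^+ 4.
  by field; rewrite gt_eqF.
rewrite lerD// (le_trans A)// ler_wpM2l//.
Qed.

Section Fixed.
Variables (b : nat -> R) (x : nat -> C) (S : C -> C).
Hypotheses (b_ge0 : forall s, 0 <= b s) (b_sum : summable_seq b).
Hypothesis x_circle : forall s, normc (x s) = 1.
Hypothesis S_lim : forall z, normc z < 1 ->
  (\prod_(0 <= s < n) atom_factor b x s z) @[n --> \oo] --> S z.

Lemma atom_factor_le1 s z : normc z < 1 -> normc (atom_factor b x s z) <= 1.
Proof.
move=> z1; rewrite normc_atom_factor// -expR0 ler_expR oppr_le0.
by rewrite mulr_ge0// poisson_ge0.
Qed.

Lemma atom_factor_deviation s z : normc z < 1 ->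
  normc (1 - atom_factor b x s z) <= 8 * b s / normc (x s - z).
Proof.
move=> z1; have x0 := circle_sub_gt0 z1 (x_circle s).
apply: le_trans (cexp_deviation _) _.
  have := Re_herglotz_kernel z1 (x_circle s); case: (herglotz_kernel _ _) => u v /= ->.
  by rewrite mul0r subr0 oppr_le0 mulr_ge0// poisson_ge0.
rewrite normc_opp normcM normc_real ger0_norm// normc_div.
rewrite !mulrA ler_pM2r ?invr_gt0//.
have : normc (x s + z) <= 2 by rewrite (le_trans (normc_triangle _ _))// x_circle; lra.
move=> h; have : b s * normc (x s + z) <= b s * 2 by rewrite ler_wpM2l.
by rewrite -mulrA; lra.
Qed.

Lemma singular_le1 z : normc z < 1 -> normc (S z) <= 1.
Proof.
move=> z1; rewrite -[S z]subr0; apply: (normc_lim_le (S_lim z1)).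
by exists 0%N => n _; rewrite subr0; apply: normc_prod_le1 => k; exact: atom_factor_le1.
Qed.

Lemma singular_derivable z : normc z < 1 -> derivable S z 1.
Proof.
move=> z1; set q := 1 - normc z.
have q0 : 0 < q by rewrite subr_gt0.
have q1 : q <= 1 by rewrite /q; have := normc_ge0 z; lra.
have [M bM] := b_sum.
have bM1 s : 0 <= b s <= M.
  rewrite b_ge0 (le_trans _ (bM s.+1))// big_nat_recr//= lerDr sumr_ge0//.
have M0 : 0 <= M by have /andP[h1 h2] := bM1 0%N; exact: le_trans h2.
pose K := (128 * M + 8) / q ^+ 4.
have K0 : 0 <= K by rewrite divr_ge0 ?exprn_ge0 ?(ltW q0)// addr_ge0 ?mulr_ge0.
have H s := atom_factor_second_order (bM1 s) (x_circle s) z1.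
have H' s : exists d : C, normc d <= K * b s /\
    forall w : C, normc (w - z) < q ^+ 2 / (8 * (M + 1)) ->
    normc (atom_factor b x s w - atom_factor b x s z - d * (w - z)) <=
    K * b s * normc (w - z) ^+ 2.
  by have [d d1 d2] := H s; exists d.
have [d Hd] := choice H'.
have M1 : 0 < 8 * (M + 1) by rewrite mulr_gt0// ltr_wpDl.
have rq : q ^+ 2 / (8 * (M + 1)) <= q / 2.
  rewrite ler_pdivrMr//.
  have : q ^+ 2 <= q by rewrite expr2 ler_piMr// ltW.
  have : 0 <= q * M by rewrite mulr_ge0// ltW.
  lra.
apply: (@derivable_prod R (fun s => atom_factor b x s) S z d
  (fun s => K * b s) (q ^+ 2 / (8 * (M + 1)))) => //.
- by rewrite divr_gt0 ?exprn_gt0//= (le_trans rq)//; lra.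
- by move=> w wz; have := normc_lower w z; rewrite /q in wz rq *; lra.
- by move=> k w w1; exact: atom_factor_le1.
- move=> k; apply: le_trans (atom_factor_deviation k z1) _.
  rewrite mulrAC ler_wpM2r// /K ler_pM ?invr_ge0 ?normc_ge0//.
    by rewrite lerDr mulr_ge0.
  rewrite lef_pV2 ?posrE ?exprn_gt0 ?circle_sub_gt0//.
  apply: le_trans (circle_sub_lower z (x_circle k)).
  by rewrite exprS ler_piMr ?(ltW q0)// exprn_ile1// ltW.
- by move=> k; have [] := Hd k.
- by move=> k w wz; have [_] := Hd k; exact.
- exact: summable_scale.
Qed.

(** The analogue of Frostman's criterion for atoms: the distance from [x s] to the
    radius ending at [u] is comparable to the distance from [x s] to [u], so the
    factors converge uniformly along this radius. *)
Lemma singular_radial_limit (u : C) : normc u = 1 -> (forall s, x s != u) ->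
  summable_seq (fun s => b s / normc (x s - u)) ->
  exists2 L : C, normc L = 1 & S (r%:C%C * u) @[r --> (1 : R)^'-] --> L.
Proof.
move=> u1 xu su.
have xu0 s : 0 < normc (x s - u) by rewrite normc_gt0 subr_eq0.
have ru_u (r : R) : r < 1 -> normc (r%:C%C * u - u) = 1 - r.
  move=> r1; rewrite -[X in _ - X]mul1r -mulrBl normcM u1 mulr1.
  by rewrite -(rmorph1 (real_complex R)) -rmorphB normc_real ler0_norm ?opprB// subr_le0 ltW.
have xru s (r : R) : 0 <= r < 1 -> normc (x s - u) <= 2 * normc (x s - r%:C%C * u).
  move=> /andP[r0 r1]; have := normc_dist_triangle (r%:C%C * u) (x s) u.
  have := circle_sub_lower (r%:C%C * u) (x_circle s).
  by rewrite normc_circle_scale// ru_u//; lra.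
apply: (@radial_limit_prod R (fun s => atom_factor b x s) S u
  (fun s => atom_factor b x s u) (fun s => 16 * (b s / normc (x s - u)))) => //.
- by move=> k w w1; exact: atom_factor_le1.
- move=> k r r01; have /andP[r0 r1] := r01.
  have ru1 : normc (r%:C%C * u) < 1 by rewrite normc_circle_scale.
  apply: le_trans (atom_factor_deviation k ru1) _.
  rewrite ler_pdivrMr ?circle_sub_gt0//.
  have h := xru k r r01.
  have -> : 16 * (b k / normc (x k - u)) * normc (x k - r%:C%C * u) =
     8 * b k * (2 * normc (x k - r%:C%C * u) / normc (x k - u)) by ring.
  by rewrite ler_peMr ?mulr_ge0// ler_pdivlMr// mul1r.
- move=> k; set D := normc (x k - u).
  apply/cvgC_left1_eps => e e0.
  pose m := 4 * (b k + 1) / D ^+ 2.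
  have m0 : 0 < m by rewrite divr_gt0 ?exprn_gt0 ?xu0// mulr_gt0// ltr_wpDl.
  have t0 : 0 < Num.min 1 (Num.min (1 / (2 * m)) (e / (5 * m))).
    by rewrite !lt_min ltr01/=; apply/andP; split; rewrite divr_gt0// mulr_gt0.
  exists (Num.min 1 (Num.min (1 / (2 * m)) (e / (5 * m)))) => // r rd r1.
  have [r0 rd1 rd2] : [/\ 0 < r, 1 - r < 1 / (2 * m) & 1 - r < e / (5 * m)].
    by move: rd; rewrite ltrBlDr -ltrBlDl !lt_min => /and3P[? ? ?]; split; lra.
  have r01 : 0 <= r < 1 by rewrite (ltW r0).
  have xr0 : 0 < normc (x k - r%:C%C * u).
    by rewrite circle_sub_gt0// normc_circle_scale// ltW.
  pose v := - ((b k)%:C%C * (herglotz_kernel (r%:C%C * u) (x k) - herglotz_kernel u (x k))).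
  have nv : normc v <= m * (1 - r).
    rewrite /v herglotz_kernel_increment -?normc_gt0 ?xu//; last first.
      by rewrite -subr_eq0 -normc_gt0.
    rewrite normc_opp normcM normc_real ger0_norm// normc_div !normcM x_circle.
    rewrite mulr1 normc_natr ru_u// -/D.
    have h := xru k r r01; rewrite -/D in h.
    apply: (@le_trans _ _ (b k * (2 * (1 - r) / (D / 2 * D)))).
      rewrite ler_wpM2l// ler_wpM2l ?mulr_ge0 ?subr_ge0 ?(ltW r1)//.
      rewrite lef_pV2 ?posrE ?mulr_gt0 ?invr_gt0 ?xu0//.
      by rewrite ler_wpM2r ?normc_ge0//; lra.
    have -> : b k * (2 * (1 - r) / (D / 2 * D)) = 4 * b k / D ^+ 2 * (1 - r).
      by field; rewrite gt_eqF ?xu0.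
    rewrite ler_wpM2r ?subr_ge0 ?(ltW r1)// ler_wpM2r ?invr_ge0 ?sqr_ge0//.
    by rewrite ler_wpM2l// lerDl.
  have v1 : normc v <= 1 / 2.
    apply: le_trans nv _; rewrite mulrC -ler_pdivlMr// (le_trans (ltW rd1))//.
    by rewrite invfM mulrA.
  have v3 : normc v < e / 5.
    apply: le_lt_trans nv _; rewrite mulrC -ltr_pdivlMr// (lt_le_trans rd2)//.
    by rewrite invfM mulrA.
  have -> : atom_factor b x k (r%:C%C * u) = atom_factor b x k u * cexp v.
    rewrite /atom_factor -cexpD; congr cexp; rewrite /v; ring.
  rewrite -[X in _ - X]mulr1 -mulrBr normcM.
  have -> : normc (atom_factor b x k u) = 1.
    rewrite normc_cexp; have := herglotz_kernel_circle (x_circle k) u1.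
    by case: (herglotz_kernel _ _) => p q /= ->; rewrite mulr0 mul0r subr0 oppr0 expR0.
  rewrite mul1r -(subrK v (cexp v - 1)) .
  apply: le_lt_trans (normc_triangle _ _) _.
  have := cexp_second_order v1.
  have : normc v ^+ 2 <= normc v * (1 / 2) by rewrite expr2 ler_wpM2l ?normc_ge0.
  lra.
- move=> k; rewrite normc_cexp; have := herglotz_kernel_circle (x_circle k) u1.
  by case: (herglotz_kernel _ _) => p q /= ->; rewrite mulr0 mul0r subr0 oppr0 expR0.
- exact: summable_scale.
Qed.

End Fixed.
End AtomFactors.

(** * Half-plane coordinates *)

Section Cayley.
Variable R : realType.
Local Notation C := R[i].
Implicit Types t y s e : R.

(** The Cayley transform of the half-plane point [t + i y]; at [y = 0] it
    parametrizes the circle without one point. *)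
Definition cay t y : C := ((1 - y) +i* t)%C / ((1 + y) -i* t)%C.

Definition cay_den t y : R := (1 + y) ^+ 2 + t ^+ 2.

Lemma cay_den_gt0 t y : 0 <= y -> 0 < cay_den t y.
Proof. by move=> y0; rewrite ltr_wpDr ?sqr_ge0// exprn_gt0// ltr_wpDr. Qed.

Lemma normc_cay_den t y : normc ((1 + y) -i* t)%C ^+ 2 = cay_den t y.
Proof. by rewrite normc_sqr /= sqrrN. Qed.

Lemma cay_den_neq0 t y : 0 <= y -> ((1 + y) -i* t)%C != 0 :> C.
Proof.
by move=> y0; rewrite -normc_eq0 -sqrf_eq0 normc_cay_den gt_eqF// cay_den_gt0.
Qed.

Lemma normc_cay t y : 0 <= y -> normc (cay t y) ^+ 2 = 1 - 4 * y / cay_den t y.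
Proof.
move=> y0; have d0 := cay_den_gt0 t y0.
rewrite normc_div expr_div_n normc_cay_den normc_sqr /=.
by rewrite /cay_den in d0 *; field; rewrite gt_eqF.
Qed.

Lemma cay_circle t : normc (cay t 0) = 1.
Proof.
apply/eqP; rewrite -(@eqrXn2 _ 2)// ?normc_ge0// normc_cay//.
by rewrite mulr0 mul0r subr0 expr1n.
Qed.

Lemma cay_disc t y : 0 < y -> normc (cay t y) < 1.
Proof.
move=> y0; rewrite -(@ltr_pXn2r _ 2) ?nnegrE ?normc_ge0//.
rewrite normc_cay ?(ltW y0)// expr1n ltrBlDr ltrDl.
by rewrite divr_gt0 ?mulr_gt0// cay_den_gt0// ltW.
Qed.

Lemma normc_cay_dist t y s e : 0 <= y -> 0 <= e ->
  normc (cay t y - cay s e) ^+ 2 =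
  4 * ((t - s) ^+ 2 + (y - e) ^+ 2) / (cay_den t y * cay_den s e).
Proof.
move=> y0 e0; have dy := cay_den_neq0 t y0; have de := cay_den_neq0 s e0.
pose N : C := ((1 - y) +i* t)%C * ((1 + e) -i* s)%C -
  ((1 - e) +i* s)%C * ((1 + y) -i* t)%C.
have -> : cay t y - cay s e = N / (((1 + y) -i* t)%C * ((1 + e) -i* s)%C).
  by rewrite /N /cay; field; rewrite dy de.
rewrite normc_div normcM expr_div_n exprMn !normc_cay_den; congr (_ / _).
by rewrite normc_sqr /N /=; ring.
Qed.

Lemma rho_cay t y s e : 0 < y -> 0 < e ->
  1 - rho (cay t y) (cay s e) ^+ 2 = 4 * y * e / ((t - s) ^+ 2 + (y + e) ^+ 2).
Proof.
move=> y0 e0; have dy := cay_den_gt0 t (ltW y0); have de := cay_den_gt0 s (ltW e0).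
rewrite rho_sqr ?cay_disc// normc_kernelE normc_cay_dist ?(ltW y0) ?(ltW e0)//.
rewrite !normc_cay ?(ltW y0) ?(ltW e0)//.
have h : 0 < (t - s) ^+ 2 + (y + e) ^+ 2.
  by rewrite ltr_wpDl ?sqr_ge0// exprn_gt0// addr_gt0.
have -> : (y + e) ^+ 2 = (y - e) ^+ 2 + 4 * y * e by ring.
have h' : (t - s) ^+ 2 + (y - e) ^+ 2 + 4 * y * e != 0.
  by rewrite gt_eqF//; move: h; congr (_ < _); ring.
move: h'; move: (cay_den t y) (cay_den s e) dy de => p q p0 q0 h'.
field; rewrite !gt_eqF//=.
  have -> : 4 * ((t - s) ^+ 2 + (y - e) ^+ 2) + (p - (p - 4 * y)) * (q - (q - 4 * e))
    = 4 * ((t - s) ^+ 2 + (y + e) ^+ 2) by ring.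
  by rewrite mulr_gt0.
by move: h; congr (_ < _); ring.
Qed.

Lemma poisson_cay t y u : 0 < y ->
  poisson (cay t y) (cay u 0) = (1 + u ^+ 2) * (y / ((t - u) ^+ 2 + y ^+ 2)).
Proof.
move=> y0; have dy := cay_den_gt0 t (ltW y0).
rewrite /poisson normc_distC normc_cay_dist ?(ltW y0)// normc_cay ?(ltW y0)//.
rewrite {3}/cay_den addr0 expr1n subr0.
have h : 0 < (t - u) ^+ 2 + y ^+ 2 by rewrite ltr_wpDl ?sqr_ge0// exprn_gt0.
have h' : 0 < 1 + u ^+ 2 by rewrite ltr_wpDr ?sqr_ge0.
by field; rewrite !gt_eqF.
Qed.

(** The inverse Cayley transform [z = - i (w - 1) / (w + 1)], whose imaginary part
    is [(1 - |w|^2) / |1 + w|^2]. *)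
Lemma cay_surj (w : C) : normc w < 1 -> exists t y, 0 < y /\ w = cay t y.
Proof.
move=> w1.
have w0 : 1 + w != 0.
  apply/eqP => h; have e : w = - 1 by apply/eqP; rewrite -addr_eq0 addrC h.
  by rewrite e normc_opp normc1 ltxx in w1.
have w2 : normc w ^+ 2 < 1 by rewrite expr_lt1// normc_ge0.
pose z : C := - 'i%C * (w - 1) / (1 + w).
have zi : w = (1 + 'i%C * z) / (1 - 'i%C * z).
  have i2 : 'i%C * 'i%C = -1 :> C by rewrite -expr2 sqr_i.
  have -> : 'i%C * z = (w - 1) / (1 + w).
    have -> : 'i%C * z = - ('i%C * 'i%C) * (w - 1) / (1 + w) by rewrite /z; ring.
    by rewrite i2 opprK mul1r.
  have -> : 1 + (w - 1) / (1 + w) = 2 * w / (1 + w) by field.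
  have -> : 1 - (w - 1) / (1 + w) = 2 / (1 + w) by field.
  by field; rewrite ?w0 ?pnatr_eq0.
have zIm : complex.Im z = (1 - normc w ^+ 2) / normc (1 + w) ^+ 2.
  rewrite /z !normc_sqr; case: (w) => p q /=; rewrite !add0r; ring.
exists (complex.Re z), (complex.Im z); split.
  by rewrite zIm divr_gt0 ?subr_gt0// exprn_gt0// normc_gt0.
rewrite {1}zi /cay; case: (z) => p q; congr (_ / _); simpc; congr (_ +i* _)%C; ring.
Qed.

(** A pseudo-hyperbolic disc of the half-plane is a Euclidean disc: the condition
    reads [3 ((t - s)^2 + (y + e)^2) < 16 y e], and each claim is a consequence of
    this quadratic inequality. *)
Lemma rho_cay_half t y s e : 0 < y -> 0 < e -> rho (cay t y) (cay s e) < 1 / 2 ->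
  [/\ y < 3 * e, e < 3 * y & `|t - s| < 4 / 3 * y].
Proof.
move=> y0 e0 r2; have := rho_cay t s y0 e0.
have : rho (cay t y) (cay s e) ^+ 2 < 1 / 4.
  have -> : 1 / 4 = (1 / 2) ^+ 2 :> R by field.
  by rewrite ltr_pXn2r ?nnegrE ?rho_ge0.
move: (rho _ _ ^+ 2) => r r4 hr.
have h : 0 < (t - s) ^+ 2 + (y + e) ^+ 2.
  by rewrite ltr_wpDl ?sqr_ge0// exprn_gt0// addr_gt0.
have {hr}hh : 4 * y * e = (1 - r) * ((t - s) ^+ 2 + (y + e) ^+ 2).
  by rewrite hr divfK// gt_eqF.
have h3 : 3 / 4 * ((t - s) ^+ 2 + (y + e) ^+ 2) < 4 * y * e.
  by rewrite hh ltr_pM2r//; lra.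
have ts := sqr_ge0 (t - s).
have p1 : 0 < (3 * e - y) * (3 * y - e) by lra.
have p2 : (t - s) ^+ 2 < (4 / 3 * y) ^+ 2 by have := sqr_ge0 (e - 5 / 3 * y); lra.
split.
- rewrite -subr_gt0; move: p1; case: (ltP 0 (3 * e - y)) => // a p1.
  have : 0 < 3 * y - e by lra.
  by move=> /ltW q; have := mulr_le0_ge0 a q; rewrite leNgt p1.
- rewrite -subr_gt0; move: p1; case: (ltP 0 (3 * y - e)) => // a p1.
  have : 0 < 3 * e - y by lra.
  by move=> /ltW q; have := mulr_ge0_le0 q a; rewrite leNgt p1.
- rewrite -(@ltr_pXn2r _ 2) ?nnegrE ?mulr_ge0 ?divr_ge0 ?(ltW y0)//.
  by rewrite real_normK ?num_real.
Qed.

End Cayley.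

Section WeakEmbedding.
Variable R : realType.
Local Notation C := R[i].

(** The form in which the weak embedding property is contradicted: where the
    function is small there is a zero nearby. The infimum in the definition is
    taken at [eps / 2] to gain a strict inequality. *)
Lemma WEP_near_zero (F : C -> C) (eps : R) : WEP F -> 0 < eps ->
  exists2 eta, 0 < eta & forall z, normc z < 1 -> normc (F z) < eta ->
    exists w, [/\ normc w < 1, F w = 0 & rho z w < eps].
Proof.
move=> [_ Fw] eps0; have e2 : 0 < eps / 2 by rewrite divr_gt0.
have := Fw _ e2; set E := wep_eta F (eps / 2) => E0.
have [eta eta0 etaE] : exists2 eta : R, 0 < eta & (eta%:E <= E)%E.
  move: E0; case: E => [r|_|//]; last by exists 1 => //; rewrite leey.
  by rewrite lte_fin => r0; exists r.
exists eta => // z z1 Fz.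
have : ~~ ((eps / 2)%:E < rho_set z (zero_set F))%E.
  apply/negP => h; suff : (eta%:E <= (normc (F z))%:E)%E by rewrite lee_fin leNgt Fz.
  apply: le_trans etaE _; apply: ereal_inf_lbound.
  by exists z => //; split.
rewrite -leNgt => h.
have : (rho_set z (zero_set F) < eps%:E)%E.
  by apply: le_lt_trans h _; rewrite lte_fin; lra.
move=> /ereal_inf_lt[_ [w [w1 Fw0] <-]]; rewrite lte_fin => rzw.
by exists w; split.
Qed.

End WeakEmbedding.

(** * Zeros on a grid and atoms in a cluster *)

Section BlaschkeUpperBound.
Variable R : realType.
Local Notation C := R[i].
Variables (a : nat -> option C) (B : C -> C).
Hypothesis a_disc : forall n w, a n = Some w -> normc w < 1.
Hypothesis a_sum : summable_seq (@opt_gap R \o a).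
Hypothesis B_lim : forall z, normc z < 1 ->
  (\prod_(0 <= n < N) opt_factor (a n) z) @[N --> \oo] --> B z.

Lemma le_expR_half (v : R) : 0 <= v <= 1 -> v <= expR (- ((1 - v ^+ 2) / 2)).
Proof.
move=> /andP[v0 v1]; apply: le_trans (expR_ge1Dx _).
by have := sqr_ge0 (1 - v); lra.
Qed.

(** From [v <= exp (- (1 - v^2) / 2)] for each factor. Only finitely many zeros are
    counted, through injective indices, because repeated zeros count as often as
    they are listed. *)
Lemma blaschke_upper (T : finType) (idx : T -> nat) (w : T -> C) z :
  normc z < 1 -> injective idx -> (forall p, a (idx p) = Some (w p)) ->
  normc (B z) <= expR (- ((\sum_p (1 - rho z (w p) ^+ 2)) / 2)).
Proof.
move=> z1 idx_inj aw; rewrite -[B z]subr0.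
apply: (normc_lim_le (B_lim z1)).
pose g n := 1 - normc (opt_factor (a n) z) ^+ 2.
have g0 n : 0 <= g n.
  by rewrite subr_ge0 expr_le1 ?normc_ge0 ?opt_factor_le1.
exists (\max_p (idx p)).+1 => N HN; rewrite subr0 normc_prod.
apply: (@le_trans _ _ (expR (- ((\sum_(0 <= n < N) g n) / 2)))).
  elim: N {HN} => [|N ih]; first by rewrite !big_geq// mul0r oppr0 expR0.
  rewrite !big_nat_recr//= mulrDl opprD expRD ler_pM ?normc_ge0//.
    by apply: prodr_ge0 => k _; exact: normc_ge0.
  by apply: le_expR_half; rewrite normc_ge0 opt_factor_le1.
rewrite ler_expR lerN2 ler_wpM2r ?invr_ge0//.
have lt_idx p : (idx p < N)%N.
  by apply: leq_ltn_trans HN; exact: (leq_bigmax p).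
pose h p : 'I_N := Ordinal (lt_idx p).
have h_inj : {in [set: T]%SET &, injective h}.
  by move=> p q _ _ [] /idx_inj.
rewrite big_mkord.
have -> : \sum_p (1 - rho z (w p) ^+ 2) = \sum_(n in h @: [set: T]%SET) g n.
  rewrite big_imset//=; apply: eq_big => [p|p _]; first by rewrite inE.
  by rewrite /g /= aw /= normc_blaschke_factor.
by rewrite [leRHS](bigID (mem (h @: [set: T]%SET)))/= lerDl sumr_ge0.
Qed.

(** One zero near each point of a Whitney grid under the interval of length [L]
    costs the same amount of Blaschke mass at each of the [J] scales. *)
Lemma blaschke_grid_upper (phi L H : R) (J : nat) : 0 < L -> L <= H ->
  (forall t y, phi <= t <= phi + L -> L / 16 ^+ J <= y <= L ->
    exists w, [/\ normc w < 1, B w = 0 & rho (cay t y) w < 1 / 2]) ->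
  normc (B (cay phi H)) <= expR (- (J%:R * L / (48 * H))).
Proof.
move=> L0 LH near; have H0 : 0 < H by exact: lt_le_trans LH.
have [g Hg] : exists g : C -> R * R, forall w, normc w < 1 ->
    0 < (g w).2 /\ w = cay (g w).1 (g w).2.
  have Hw w : exists q : R * R, normc w < 1 -> 0 < q.2 /\ w = cay q.1 q.2.
    have [w1|w1] := pselect (normc w < 1); last by exists (0, 0) => /w1.
    by have [t [y [y0 ->]]] := cay_surj w1; exists (t, y).
  by have [g Hg] := choice Hw; exists g.
(* Cell [l] of generation [i] has height [L / 16 ^ (i + 1)] and is centred at
   distance [4 l] heights from [phi]; there are [4 * 16 ^ i] of them, so they stay
   above the interval. *)
pose T := {i : 'I_J & 'I_(4 * 16 ^ i)}.
pose y (p : T) : R := L / 16 ^+ (tag p).+1.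
pose t (p : T) : R := phi + 4 * (tagged p : nat)%:R * y p.
have e16 n : (0 : R) < 16 ^+ n by rewrite exprn_gt0.
have y0 p : 0 < y p by rewrite divr_gt0.
have y16 p : y p <= L / 16.
  by rewrite /y ler_wpM2l ?(ltW L0)// lef_pV2 ?posrE// exprS ler_peMr// exprn_ege1// ler1n.
have yJ p : L / 16 ^+ J <= y p <= L.
  have h := y16 p; apply/andP; split; last by lra.
  rewrite /y ler_wpM2l ?(ltW L0)// lef_pV2 ?posrE// ler_eXn2l ?ltr1n//.
have tL p : phi <= t p <= phi + L.
  apply/andP; split; first by
    rewrite /t lerDl; apply: mulr_ge0 (ltW (y0 p)); rewrite mulr_ge0.
  rewrite /t lerD2l.
  have : (tagged p : nat)%:R <= (4 * 16 ^ (tag p))%:R :> R.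
    by rewrite ler_nat ltnW.
  rewrite natrM natrX => h; rewrite /y mulrA ler_pdivrMr// exprS.
  have : (tagged p : nat)%:R * L <= 4 * 16 ^+ tag p * L by rewrite ler_wpM2r ?(ltW L0).
  lra.
have H1 p : exists q : nat * C, [/\ a q.1 = Some q.2, normc q.2 < 1 &
    rho (cay (t p) (y p)) q.2 < 1 / 2].
  have [w [w1 Bw r]] := near _ _ (tL p) (yJ p).
  have [n an] := (blaschke_zeroP a_disc a_sum B_lim w1).1 Bw.
  by exists (n, w).
have [q Hq] := choice H1.
have bnd p : let s := (g (q p).2).1 in let e := (g (q p).2).2 in
   [/\ 0 < e, (q p).2 = cay s e, y p < 3 * e, e < 3 * y p & `|t p - s| < 4 / 3 * y p].
  have [_ w1 r] := Hq p; have [e0 we] := Hg _ w1; rewrite /=.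
  by rewrite we in r; have [] := rho_cay_half (y0 p) e0 r.
have lev (p p' : T) : (tag p < tag p')%N -> y p' <= y p / 16.
  move=> pp; rewrite /y -mulrA ler_wpM2l ?(ltW L0)// -invfM lef_pV2 ?posrE ?mulr_gt0//.
  by rewrite mulrC -exprS ler_eXn2l ?ltr1n.
(* The pseudo-hyperbolic discs of radius 1 / 2 around distinct grid points are
   disjoint: heights in different generations differ by a factor 16 and two points
   of the same generation are at least four heights apart. *)
have q_inj : injective (fun p => (q p).1).
  move=> p p' /= qq; have [ap _ _] := Hq p; have [ap' _ _] := Hq p'.
  have ww : (q p).2 = (q p').2 by move: ap; rewrite qq ap' => -[].
  have [_ _ b1 b2 b3] := bnd p; have [_ _ b1' b2' b3'] := bnd p'.
  rewrite -ww in b1' b2' b3'.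
  move: (g _) b1 b2 b3 b1' b2' b3' => [s e] /= b1 b2 b3 b1' b2' b3'.
  have tt : tag p = tag p'.
    apply/eqP; apply: contraT => /eqP ne.
    have [lt|lt|/val_inj//] := ltngtP (tag p : nat) (tag p' : nat).
      by have := lev _ _ lt; lra.
    by have := lev _ _ lt; lra.
  have yy : y p = y p' by rewrite /y tt.
  have td : `|t p - t p'| < 4 * y p.
    have -> : t p - t p' = (t p - s) - (t p' - s) by ring.
    by rewrite (le_lt_trans (ler_normB _ _))//; rewrite -yy in b3'; have := y0 p; lra.
  move: td; rewrite /t -yy.
  have -> : phi + 4 * (tagged p : nat)%:R * y p - (phi + 4 * (tagged p' : nat)%:R * y p)
     = 4 * y p * ((tagged p : nat)%:R - (tagged p' : nat)%:R) by ring.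
  rewrite normrM ger0_norm; last by apply: mulr_ge0 (ltW (y0 p)).
  rewrite -[X in _ < X]mulr1.
  rewrite ltr_pM2l ?mulr_gt0// => h.
  have {h} ll : (tagged p : nat) = (tagged p' : nat).
    apply/eqP; move: h; apply: contraTT => ne; rewrite -leNgt.
    have [lt|lt|e'] := ltngtP (tagged p : nat) (tagged p' : nat).
    - by rewrite distrC -natrB ?(ltnW lt)// normr_nat ler1n subn_gt0.
    - by rewrite -natrB ?(ltnW lt)// normr_nat ler1n subn_gt0.
    - by rewrite e' eqxx in ne.
  case: p p' tt ll {lev bnd b1 b2 b3 b1' b2' b3' qq ap ap' ww yy} => i l [i' l'] /= tt.
  case: _ / tt l' => l' /val_inj -> //.
have aq (p : T) : a (q p).1 = Some (q p).2 by have [] := Hq p.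
apply: le_trans (blaschke_upper (w := fun p => (q p).2) (cay_disc phi H0) q_inj aq) _.
rewrite ler_expR lerN2.
(* Seen from height [H >= L], a zero at height comparable to [y p] costs about
   [y p / H]. *)
have term p : y p / (6 * H) <= 1 - rho (cay phi H) (q p).2 ^+ 2.
  have [e0 we b1 b2 b3] := bnd p; rewrite we.
  move: (g _) e0 b1 b2 b3 {we} => [s e] /= e0 b1 b2 b3.
  rewrite rho_cay//.
  have yp := y0 p; have y16p := y16 p; have /andP[t1 t2] := tL p.
  have sd : (phi - s) ^+ 2 <= (2 * H) ^+ 2.
    rewrite -(real_normK (num_real (phi - s))) ler_pXn2r// ?nnegrE ?mulr_ge0 ?(ltW H0)//.
    by move: b3; rewrite ltr_norml ler_norml => /andP[? ?]; apply/andP; split; lra.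
  have ed : (H + e) ^+ 2 <= (2 * H) ^+ 2.
    by rewrite ler_pXn2r// ?nnegrE ?mulr_ge0 ?addr_ge0 ?(ltW H0) ?(ltW e0)//; lra.
  have dpos : 0 < (phi - s) ^+ 2 + (H + e) ^+ 2.
    by rewrite ltr_wpDl ?sqr_ge0// exprn_gt0// addr_gt0.
  rewrite ler_pdivlMr// mulrC mulrA ler_pdivrMr ?mulr_gt0//.
  have : ((phi - s) ^+ 2 + (H + e) ^+ 2) * y p <= (8 * H ^+ 2) * (3 * e).
    apply: ler_pM => //; [exact: ltW|exact: ltW| |exact: ltW].
    by move: sd ed; rewrite exprMn; lra.
  by have -> : 4 * H * e * (6 * H) = 8 * H ^+ 2 * (3 * e) by ring.
have : \sum_(p : T) y p / (6 * H) <= \sum_p (1 - rho (cay phi H) (q p).2 ^+ 2).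
  by apply: ler_sum => p _; exact: term.
have -> : \sum_(p : T) y p / (6 * H) = J%:R * L / (24 * H).
  rewrite -mulr_suml.
  have -> : \sum_(p : T) y p = \sum_(i < J) \sum_(l < 4 * 16 ^ i) L / 16 ^+ i.+1.
    by rewrite (sig_big_dep (fun=> true) (fun _ _ => true)).
  have inner_sum (i : 'I_J) : \sum_(l < 4 * 16 ^ i) L / 16 ^+ i.+1 = L / 4.
    rewrite sumr_const card_ord -[LHS]mulr_natl natrM natrX.
    by rewrite exprS; field; rewrite gt_eqF.
  rewrite (eq_bigr _ (fun i _ => inner_sum i)).
  by rewrite sumr_const card_ord -[X in X / _]mulr_natl; field; rewrite gt_eqF.
move=> h; have -> : J%:R * L / (48 * H) = J%:R * L / (24 * H) / 2.
  by field; rewrite gt_eqF.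
by rewrite ler_pM2r ?invr_gt0.
Qed.

End BlaschkeUpperBound.

Section Clusters.
Variable R : realType.
Variables (b : nat -> R) (s : nat).
Hypotheses (b_ge0 : forall j, 0 <= b j) (b_le : forall j, (s <= j)%N -> b j <= b s).

(** Discrete version of the fact that the partial sums sweep the interval from
    [al] to [be] at unit speed; the error is one step, at most [b s]. *)
Lemma window_mass (e : nat) (al be : R) : 0 <= al -> (s <= e)%N ->
  Num.min be (\sum_(s <= i < e) b i) - al - b s <=
  \sum_(s <= j < e | al <= \sum_(s <= i < j) b i <= be) b j.
Proof.
move=> al0; elim: e => [|e ih].
  rewrite leqn0 => /eqP s0; rewrite !big_geq ?s0//.
  have h : Num.min be 0 <= 0 by rewrite ge_min lexx orbT.
  by have := b_ge0 0%N; lra.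
rewrite leq_eqVlt => /predU1P[<-|].
  rewrite !big_geq//; have := b_ge0 s.
  have : Num.min be 0 <= 0 by rewrite ge_min lexx orbT.
  lra.
rewrite ltnS => se; have {ih} := ih se.
rewrite big_nat_recr//= [X in _ -> _ <= X]big_mkcond/= [X in _ -> _ <= X]big_nat_recr//=.
rewrite -big_mkcond/=.
have G0 : 0 <= \sum_(s <= j < e | al <= \sum_(s <= i < j) b i <= be) b j.
  by apply: sumr_ge0.
move: (\sum_(s <= j < e | _) b j) G0 => G G0.
move: (\sum_(s <= i < e) b i) => c.
have be_ := b_ge0 e; have bs := b_le se.
case: ifPn => [/andP[c1 c2]|].
  rewrite (min_r c2) => h.
  have : Num.min be (c + b e) <= c + b e by rewrite ge_min lexx orbT.
  lra.
rewrite negb_and -!ltNge => /orP[c1|c1].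
  have : Num.min be (c + b e) <= c + b e by rewrite ge_min lexx orbT.
  lra.
by rewrite (min_l (ltW c1)) min_l; lra.
Qed.

(** Masses laid end to end with density [1 / A] look uniform at every scale
    between their spacing and their total extent. *)
Lemma cluster_poisson_lower (e : nat) (A phi t y : R) : 0 < A -> 0 < y -> (s <= e)%N ->
  let M := \sum_(s <= i < e) b i in
  phi <= t <= phi + A * M -> 4 * A * b s <= y <= A * M ->
  1 / (8 * A) <= \sum_(s <= j < e) b j *
    (y / ((t - (phi + A * \sum_(s <= i < j) b i)) ^+ 2 + y ^+ 2)).
Proof.
move=> A0 y0 se M /andP[t1 t2] /andP[y1 y2].
(* A window of mass [y / (2 A)] occupies length [y / 2]; it fits on the left or on
   the right of [t] within distance [y], and the discretization error [b s] takes
   away at most half of its mass. *)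
have key al : 0 <= al -> al + y / (2 * A) <= M ->
    (forall c, al <= c <= al + y / (2 * A) -> `|t - (phi + A * c)| <= y) ->
    1 / (8 * A) <= \sum_(s <= j < e) b j *
    (y / ((t - (phi + A * \sum_(s <= i < j) b i)) ^+ 2 + y ^+ 2)).
  move=> al0 alM Hc; have := window_mass (al + y / (2 * A)) al0 se.
  rewrite min_l// => mass.
  pose P j := al <= \sum_(s <= i < j) b i <= al + y / (2 * A).
  apply: (@le_trans _ _ (\sum_(s <= j < e | P j) b j * (1 / (2 * y)))).
    rewrite -mulr_suml; apply: (@le_trans _ _ (y / (4 * A) * (1 / (2 * y)))).
      by have -> : y / (4 * A) * (1 / (2 * y)) = 1 / (8 * A) by field; rewrite !gt_eqF.
    rewrite ler_wpM2r ?divr_ge0 ?mulr_ge0 ?(ltW y0)//; apply: le_trans mass.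
    have : b s <= y / (4 * A) by rewrite ler_pdivlMr ?mulr_gt0//; lra.
    have -> : y / (2 * A) = y / (4 * A) + y / (4 * A) by field; rewrite gt_eqF.
    lra.
  rewrite [leRHS](bigID P)/=; apply: ler_wpDr.
    apply: sumr_ge0 => j _; rewrite mulr_ge0// divr_ge0 ?(ltW y0)//.
    by rewrite addr_ge0 ?sqr_ge0.
  apply: ler_sum => j /Hc h; rewrite ler_wpM2l//.
  have : (t - (phi + A * \sum_(s <= i < j) b i)) ^+ 2 <= y ^+ 2.
    by rewrite -(real_normK (num_real (t - _))) ler_pXn2r ?nnegrE ?(ltW y0).
  move: (_ ^+ 2) (sqr_ge0 (t - (phi + A * \sum_(s <= i < j) b i))) => D D0 Dy.
  have y20 : 0 < y ^+ 2 by rewrite exprn_gt0.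
  rewrite ler_pdivlMr ?ltr_wpDl// mulrC mulrA mulr1 ler_pdivrMr ?mulr_gt0//.
  have -> : y * (2 * y) = 2 * y ^+ 2 by ring.
  lra.
have AA : A * (y / (2 * A)) = y / 2 by field; rewrite gt_eqF.
have TA : A * ((t - phi) / A) = t - phi by rewrite mulrC divfK// gt_eqF.
have AS (u v : R) : u <= v -> A * u <= A * v by move=> uv; rewrite ler_wpM2l// ltW.
have [h|h] := leP (t + y / 2) (phi + A * M).
  apply: (key ((t - phi) / A)); first by rewrite divr_ge0 ?(ltW A0)// subr_ge0.
    by rewrite -(ler_pM2l A0) mulrDr AA TA; lra.
  move=> c /andP[/AS c1 /AS c2]; move: c1 c2; rewrite mulrDr AA TA => c1 c2.
  by rewrite ler_norml; apply/andP; split; lra.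
apply: (key ((t - phi) / A - y / (2 * A))).
- by rewrite -(ler_pM2l A0) mulr0 mulrBr AA TA; lra.
- by rewrite subrK -(ler_pM2l A0) TA; lra.
move=> c /andP[/AS c1 /AS c2]; move: c1 c2; rewrite subrK mulrBr AA TA => c1 c2.
by rewrite ler_norml; apply/andP; split; lra.
Qed.

End Clusters.

(** * Heavy tails exclude wepability *)

Section RealLimits.
Variable R : realType.

Lemma lim_le_bound (u : nat -> R) (P M : R) :
  u @ \oo --> P -> (forall n, u n <= M) -> P <= M.
Proof.
move=> /cvgrPdist_lt uP uM; apply/ler_addgt0Pr => e /uP[N _ HN].
have := HN N (leqnn N) => /=; rewrite ltr_norml => /andP[_ h].
by have := uM N; lra.
Qed.

Lemma series_le_lim (c : nat -> R) (P : R) n : (forall s, 0 <= c s) ->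
  (fun n => \sum_(0 <= s < n) c s) @ \oo --> P -> \sum_(0 <= s < n) c s <= P.
Proof.
move=> c0 cP; rewrite -[leRHS](cvg_lim (@Rhausdorff R) cP).
apply: (@nondecreasing_cvgn_le _ (fun n => \sum_(0 <= s < n) c s)).
  by apply/nondecreasing_seqP => k; rewrite big_nat_recr//= lerDl.
by apply/cvg_ex; exists P.
Qed.

Lemma expRN_lt (e x : R) : 0 < e -> 1 / e < x -> expR (- x) < e.
Proof.
move=> e0 ex; rewrite expRN -[ltRHS]invrK ltf_pV2 ?posrE ?expR_gt0 ?invr_gt0//.
by have := expR_ge1Dx x; rewrite -div1r; lra.
Qed.

Lemma sum_window_le (b : nat -> R) s e n : (forall j, 0 <= b j) ->
  \sum_(0 <= j < n | (s <= j < e)%N) b j <= \sum_(s <= j < e) b j.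
Proof.
move=> b0; apply: (@le_trans _ _ (\sum_(s <= j < minn n e) b j)); last first.
  by apply: sum_nat_widen => //; exact: geq_minr.
elim: n => [|n ih]; first by rewrite min0n !big_geq.
rewrite big_mkcond/= big_nat_recr//= -big_mkcond/=.
case: ifPn => [/andP[sn ne]|_]; last first.
  rewrite addr0 (le_trans ih)// sum_nat_widen//.
  by rewrite leq_min geq_minr andbT (leq_trans (geq_minl _ _)).
rewrite (minn_idPl ne) big_nat_recr//= lerD2r (le_trans ih)//.
by rewrite (minn_idPl (ltnW ne)).
Qed.

End RealLimits.

Section HeavyTails.
Variable R : realType.
Local Notation C := R[i].
Variable b : nat -> R.
Hypotheses (b_gt0 : forall s, 0 < b s) (b_sum : summable_seq b).
Hypothesis b_anti : forall i j, (i <= j)%N -> b j <= b i.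
Hypothesis heavy : forall K, 0 < K -> exists s n, K * b s < \sum_(s <= k < n) b k.

Let b_ge0 s : 0 <= b s. Proof. exact: ltW. Qed.

(** The tail condition fails arbitrarily far out: up to a given index it can only
    fail by a bounded factor, since the total mass is finite. *)
Lemma heavy_block (K delta : R) (N : nat) : 0 < K -> 0 < delta ->
  exists p : nat * nat, [/\ (N <= p.1)%N, (p.1 < p.2)%N,
    K * b p.1 < \sum_(p.1 <= k < p.2) b k & \sum_(p.1 <= k < p.2) b k < delta].
Proof.
move=> K0 d0; have [W bW] := b_sum.
have [N1 HN1] := summable_tail b_ge0 b_sum d0.
pose N0 := maxn N N1.
have W0 : 0 <= W by apply: le_trans (bW 0%N); rewrite big_geq.
have K1 : 0 < K + W / b N0 by rewrite ltr_wpDr// divr_ge0.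
have [s [n sn]] := heavy K1.
have Ns : (N0 <= s)%N.
  rewrite leqNgt; apply/negP => sN; move: sn; apply/negP; rewrite -leNgt.
  apply: (@le_trans _ _ W); first by apply: le_trans (bW n); exact: sum_nat_widen.
  rewrite mulrDl; apply: ler_wpDl; first by rewrite mulr_ge0// ltW.
  by rewrite mulrAC ler_pdivlMr// ler_wpM2l// b_anti// ltnW.
have sK : K * b s < \sum_(s <= k < n) b k.
  by apply: le_lt_trans sn; rewrite mulrDl lerDl mulr_ge0// divr_ge0.
exists (s, n); split => //=.
- by apply: leq_trans Ns; exact: leq_maxl.
- rewrite ltnNge; apply/negP => ns; move: sK; rewrite big_geq// ltNge.
  by rewrite mulr_ge0// ltW.
- by apply: HN1; apply: leq_trans Ns; exact: leq_maxr.
Qed.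

(* [e2 k] is the position of the cluster [k], [A k] the length that one unit of mass
   occupies there, and [J k] the number of generations of the grid above it: it has
   to dominate [(k + 1) ^ 2], the ratio of the height of contradiction to the
   length of the cluster. *)
Let e2 k : R := (2 ^+ k)^-1.
Let A k : R := (k.+1%:R)^-1.
Let J k := (k.+1 ^ 3)%N.

Let delta k : R := (16 * k.+1%:R * 8 ^+ k)^-1.

Lemma delta_gt0 k : 0 < delta k.
Proof. by rewrite invr_gt0 !mulr_gt0// exprn_gt0. Qed.

Lemma clusters_exist : exists cl : nat -> nat * nat,
  [/\ forall i k, (i < k)%N -> ((cl i).2 <= (cl k).1)%N,
      forall k, ((cl k).1 < (cl k).2)%N,
      forall k, 4 * 16 ^+ J k * b (cl k).1 < \sum_((cl k).1 <= j < (cl k).2) b j &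
      forall k, \sum_((cl k).1 <= j < (cl k).2) b j < delta k].
Proof.
have K0 k : (0 : R) < 4 * 16 ^+ J k by rewrite mulr_gt0// exprn_gt0.
have [F HF] := choice (fun kN : nat * nat => heavy_block kN.2 (K0 kN.1) (delta_gt0 kN.1)).
pose fix cl k := if k is k'.+1 then F (k, (cl k').2) else F (0, 0)%N.
have clE k : exists N, cl k = F (k, N) by case: k => [|k]; eexists.
have step k : ((cl k).2 <= (cl k.+1).1)%N by have [] := HF (k.+1, (cl k).2).
have lt k : ((cl k).1 < (cl k).2)%N by have [N ->] := clE k; have [] := HF (k, N).
exists cl; split => //.
- move=> i; elim=> [//|k ih]; rewrite ltnS leq_eqVlt => /predU1P[->//|/ih h].
  by apply: leq_trans (step k); apply: leq_trans h (ltnW (lt k)).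
- by move=> k; have [N ->] := clE k; have [] := HF (k, N).
- by move=> k; have [N ->] := clE k; have [] := HF (k, N).
Qed.

Section Configuration.
Variable cl : nat -> nat * nat.
Hypothesis cl_lt : forall i k, (i < k)%N -> ((cl i).2 <= (cl k).1)%N.
Hypothesis cl_nonempty : forall k, ((cl k).1 < (cl k).2)%N.
Hypothesis cl_heavy : forall k,
  4 * 16 ^+ J k * b (cl k).1 < \sum_((cl k).1 <= j < (cl k).2) b j.
Hypothesis cl_small : forall k, \sum_((cl k).1 <= j < (cl k).2) b j < delta k.

Definition in_cluster k j := ((cl k).1 <= j < (cl k).2)%N.
Let M k := \sum_((cl k).1 <= j < (cl k).2) b j.

Lemma cluster_uniq i k j : in_cluster i j -> in_cluster k j -> i = k.
Proof.
move=> /andP[i1 i2] /andP[k1 k2]; have [lt|lt|//] := ltngtP i k.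
  by have := cl_lt lt; rewrite leqNgt (leq_ltn_trans k1 i2).
by have := cl_lt lt; rewrite leqNgt (leq_ltn_trans i1 k2).
Qed.

(** Atoms end to end with density [k + 1] give a Poisson sum of order [k + 1] close
    to the cluster [k], whatever their sizes. The atoms that belong to no cluster
    are kept at a distance from all clusters. *)
Definition cluster_position (u : nat -> R) := forall j,
  (forall k, in_cluster k j ->
     u j = e2 k + A k * \sum_((cl k).1 <= i < j) b i) /\
  ((forall k, ~~ in_cluster k j) -> u j = 2 + (j.+1%:R)^-1).

Lemma cluster_position_exists : exists u, cluster_position u.
Proof.
have H j : exists v : R, (forall k, in_cluster k j ->
     v = e2 k + A k * \sum_((cl k).1 <= i < j) b i) /\
     ((forall k, ~~ in_cluster k j) -> v = 2 + (j.+1%:R)^-1).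
  have [[k kj]|no] := pselect (exists k, in_cluster k j).
    exists (e2 k + A k * \sum_((cl k).1 <= i < j) b i); split.
      by move=> i ij; rewrite (cluster_uniq ij kj).
    by move=> /(_ k); rewrite kj.
  exists (2 + (j.+1%:R)^-1); split => // k kj; exfalso; apply: no; by exists k.
by have [u Hu] := choice H; exists u.
Qed.

Variable u : nat -> R.
Hypothesis u_pos : cluster_position u.

Lemma M_gt0 k : 0 < M k.
Proof.
by apply: le_lt_trans (cl_heavy k); rewrite !mulr_ge0// exprn_ge0.
Qed.

Lemma e2_gt0 k : 0 < e2 k. Proof. by rewrite invr_gt0 exprn_gt0. Qed.
Lemma A_gt0 k : 0 < A k. Proof. by rewrite invr_gt0. Qed.
Lemma A_le1 k : A k <= 1. Proof. by rewrite invf_le1// ler1n. Qed.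

Lemma e2_le k i : (k <= i)%N -> e2 i <= e2 k.
Proof. by move=> ki; rewrite lef_pV2 ?posrE ?exprn_gt0// ler_weXn2l// ler1n. Qed.

Lemma e2S k : e2 k.+1 = e2 k / 2.
Proof. by rewrite /e2 exprS invfM mulrC. Qed.

Lemma e2_le1 k : e2 k <= 1.
Proof. by rewrite invf_le1 ?exprn_gt0// exprn_ege1// ler1n. Qed.

(** The height [(k + 1) M k] is large enough for the cluster [k] to look light, and
    small compared with the distance to the other atoms. *)
Lemma height_small k : k.+1%:R * M k <= e2 k ^+ 3 / 16.
Proof.
have := ltW (cl_small k); rewrite -/(M k) /delta => h.
have k0 : (0 : R) < k.+1%:R by [].
apply: (@le_trans _ _ (k.+1%:R * (16 * k.+1%:R * 8 ^+ k)^-1)).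
  by rewrite ler_wpM2l.
rewrite /e2 -exprVn -exprM mulnC exprM exprVn.
have -> : (2 ^- 3 : R) = 8^-1 by rewrite -natrX.
by rewrite le_eqVlt exprVn; apply/orP; left; apply/eqP; field; rewrite gt_eqF ?exprn_gt0// gt_eqF.
Qed.

Lemma e2_cube_le k : e2 k ^+ 3 <= e2 k.
Proof.
by rewrite exprS ler_piMr ?(ltW (e2_gt0 k))// exprn_ile1 ?(ltW (e2_gt0 k))// e2_le1.
Qed.

Lemma height_le k : k.+1%:R * M k <= e2 k / 16.
Proof.
by apply: le_trans (height_small k) _; rewrite ler_wpM2r ?invr_ge0// e2_cube_le.
Qed.

Lemma length_le_height k : A k * M k <= k.+1%:R * M k.
Proof.
rewrite ler_wpM2r ?(ltW (M_gt0 k))// (le_trans (A_le1 k))// ler1n//.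
Qed.

Lemma in_cluster_position k j : in_cluster k j ->
  u j = e2 k + A k * \sum_((cl k).1 <= i < j) b i.
Proof. by have [h _] := u_pos j; exact: h. Qed.

Lemma in_cluster_range k j : in_cluster k j -> e2 k <= u j <= e2 k * (17 / 16).
Proof.
move=> kj; rewrite (in_cluster_position kj); have /andP[k1 k2] := kj.
rewrite lerDl mulr_ge0 ?(ltW (A_gt0 k)) ?sumr_ge0//=.
have : A k * \sum_((cl k).1 <= i < j) b i <= A k * M k.
  by rewrite ler_wpM2l ?(ltW (A_gt0 k))// sum_nat_widen// ltnW.
have := length_le_height k; have := height_le k; lra.
Qed.

Lemma u_range j : 0 <= u j <= 3.
Proof.
have [[k kj]|no] := pselect (exists k, in_cluster k j).
  by have := in_cluster_range kj; have := e2_le1 k; have := e2_gt0 k; lra.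
have [_ ->] := u_pos j; last by move=> k; apply/negP => kj; apply: no; exists k.
have : (j.+1%:R^-1 : R) <= 1 by rewrite invf_le1// ler1n.
have : (0 : R) < j.+1%:R^-1 by rewrite invr_gt0.
by move: (_^-1) => v v0 v1; apply/andP; split; lra.
Qed.

Lemma clusters_apart i k j : (i < k)%N -> in_cluster k j -> u j <= e2 i * (17 / 32).
Proof.
move=> ik kj; have /andP[_ h] := in_cluster_range kj.
have := e2_le ik; rewrite e2S; lra.
Qed.

(** The clusters lie in disjoint dyadic intervals below [2], and the partial sums
    are increasing inside a cluster. *)
Lemma u_inj : injective u.
Proof.
move=> i j uij.
have no_cl (l : nat) : ~ (exists k, in_cluster k l) -> u l = 2 + (l.+1%:R)^-1.
  move=> no; have [_ ->//] := u_pos l.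
  by move=> k; apply/negP => kl; apply: no; exists k.
have lt2 k l : in_cluster k l -> u l < 2.
  by move=> kl; have := in_cluster_range kl; have := e2_le1 k; lra.
have gt2 (l : nat) : ~ (exists k, in_cluster k l) -> 2 < u l.
  by move=> /no_cl->; rewrite ltrDl invr_gt0.
have [[k ki]|ni] := pselect (exists k, in_cluster k i); last first.
  have [[l lj]|nj] := pselect (exists k, in_cluster k j).
    by have := gt2 _ ni; rewrite uij ltNge (ltW (lt2 _ _ lj)).
  move: uij; rewrite (no_cl _ ni) (no_cl _ nj) => /addrI/invr_inj/eqP.
  by rewrite eqr_nat => /eqP[].
have [[l lj]|nj] := pselect (exists k, in_cluster k j); last first.
  by have := gt2 _ nj; rewrite -uij ltNge (ltW (lt2 _ _ ki)).
have strict p q : in_cluster k p -> in_cluster k q -> (p < q)%N -> u p < u q.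
  move=> kp kq pq; rewrite (in_cluster_position kp) (in_cluster_position kq).
  rewrite ltrD2l ltr_pM2l ?A_gt0//; have /andP[k1 _] := kp.
  rewrite [ltRHS](@big_cat_nat _ _ _ p)//=; last exact: ltnW.
  rewrite ltrDl (@big_cat_nat _ _ _ p.+1)//= big_nat1.
  by rewrite ltr_wpDr ?sumr_ge0.
have [lt|lt|kl] := ltngtP k l.
- exfalso; have := clusters_apart lt lj; rewrite -uij.
  by have := in_cluster_range ki; have := e2_gt0 k; lra.
- exfalso; have := clusters_apart lt ki; rewrite uij.
  by have := in_cluster_range lj; have := e2_gt0 l; lra.
- subst l; have [lt|lt|//] := ltngtP i j.
    by have := strict _ _ ki lj lt; rewrite uij ltxx.
  by have := strict _ _ lj ki lt; rewrite uij ltxx.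
Qed.

(** A point at height comparable to [(k + 1) M k] above the cluster [k] sees all
    the atoms of that cluster at once, and the others from afar. *)
Lemma poisson_above_cluster k s e n :
  let H := k.+1%:R * M k in
  H < 3 * e -> e < 3 * H -> `|e2 k - s| < 4 / 3 * H ->
  \sum_(0 <= j < n) b j * poisson (cay s e) (cay (u j) 0) <=
    30 / k.+1%:R + 30 * (\sum_(0 <= j < n) b j) / k.+1%:R.
Proof.
move=> H e1 e3 sk.
have k0 : (0 : R) < k.+1%:R by [].
have M0 := M_gt0 k; have H0 : 0 < H by rewrite mulr_gt0.
have h3 : H <= e2 k ^+ 3 / 16 := height_small k.
have H16 : H <= e2 k / 16 := height_le k.
have HM : M k * (30 / H) = 30 / k.+1%:R by rewrite /H; field; rewrite !gt_eqF.
have e0 : 0 < e by lra.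
have e20 := e2_gt0 k; have e21 := e2_le1 k.
clearbody H.
have cH : 0 <= 30 * (16 * H) / e2 k ^+ 2.
  apply: divr_ge0; last exact: sqr_ge0.
  by rewrite !mulr_ge0 ?ler0n// ltW.
have term j : poisson (cay s e) (cay (u j) 0) <=
    (if in_cluster k j then 30 / H else 0) + 30 * (16 * H) / e2 k ^+ 2.
  rewrite poisson_cay//; have /andP[u0 u3] := u_range j.
  have u10 : 1 + u j ^+ 2 <= 10.
    have : u j ^+ 2 <= 3 ^+ 2 by rewrite ler_pXn2r// nnegrE.
    by rewrite -natrX /= => h; lra.
  have d0 : 0 < (s - u j) ^+ 2 + e ^+ 2 by rewrite ltr_wpDl ?sqr_ge0// exprn_gt0.
  have ed0 : 0 <= e / ((s - u j) ^+ 2 + e ^+ 2) by apply: divr_ge0; exact: ltW.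
  have u11 : 0 <= 1 + u j ^+ 2 by apply: addr_ge0 => //; exact: sqr_ge0.
  case: ifPn => kj.
    apply: ler_wpDr cH _; apply: (@le_trans _ _ (10 * (3 / H))); last first.
      by rewrite le_eqVlt; apply/orP; left; apply/eqP; field; rewrite gt_eqF.
    apply: ler_pM => //; rewrite ler_pdivrMr// mulrAC ler_pdivlMr//.
    apply: (@le_trans _ _ (3 * e ^+ 2)).
      by rewrite expr2 mulrA [leRHS]mulrC ler_wpM2l ?(ltW e0)// ltW.
    by rewrite ler_wpM2l// lerDr sqr_ge0.
  rewrite add0r; apply: (@le_trans _ _ (10 * (3 * (16 * H) / e2 k ^+ 2))); last first.
    by rewrite le_eqVlt; apply/orP; left; apply/eqP; field; rewrite gt_eqF.
  apply: ler_pM => //.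
  have far : e2 k / 4 <= `|s - u j|.
    have sk' : e2 k - e2 k / 12 <= s <= e2 k + e2 k / 12.
      by move: sk; rewrite ltr_norml => /andP[? ?]; apply/andP; split; lra.
    have [[l lj]|nj] := pselect (exists l, in_cluster l j); last first.
      rewrite distrC ler_normr; apply/orP; left.
      have [_ ->] := u_pos j; last by move=> l; apply/negP => lj; apply: nj; exists l.
      have : (0 : R) < j.+1%:R^-1 by rewrite invr_gt0.
      by move: (j.+1%:R^-1) => v v0; lra.
    have [lt|lt|kl] := ltngtP k l; last by rewrite kl lj in kj.
      rewrite ler_normr; apply/orP; left; have := clusters_apart lt lj; lra.
    rewrite distrC ler_normr; apply/orP; left.
    by have := in_cluster_range lj; have := e2_le lt; rewrite e2S; lra.
  have far2 : e2 k ^+ 2 / 16 <= (s - u j) ^+ 2.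
    rewrite -(real_normK (num_real (s - u j))).
    have -> : e2 k ^+ 2 / 16 = (e2 k / 4) ^+ 2 by field.
    by rewrite ler_pXn2r// nnegrE ?normr_ge0// divr_ge0// ltW.
  have e22 : 0 < e2 k ^+ 2 by rewrite exprn_gt0.
  rewrite ler_pdivrMr// mulrAC ler_pdivlMr//.
  apply: (@le_trans _ _ (3 * H * (16 * ((s - u j) ^+ 2 + e ^+ 2)))).
    apply: ler_pM (ltW e0) (ltW e22) (ltW e3) _.
    by have := sqr_ge0 e; lra.
  by rewrite le_eqVlt; apply/orP; left; apply/eqP; ring.
apply: (@le_trans _ _ (\sum_(0 <= j < n) b j *
    ((if in_cluster k j then 30 / H else 0) + 30 * (16 * H) / e2 k ^+ 2))).
  by apply: ler_sum => j _; rewrite ler_wpM2l.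
under eq_bigr => j _ do rewrite mulrDr.
rewrite big_split/= -mulr_suml lerD//.
  have -> : \sum_(0 <= j < n) b j * (if in_cluster k j then 30 / H else 0) =
     (\sum_(0 <= j < n | in_cluster k j) b j) * (30 / H).
    rewrite mulr_suml [RHS]big_mkcond; apply: eq_bigr => j _.
    by case: ifP => _; rewrite ?mulr0.
  apply: (@le_trans _ _ (M k * (30 / H))).
    by apply: ler_wpM2r; [rewrite divr_ge0// ltW|exact: sum_window_le].
  by rewrite HM.
rewrite mulrC -mulrA [leRHS]mulrAC ler_wpM2r ?sumr_ge0//.
apply: (@le_trans _ _ (30 * e2 k)).
  rewrite mulrA ler_pdivrMr ?exprn_gt0//.
  have -> : 30 * e2 k * e2 k ^+ 2 = 30 * (16 * (e2 k ^+ 3 / 16)) by field.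
  by rewrite ler_wpM2l ?ler0n// ler_wpM2l ?ler0n.
rewrite ler_wpM2l// /e2 lef_pV2 ?posrE ?exprn_gt0//.
by rewrite -natrX ler_nat ltn_expl.
Qed.

(** Inside the box over the cluster [k], the atoms of the cluster alone give a
    Poisson sum of order [k]. *)
Lemma poisson_inside_cluster k t y (P : R) :
  e2 k <= t <= e2 k + A k * M k -> A k * M k / 16 ^+ J k <= y <= A k * M k ->
  (fun n => \sum_(0 <= j < n) b j * poisson (cay t y) (cay (u j) 0)) @ \oo --> P ->
  k.+1%:R / 8 <= P.
Proof.
move=> tI /andP[y1 y2] PP; have A0 := A_gt0 k; have M0 := M_gt0 k.
have e16 : (0 : R) < 16 ^+ J k by rewrite exprn_gt0.
have y0 : 0 < y by apply: lt_le_trans y1; rewrite divr_gt0// mulr_gt0.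
have y3 : 4 * A k * b (cl k).1 <= y <= A k * M k.
  rewrite y2 andbT (le_trans _ y1)// ler_pdivlMr//.
  have -> : 4 * A k * b (cl k).1 * 16 ^+ J k = A k * (4 * 16 ^+ J k * b (cl k).1) by ring.
  by rewrite ler_wpM2l ?(ltW A0)// ltW.
have := cluster_poisson_lower b_ge0 (fun j h => b_anti h) A0 y0 (ltnW (cl_nonempty k)) tI y3.
have -> : 1 / (8 * A k) = k.+1%:R / 8 by rewrite /A invfM invrK mul1r mulrC.
move=> h; apply: le_trans h _.
apply: (@le_trans _ _ (\sum_(0 <= j < (cl k).2) b j * poisson (cay t y) (cay (u j) 0))).
  rewrite [leRHS](@big_cat_nat _ _ _ (cl k).1)//=; last exact: ltnW.
  apply: ler_wpDl.
    by apply: sumr_ge0 => j _; rewrite mulr_ge0 ?poisson_ge0 ?cay_disc.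
  rewrite big_nat_cond [leRHS]big_nat_cond.
  apply: ler_sum => j /andP[jk _]; rewrite ler_wpM2l// poisson_cay//.
  rewrite (in_cluster_position jk) ler_peMl ?lerDl ?sqr_ge0//.
  by apply: divr_ge0; [exact: ltW|apply: addr_ge0; exact: sqr_ge0].
by apply: series_le_lim PP => j; rewrite mulr_ge0// poisson_ge0// cay_disc.
Qed.

(** On the box above the cluster [k] the Poisson sum is at least [(k + 1) / 8], so
    the weak embedding property puts a zero of [B] near every grid point. These
    zeros make [B] small at height [(k + 1) M k], hence there is a zero near this
    point too; but there the Poisson sum is of order [1 / (k + 1)], so [|S|] is
    close to one, against the condition on the zeros of [B]. *)
Lemma cluster_configuration_not_wepable (S : C -> C) (mu : {measure set borelC R -> \bar R}) :
  is_atomic_measure b (fun j => cay (u j) 0) mu ->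
  (forall z, unit_disc z -> S z = singular_function mu z) -> ~ easily_wepable S.
Proof.
move=> mub SE [_ [m [B [m1 [a [a_disc a_cvg B_lim]] HW Zsub]]]].
have a_sum : summable_seq (@opt_gap R \o a).
  by apply: cvg_summable a_cvg => n; exact: opt_gap_ge0.
have SP z : normc z < 1 -> exists2 P : R,
    (fun n => \sum_(0 <= j < n) b j * poisson z (cay (u j) 0)) @ \oo --> P &
    normc (S z) = expR (- P).
  move=> z1; rewrite SE//.
  exact: (normc_singular b_ge0 b_sum (fun j => cay_circle (u j)) mub z1).
have P_ge0 z P : normc z < 1 ->
    (fun n => \sum_(0 <= j < n) b j * poisson z (cay (u j) 0)) @ \oo --> P -> 0 <= P.
  move=> z1 PP; apply: le_trans (series_le_lim 0 _ PP); first by rewrite big_geq.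
  by move=> j; rewrite mulr_ge0 ?poisson_ge0.
have [W bW] := b_sum.
have W0 : 0 <= W by apply: le_trans (bW 0%N); rewrite big_geq.
have half0 : (0 : R) < 1 / 2 by rewrite divr_gt0.
have [eta eta0 near] := WEP_near_zero HW half0.
have near_zero z : normc z < 1 -> normc (S z) * normc (B z) < eta ->
    exists w, [/\ normc w < 1, B w = 0, rho z w < 1 / 2 & normc (S w) < m].
  move=> z1; rewrite -normcM => h.
  have [w [w1 Fw r]] := near z z1 h.
  have Bw : B w = 0.
    move/eqP: Fw; rewrite mulf_eq0 => /orP[/eqP Sw|/eqP//].
    by have [P _] := SP w w1; rewrite Sw normc0 => h0; have := expR_gt0 (- P); rewrite -h0 ltxx.
  exists w; split => //.
  by have [] := Zsub w (conj w1 Bw).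
(* Two lower bounds for [k]: the first makes [|B|] smaller than [eta], the second
   makes the Poisson sum at the zero smaller than [1 - m]. *)
pose X := 48 * (1 / eta) + 30 * (1 + W) / (1 - m).
have m10 : 0 < 1 - m by rewrite subr_gt0.
have ie0 : 0 < 1 / eta by rewrite divr_gt0.
have X2 : 0 <= 30 * (1 + W) / (1 - m).
  by rewrite divr_ge0 ?(ltW m10)// mulr_ge0 ?ler0n// addr_ge0.
have X0 : 0 <= X by rewrite addr_ge0// mulr_ge0 ?ler0n// ltW.
pose k := Num.bound X.
have kX : X < k.+1%:R.
  apply: lt_trans (_ : k%:R < _); last by rewrite ltr_nat.
  by have := archi_boundP X0.
have kX1 : 48 * (1 / eta) < k.+1%:R by apply: le_lt_trans kX; rewrite lerDl.
have kX2 : 30 * (1 + W) / (1 - m) < k.+1%:R.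
  by apply: le_lt_trans kX; rewrite lerDr mulr_ge0 ?ler0n// ltW.
clearbody k; clear X X0 kX.
have k0 : (0 : R) < k.+1%:R by [].
pose H := k.+1%:R * M k.
have M0 := M_gt0 k; have H0 : 0 < H by rewrite mulr_gt0.
have L0 : 0 < A k * M k by rewrite mulr_gt0 ?A_gt0.
have grid t y : e2 k <= t <= e2 k + A k * M k ->
    A k * M k / 16 ^+ J k <= y <= A k * M k ->
    exists w, [/\ normc w < 1, B w = 0 & rho (cay t y) w < 1 / 2].
  move=> tI yI; have /andP[y1 _] := yI.
  have y0 : 0 < y by apply: lt_le_trans y1; rewrite divr_gt0// exprn_gt0.
  have z1 := cay_disc t y0; have [P PP SzP] := SP _ z1.
  have [|w [w1 Bw r _]] := near_zero _ z1; last by exists w.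
  apply: (@le_lt_trans _ _ (normc (S (cay t y)))).
    by rewrite ler_piMr ?normc_ge0// (blaschke_le1 a_disc B_lim).
  rewrite SzP; apply: expRN_lt => //.
  by apply: lt_le_trans (poisson_inside_cluster tI yI PP); lra.
have z1 := cay_disc (e2 k) H0.
have Bz := blaschke_grid_upper a_disc a_sum B_lim L0 (length_le_height k) grid.
have [|w [w1 Bw r Sw]] := near_zero _ z1.
  apply: (@le_lt_trans _ _ (normc (B (cay (e2 k) H)))).
    rewrite ler_piMl ?normc_ge0//; have [P PP ->] := SP _ z1.
    by rewrite -expR0 ler_expR oppr_le0; exact: P_ge0 PP.
  apply: le_lt_trans Bz _; apply: expRN_lt => //.
  have -> : (J k)%:R * (A k * M k) / (48 * (k.+1%:R * M k)) = k.+1%:R / 48.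
    by rewrite /J /A natrX; field; rewrite !gt_eqF.
  lra.
have [s [e [e0 we]]] := cay_surj w1.
rewrite we in r; have [r1 r2 r3] := rho_cay_half H0 e0 r.
have [P PP SwP] := SP w w1.
have : 1 - m < P by have := expR_ge1Dx (- P); rewrite SwP in Sw; lra.
apply/negP; rewrite -leNgt; apply: (lim_le_bound PP) => n.
rewrite we; apply: le_trans (poisson_above_cluster n r1 r2 r3) _.
rewrite -mulrDl ler_pdivrMr// -ler_pdivrMl// mulrC.
apply: le_trans (ltW kX2); rewrite ler_wpM2r ?invr_ge0 ?(ltW m10)//.
by have := bW n; lra.
Qed.

End Configuration.

(** A sequence violating the tail condition has blocks whose total mass is
    arbitrarily larger than their largest element. Placing such a block densely
    on a short arc forces the zeros of [B] to fill a box over the arc, at so many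
    scales that [B] is small, hence has a zero, at a point where [S] is not. *)
Theorem heavy_tails_not_wepable :
  exists S : C -> C, atomic_singular_inner b S /\ ~ easily_wepable S.
Proof.
have [cl [h1 h2 h3 h4]] := clusters_exist.
have [u Hu] := cluster_position_exists h1.
have [mu mub] := atomic_measure_exists (fun j => cay (u j) 0) b_ge0.
exists (singular_function mu); split; last first.
  move=> ew.
  by have := cluster_configuration_not_wepable h2 h3 h4 Hu mub (fun _ _ => erefl) ew.
exists (fun j => cay (u j) 0), mu; split => //.
- by move=> j; exact: cay_circle.
- move=> i j /= e; apply: (u_inj h3 h4 Hu).
  have := normc_cay_dist (u i) (u j) (lexx 0) (lexx 0).
  rewrite e subrr normc0 expr0n/= subrr expr0n/= addr0 => /esym/eqP.
  rewrite mulf_eq0 mulf_eq0 pnatr_eq0 orFb invr_eq0 mulf_eq0.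
  rewrite orbb mulf_eq0 !(gt_eqF (cay_den_gt0 _ _))// !orbF subr_eq0.
  by move/eqP.
Qed.

End HeavyTails.

(** * Geometric decay of masses with light tails *)

Section GeometricDecay.
Variable R : realType.

(** Heights and masses are both written as eighth powers, so that the fractional
    exponents of the estimates become integers. *)
Definition eighth_root (x : R) : R := Num.sqrt (Num.sqrt (Num.sqrt x)).

Lemma eighth_rootK x : 0 <= x -> eighth_root x ^+ 8 = x.
Proof.
move=> x0; rewrite -[8%N]/(2 * (2 * 2))%N !exprM.
by rewrite !sqr_sqrtr ?sqrtr_ge0.
Qed.

Lemma eighth_root_gt0 x : 0 < x -> 0 < eighth_root x.
Proof. by move=> x0; rewrite !sqrtr_gt0. Qed.

Variable b : nat -> R.
Hypothesis b_gt0 : forall s, 0 < b s.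
Hypothesis b_anti : forall i j, (i <= j)%N -> b j <= b i.

Definition beta s := eighth_root (b s).

Lemma beta_gt0 s : 0 < beta s. Proof. exact: eighth_root_gt0. Qed.

Lemma beta8 s : beta s ^+ 8 = b s. Proof. by rewrite eighth_rootK// ltW. Qed.

Lemma beta_anti i j : (i <= j)%N -> beta j <= beta i.
Proof.
move=> ij; rewrite -(@ler_pXn2r _ 8)// ?nnegrE ?(ltW (beta_gt0 _))//.
by rewrite !beta8 b_anti.
Qed.

(** If [b] lost less than the factor [2 ^ 8] over a block of [L] indices, the mass of
    that block would exceed the tail bound once [L] is larger than [2 ^ 8 K]. *)
Lemma beta_halving (K : R) : 1 <= K -> (forall s n, \sum_(s <= k < n) b k <= K * b s) ->
  exists2 L, (0 < L)%N & forall s, beta (s + L) <= beta s / 2.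
Proof.
move=> K_ge1 b_tail; have K_ge0 : 0 <= K by exact: le_trans K_ge1.
have K0 : 0 <= K * 2 ^+ 8 by rewrite mulr_ge0 ?exprn_ge0.
pose L := (Num.bound (K * 2 ^+ 8)).+1; exists L => // s.
rewrite -(@ler_pXn2r _ 8)// ?nnegrE ?divr_ge0 ?(ltW (beta_gt0 _))//.
rewrite expr_div_n !beta8 ler_pdivlMr ?exprn_gt0//.
have L0 : (0 : R) < L%:R by rewrite ltr0n.
rewrite -(ler_pM2r L0) mulrAC.
apply: (@le_trans _ _ (\sum_(s <= k < s + L) b k * 2 ^+ 8)).
  rewrite -mulr_suml ler_wpM2r ?exprn_ge0//.
  apply: (@le_trans _ _ (\sum_(s <= k < s + L) b (s + L))).
    by rewrite sumr_const_nat addKn mulr_natr.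
  rewrite big_nat_cond [leRHS]big_nat_cond; apply: ler_sum => k /andP[/andP[_ kL] _].
  by apply: b_anti; exact: ltnW.
rewrite -mulr_suml; apply: (@le_trans _ _ (K * b s * 2 ^+ 8)).
  by rewrite ler_wpM2r ?exprn_ge0.
rewrite mulrAC mulrC ler_wpM2l ?(ltW (b_gt0 s))//.
apply: (le_trans (ltW (archi_boundP K0))).
by rewrite ler_nat leqnSn.
Qed.

Variable L : nat.
Hypothesis L_gt0 : (0 < L)%N.
Hypothesis beta_half : forall s, beta (s + L) <= beta s / 2.

(** Halving every [L] steps: each block of [L] terms contributes at most [L] times
    its first term, and the blocks form a geometric series. *)
Lemma sum_beta_le m n : \sum_(m <= s < n) beta s <= 2 * L%:R * beta m.
Proof.
have [d] := ubnP (n - m); elim: d m => // d ih m nmd.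
have [nm|nm] := leqP n (m + L).
  apply: (@le_trans _ _ (\sum_(m <= s < m + L) beta s)).
    by apply: sum_nat_widen => // k; exact: ltW (beta_gt0 k).
  apply: (@le_trans _ _ (\sum_(m <= s < m + L) beta m)).
    rewrite big_nat_cond [leRHS]big_nat_cond; apply: ler_sum => k /andP[/andP[mk _] _].
    exact: beta_anti.
  rewrite sumr_const_nat addKn -[leLHS]mulr_natl ler_wpM2r ?(ltW (beta_gt0 _))//.
  by have : (0 : R) <= L%:R by []; lra.
rewrite (@big_cat_nat _ _ _ (m + L))//=; [|exact: leq_addr|exact: ltnW].
have h2 : \sum_(m + L <= s < n) beta s <= L%:R * beta m.
  apply: le_trans (ih (m + L)%N _) _; first by lia.
  rewrite -mulrA mulrCA ler_wpM2l//.
  by have := beta_half m; lra.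
have h1 : \sum_(m <= s < m + L) beta s <= L%:R * beta m.
  apply: (@le_trans _ _ (\sum_(m <= s < m + L) beta m)).
    rewrite big_nat_cond [leRHS]big_nat_cond; apply: ler_sum => k /andP[/andP[mk _] _].
    exact: beta_anti.
  by rewrite sumr_const_nat addKn -[leLHS]mulr_natl.
lra.
Qed.

Lemma sum_beta_inv_le n : \sum_(0 <= s < n.+1) (beta s)^-1 <= 2 * L%:R / beta n.
Proof.
have iv k j : (k <= j)%N -> (beta k)^-1 <= (beta j)^-1.
  by move=> kj; rewrite lef_pV2 ?posrE ?beta_gt0// beta_anti.
have i0 k : 0 <= (beta k)^-1 by rewrite invr_ge0 ltW// beta_gt0.
have [d] := ubnP n; elim: d n => // d ih n nd.
have block m : \sum_(m <= s < n.+1) (beta s)^-1 <= (n.+1 - m)%:R / beta n.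
  apply: (@le_trans _ _ (\sum_(m <= s < n.+1) (beta n)^-1)).
    rewrite big_nat_cond [leRHS]big_nat_cond; apply: ler_sum => k /andP[/andP[_ kn] _].
    by apply: iv; rewrite -ltnS.
  by rewrite sumr_const_nat -[leLHS]mulr_natl.
have [nL|Ln] := leqP n.+1 L.
  apply: (le_trans (block 0%N)); rewrite subn0 ler_wpM2r//.
  have : (n.+1%:R : R) <= L%:R by rewrite ler_nat.
  by have : (0 : R) <= L%:R by []; lra.
rewrite (@big_cat_nat _ _ _ (n.+1 - L))//=; last exact: leq_subr.
have h1 : \sum_(n.+1 - L <= s < n.+1) (beta s)^-1 <= L%:R / beta n.
  by apply: (le_trans (block _)); rewrite subKn// ltnW.
have e : (n.+1 - L)%N = (n - L).+1 by lia.
have h2 : \sum_(0 <= s < n.+1 - L) (beta s)^-1 <= L%:R / beta n.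
  rewrite e; apply: le_trans (ih (n - L)%N _) _; first by lia.
  have -> : 2 * L%:R / beta (n - L) = L%:R * (2 / beta (n - L)) by ring.
  rewrite ler_wpM2l// ler_pdivrMr ?beta_gt0//.
  have := beta_half (n - L); rewrite subnK; last by lia.
  move=> h; rewrite mulrC ler_pdivlMr ?beta_gt0//; lra.
have -> : 2 * L%:R / beta n = L%:R / beta n + L%:R / beta n by ring.
by rewrite addrC lerD.
Qed.

(** The indices with [beta s > y] form an initial segment, along which the
    quotients [y / beta s] decay geometrically backwards. *)
Lemma sum_ratio_le (y : R) n : 0 < y ->
  \sum_(0 <= s < n | y < beta s) y / beta s <= 2 * L%:R.
Proof.
move=> y0; elim: n => [|n ih]; first by rewrite big_geq// mulr_ge0.
rewrite big_mkcond/= big_nat_recr//= -big_mkcond/=.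
case: ifPn => yn; last by rewrite addr0.
apply: (@le_trans _ _ (y * \sum_(0 <= s < n.+1) (beta s)^-1)).
  rewrite big_nat_recr//= mulrDr lerD2r mulr_sumr [leLHS]big_mkcond/=.
  apply: ler_sum => s _; case: ifP => // _.
  by rewrite mulr_ge0 ?(ltW y0)// invr_ge0 ltW// beta_gt0.
apply: le_trans (ler_wpM2l (ltW y0) (sum_beta_inv_le n)) _.
rewrite mulrCA ler_piMr ?mulr_ge0// ler_pdivrMr ?beta_gt0//.
by rewrite mul1r ltW.
Qed.

Variable K : R.
Hypothesis K_ge1 : 1 <= K.
Hypothesis b_tail : forall s n, \sum_(s <= k < n) b k <= K * b s.

Let K_ge0 : 0 <= K. Proof. exact: le_trans K_ge1. Qed.

(** The atoms lighter than [y] form a tail whose first term is at most [y]. *)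
Lemma sum_small_le (y : R) n : 0 <= y ->
  \sum_(0 <= s < n | b s <= y) b s <= K * y.
Proof.
move=> y0; have Ky : 0 <= K * y by rewrite mulr_ge0.
have [[m bm]|no] := pselect (exists m, b m <= y); last first.
  rewrite big_pred0// => s; apply/negbTE/negP => bs; apply: no; by exists s.
case: (ex_minnP (ex_intro (fun m => b m <= y) m bm)) => p bp pmin.
apply: (@le_trans _ _ (\sum_(p <= s < n) b s)); last first.
  by apply: (le_trans (b_tail p n)); rewrite ler_wpM2l.
have [np|pn] := leqP n p.
  rewrite [leRHS]big_geq// big_nat_cond big_pred0// => s.
  apply/negbTE; rewrite leq0n/=; apply/negP => /andP[sn /pmin ps].
  by have := leq_ltn_trans ps sn; rewrite ltnNge np.
rewrite (@big_cat_nat _ _ _ p)//=; last exact: ltnW.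
rewrite big_nat_cond big_pred0 ?add0r; last first.
  move=> s; apply/negbTE; rewrite leq0n/=; apply/negP => /andP[sp /pmin ps].
  by have := leq_ltn_trans ps sp; rewrite ltnn.
rewrite big_mkcond/=; apply: ler_sum => s _; case: ifP => // _; exact: ltW.
Qed.

(** The atoms lighter than the height of [a] contribute at most [2 K]. Over the
    others the weights [Y / beta s] have sum at most [2 L], so one of them takes at
    least the corresponding share of the Poisson sum, which confines [a] to a disc
    around it. *)
Lemma heavy_atom (x : nat -> R[i]) (a : R[i]) (Y tau : R) (G : pred nat) n :
  (forall s, normc (x s) = 1) -> 0 < Y -> 1 - normc a = Y ^+ 8 -> 4 * K <= tau ->
  tau < \sum_(0 <= s < n | G s) b s * poisson a (x s) ->
  exists s, [/\ (s < n)%N, G s, Y < beta s &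
    normc (a - x s) ^+ 2 < 8 * L%:R / tau * (beta s ^+ 5 * Y ^+ 3) ^+ 2].
Proof.
move=> x1 Y0 aY tauK big.
have L0 : (0 : R) < L%:R by rewrite ltr0n.
have tau0 : 0 < tau by have K1 := K_ge1; lra.
have y0 : 0 < Y ^+ 8 by rewrite exprn_gt0.
have a1 : normc a < 1 by lra.
have na := normc_ge0 a.
have ax s : Y ^+ 8 <= normc (x s - a) by rewrite -aY circle_sub_lower.
have ax0 s : 0 < normc (x s - a) by exact: lt_le_trans y0 (ax s).
have p1 s : poisson a (x s) <= 2 * Y ^+ 8 / normc (x s - a) ^+ 2.
  rewrite /poisson ler_wpM2r ?invr_ge0 ?sqr_ge0//.
  have -> : 1 - normc a ^+ 2 = (1 - normc a) * (1 + normc a) by ring.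
  by rewrite aY mulrC ler_wpM2r ?(ltW y0)//; lra.
have p2 s : poisson a (x s) <= 2 / Y ^+ 8.
  apply: (le_trans (p1 s)); rewrite ler_pdivrMr ?exprn_gt0// mulrAC.
  rewrite ler_pdivlMr// -mulrA ler_wpM2l// -expr2.
  by rewrite ler_pXn2r ?nnegrE ?(ltW y0) ?normc_ge0.
have bY s : (b s <= Y ^+ 8) = (beta s <= Y).
  by rewrite -beta8 ler_pXn2r ?nnegrE ?(ltW Y0) ?(ltW (beta_gt0 s)).
apply: contrapT => no.
move: big; apply/negP; rewrite -leNgt (bigID (fun s => beta s <= Y))/=.
(* The Poisson kernel at height [Y ^ 8] is at most [2 / Y ^ 8]. *)
have h1 : \sum_(0 <= s < n | G s && (beta s <= Y)) b s * poisson a (x s) <= tau / 2.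
  apply: (@le_trans _ _ (\sum_(0 <= s < n | b s <= Y ^+ 8) b s * (2 / Y ^+ 8))).
    rewrite big_mkcond [leRHS]big_mkcond/=; apply: ler_sum => s _.
    rewrite bY; case: (G s) => /=; case: ifP => // _.
      by rewrite ler_wpM2l ?(ltW (b_gt0 s)).
    by rewrite mulr_ge0 ?(ltW (b_gt0 s))// divr_ge0// ltW.
  rewrite -mulr_suml; apply: (@le_trans _ _ (K * Y ^+ 8 * (2 / Y ^+ 8))).
    by rewrite ler_wpM2r ?divr_ge0 ?(ltW y0)// sum_small_le// ltW.
  have -> : K * Y ^+ 8 * (2 / Y ^+ 8) = 2 * K by field; rewrite gt_eqF.
  lra.
have h2 : \sum_(0 <= s < n | G s && ~~ (beta s <= Y)) b s * poisson a (x s) <= tau / 2.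
  apply: (@le_trans _ _ (\sum_(0 <= s < n | Y < beta s) tau / (4 * L%:R) * (Y / beta s))).
    rewrite big_nat_cond [leRHS]big_nat_cond big_mkcond [leRHS]big_mkcond/=.
    apply: ler_sum => s _; rewrite -ltNge.
    have r0 : 0 < tau / (4 * L%:R) * (Y / beta s).
      by rewrite mulr_gt0// divr_gt0 ?mulr_gt0// beta_gt0.
    case: ifPn => [/andP[sn /andP[Gs Ys]]|_]; last by case: ifP => // _; exact: ltW.
    rewrite sn Ys/=; rewrite leNgt; apply/negP => h; apply: no; exists s; split => //.
    have Yb1 : Y / beta s <= 1 by rewrite ler_pdivrMr ?beta_gt0// mul1r ltW.
    have Yb0 : 0 < Y / beta s by rewrite divr_gt0// beta_gt0.
    (* Replacing the weight by its square costs nothing, as it is at most one, and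
       gives the exponents 5 and 3. *)
    have {}h : tau / (4 * L%:R) * (Y / beta s) ^+ 2 <
        beta s ^+ 8 * (2 * Y ^+ 8 / normc (x s - a) ^+ 2).
      apply: (@le_lt_trans _ _ (tau / (4 * L%:R) * (Y / beta s))).
        by rewrite ler_wpM2l ?divr_ge0 ?mulr_ge0 ?(ltW tau0)// expr2 ler_piMr// ltW.
      by apply: (lt_le_trans h); rewrite beta8 ler_wpM2l ?(ltW (b_gt0 s)).
    rewrite normc_distC; move: h (ax0 s) (beta_gt0 s).
    move: (normc _) (beta s) => D B h D0 B0.
    have {}h : D ^+ 2 * (tau / (4 * L%:R) * (Y / B) ^+ 2) < B ^+ 8 * (2 * Y ^+ 8).
      by rewrite mulrC -ltr_pdivlMr ?exprn_gt0// -[ltRHS]mulrA.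
    have c0 : 0 < tau / (4 * L%:R) * (Y / B) ^+ 2.
      by rewrite mulr_gt0 ?exprn_gt0 ?divr_gt0 ?mulr_gt0.
    have -> : 8 * L%:R / tau * (B ^+ 5 * Y ^+ 3) ^+ 2 =
        B ^+ 8 * (2 * Y ^+ 8) / (tau / (4 * L%:R) * (Y / B) ^+ 2).
      by field; rewrite !gt_eqF.
    by rewrite ltr_pdivlMr.
  rewrite -mulr_sumr; apply: (@le_trans _ _ (tau / (4 * L%:R) * (2 * L%:R))).
    by rewrite ler_wpM2l ?sum_ratio_le// divr_ge0 ?mulr_ge0// ltW.
  by rewrite le_eqVlt; apply/orP; left; apply/eqP; field; rewrite gt_eqF.
lra.
Qed.

End GeometricDecay.

(** * Equidistributed points on circles *)

Section Angles.
Variable R : realType.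
Local Notation C := R[i].

Lemma cisX (t : R) n : cis (t *+ n) = cis t ^+ n.
Proof.
elim: n => [|n ih]; first by rewrite mulr0n expr0 /cis cos0 sin0.
by rewrite mulrS cisD exprS ih.
Qed.

Lemma cis_2pi : cis (pi *+ 2) = 1 :> C.
Proof. by rewrite /cis cos2pi sin2pi. Qed.

Lemma cis_periodic (t : R) : cis (t - pi *+ 2) = cis t.
Proof. by have := cisD (t - pi *+ 2) (pi *+ 2); rewrite subrK cis_2pi mulr1 => ->. Qed.

Lemma cis_2pi_sub (t : R) : cis (pi *+ 2 - t) = cis (- t).
Proof. by rewrite -(cis_periodic (pi *+ 2 - t)) addrAC subrr add0r. Qed.

Lemma cis_dist_le (s t : R) : normc (cis s - cis t) <= 4 * `|s - t|.
Proof.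
have -> : cis s - cis t = - (cis t * (1 - cis (s - t))).
  by rewrite mulrBr -cisD (addrC t) subrK mulr1 opprB.
rewrite normc_opp normcM normc_cis mul1r.
have -> : cis (s - t) = cexp (0 +i* (s - t))%C.
  by rewrite /cexp /= expR0 rmorph1 mul1r.
apply: le_trans (cexp_deviation (v := (0 +i* (s - t))%C) _) _; first by [].
by rewrite ler_wpM2l//= expr0n/= add0r sqrtr_sqr.
Qed.

(** The triple angle formula makes [c = cos (pi / 3)] a root of
    [(c + 1) (2 c - 1) ^ 2]. *)
Lemma cos_third_pi : cos (pi / 3) = 1 / 2 :> R.
Proof.
have p2 := @pihalf_lt2 R; have p1 := @pihalf_ge1 R.
have e : cos ((pi / 3) *+ 3) = -1 :> R by rewrite -mulr_natr divfK ?cospi.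
have := e; rewrite mulrS cosD cos_mulr2n sin_mulr2n.
have := cos2Dsin2 (pi / 3 : R).
have : 0 < cos (pi / 3 : R) by apply: cos_gt0_pihalf; apply/andP; split; lra.
move: (cos _) (sin _) => c s c0 cs h.
have s2 : s ^+ 2 = 1 - c ^+ 2 by lra.
have {}h : (c + 1) * (2 * c - 1) ^+ 2 = 0.
  have -> : (c + 1) * (2 * c - 1) ^+ 2 = 4 * c ^+ 3 - 3 * c + 1 by ring.
  have -> : 4 * c ^+ 3 - 3 * c = c * (c ^+ 2 *+ 2 - 1) - s * ((c * s) *+ 2).
    have -> : s * ((c * s) *+ 2) = 2 * c * s ^+ 2 by ring.
    by rewrite s2; ring.
  by rewrite h addNr.
have c1 : c + 1 != 0 by rewrite gt_eqF//; lra.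
move/eqP: h; rewrite mulf_eq0 (negPf c1) /= sqrf_eq0 subr_eq0 => /eqP h; lra.
Qed.

(** Chords are comparable to arcs: below the angle [pi / 3] by the sine, beyond
    it because the real part is at most [1 / 2]. *)
Lemma cis_chord_lower (t : R) : 0 <= t <= pi -> t <= 8 * normc (cis t - 1).
Proof.
move=> /andP[t0 tpi].
have p2 := @pihalf_lt2 R; have p1 := @pihalf_ge1 R.
have hre : 1 - cos t <= normc (cis t - 1).
  apply: le_trans (normc_Re _); rewrite /cis /=.
  by rewrite distrC ler_norm.
have him : sin t <= normc (cis t - 1).
  by apply: le_trans (normc_Im _); rewrite /cis /= oppr0 addr0 ler_norm.
have c3 := cos_third_pi.
have [t1|t1] := leP t (pi / 3); last first.
  have : cos t < cos (pi / 3).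
    by rewrite ltr_cos ?in_itv//=; apply/andP; split; lra.
  rewrite c3; lra.
move: (normc _) hre him => n hre him.
have [c] := MVT_segment t0 (fun x _ => @is_derive_sin R x)
  (continuous_subspaceT (@continuous_sin R)).
rewrite in_itv/= => /andP[c0 ct]; rewrite sin0 !subr0 => e.
have cc : 1 / 2 <= cos c.
  rewrite -c3; have : c <= pi / 3 by exact: le_trans ct t1.
  rewrite le_eqVlt => /predU1P[->//|h].
  by rewrite ltW// ltr_cos ?in_itv//=; apply/andP; split; lra.
rewrite e in him; have : t * (1 / 2) <= cos c * t by rewrite mulrC ler_wpM2r.
lra.
Qed.

Lemma cis_eq1 (t : R) : 0 < t < pi *+ 2 -> cis t != 1.
Proof.
move=> /andP[t0 t2]; apply/eqP => e.
have p1 := @pihalf_ge1 R.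
have [tp|tp] := leP t pi.
  have := cis_chord_lower (t := t); rewrite (ltW t0) tp e subrr normc0 mulr0.
  by move=> /(_ isT); rewrite leNgt t0.
have u0 : 0 <= pi *+ 2 - t <= pi by rewrite mulr2n in t2 *; apply/andP; split; lra.
have := cis_chord_lower u0; rewrite cis_2pi_sub.
have -> : cis (- t) = (cis t)^-1.
  have tt : cis t * cis (- t) = 1 by rewrite -cisD subrr /cis cos0 sin0.
  by rewrite e mul1r in tt; rewrite e invr1.
by rewrite e invr1 subrr normc0 mulr0 leNgt subr_gt0 t2.
Qed.

Lemma circle_angle (u : C) : normc u = 1 -> exists2 t : R, 0 <= t < pi *+ 2 & u = cis t.
Proof.
case: u => p q u1; have pq : p ^+ 2 + q ^+ 2 = 1.
  by have := normc_sqr (p +i* q)%C; rewrite u1 expr1n /= => <-.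
have p1 := @pihalf_ge1 R.
have pI : -1 <= p <= 1.
  rewrite -ler_norml -(@ler_pXn2r _ 2)// ?nnegrE// real_normK ?num_real//.
  by rewrite expr1n; have := sqr_ge0 q; lra.
have ca : cos (acos p) = p by rewrite acosK// in_itv.
have sa : sin (acos p) = `|q|.
  rewrite sin_acos//; have -> : 1 - p ^+ 2 = q ^+ 2 by lra.
  exact: sqrtr_sqr.
have a0 := acos_ge0 pI; have api := acos_lepi pI.
have [q0|q0] := leP 0 q.
  exists (acos p); first by rewrite mulr2n; apply/andP; split; lra.
  by rewrite /cis ca sa ger0_norm.
exists (pi *+ 2 - acos p).
  have : 0 < acos p.
    rewrite lt_def a0 andbT; apply/eqP => e; move: sa; rewrite e sin0 => /esym/eqP.
    by rewrite normr_eq0 (lt_eqF q0).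
  by rewrite mulr2n => ap; apply/andP; split; lra.
by rewrite cis_2pi_sub /cis cosN sinN ca sa (ltr0_norm q0) opprK.
Qed.

End Angles.

Section RootsOfUnity.
Variable R : realType.
Local Notation C := R[i].
Variable N : nat.
Hypothesis N_gt0 : (0 < N)%N.

Definition unity_root (l : nat) : C := cis (pi *+ 2 / N%:R) ^+ l.

Let N0 : (0 : R) < N%:R. Proof. by rewrite ltr0n. Qed.

Lemma normc_unity_root l : normc (unity_root l) = 1.
Proof. by rewrite normcX normc_cis expr1n. Qed.

Lemma unity_root_angle l : unity_root l = cis (pi *+ 2 * l%:R / N%:R).
Proof. by rewrite /unity_root -cisX; congr cis; rewrite -[LHS]mulr_natr mulrAC. Qed.

Lemma unity_rootN l : unity_root l ^+ N = 1.
Proof.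
rewrite /unity_root exprAC -cisX.
have -> : pi *+ 2 / N%:R *+ N = pi *+ 2 :> R by rewrite -[LHS]mulr_natr divfK ?gt_eqF.
by rewrite cis_2pi expr1n.
Qed.

Lemma unity_root_sum k : (0 < k < N)%N -> \sum_(l < N) unity_root l ^+ k = 0.
Proof.
move=> /andP[k0 kN]; pose w : C := unity_root 1 ^+ k.
have w1 : w != 1.
  rewrite /w -exprM mul1n -/(unity_root k) unity_root_angle cis_eq1//.
  have pp : 0 < pi *+ 2 :> R by rewrite mulrn_wgt0 ?pi_gt0.
  apply/andP; split; first by rewrite divr_gt0// mulr_gt0// ltr0n.
  by rewrite ltr_pdivrMr// ltr_pM2l// ltr_nat.
have e : \sum_(l < N) unity_root l ^+ k = \sum_(l < N) w ^+ l.
  by apply: eq_bigr => l _; rewrite /w /unity_root expr1 exprAC.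
apply/eqP; rewrite e; have := subrX1 w N.
rewrite /w exprAC unity_rootN expr1n subrr => /esym/eqP.
by rewrite mulf_eq0 subr_eq0 (negPf w1).
Qed.

(** Each term is the geometric sum of the powers of [unity_root l * v] below [N],
    divided by [1 - v ^ N]; the sum over [l] annihilates all powers but the zeroth. *)
Lemma unity_resolvent_sum (v : C) : normc v < 1 ->
  \sum_(l < N) (1 - unity_root l * v)^-1 = N%:R / (1 - v ^+ N).
Proof.
move=> v1.
have vN : 1 - v ^+ N != 0.
  rewrite subr_eq0 eq_sym; apply/eqP => e.
  have := congr1 (@normc R) e; rewrite normcX normc1 => /eqP.
  by rewrite lt_eqF// exprn_ilt1 ?normc_ge0// -lt0n.
have lv l : 1 - unity_root l * v != 0.
  rewrite subr_eq0 eq_sym; apply/eqP => e.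
  have := congr1 (@normc R) e; rewrite normcM normc_unity_root mul1r normc1 => h.
  by rewrite h ltxx in v1.
have e (l : nat) : (1 - unity_root l * v)^-1 =
    (\sum_(k < N) unity_root l ^+ k * v ^+ k) / (1 - v ^+ N).
  apply: (mulfI (lv l)); rewrite mulfV// mulrA.
  have -> : (1 - unity_root l * v) * (\sum_(k < N) unity_root l ^+ k * v ^+ k) =
     1 - (unity_root l * v) ^+ N.
    have h := subrX1 (unity_root l * v) N.
    apply: oppr_inj; rewrite [RHS]opprB h -[LHS]mulNr opprB; congr (_ * _).
    by apply: eq_bigr => k _; rewrite exprMn.
  by rewrite exprMn unity_rootN mul1r divff.
rewrite (eq_bigr _ (fun (l : 'I_N) _ => e l)) -mulr_suml; congr (_ / _).
rewrite exchange_big/=.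
have z0 : (0 < N)%N := N_gt0.
rewrite (bigD1 (Ordinal z0))//= [X in _ + X]big1 ?addr0; last first.
  move=> k; rewrite -(inj_eq val_inj)/= => k0.
  by rewrite -mulr_suml unity_root_sum ?mul0r// lt0n k0 ltn_ord.
rewrite (eq_bigr (fun=> 1)); last by move=> l _; rewrite !expr0 mulr1.
by rewrite sumr_const card_ord.
Qed.

(** The Poisson kernel as a real part, which makes it additive. *)
Lemma Re_resolvent (w : C) : w != 1 ->
  (1 - normc w ^+ 2) / normc (1 - w) ^+ 2 = 2 * complex.Re (1 - w)^-1 - 1.
Proof.
move=> w1; have d : 0 < normc (1 - w) ^+ 2.
  by rewrite exprn_gt0// normc_gt0 subr_eq0 eq_sym.
move: d; rewrite !normc_sqr; case: w w1 => p q _ /= d.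
field; rewrite gt_eqF//; move: d; congr (_ < _); ring.
Qed.

(** Summing the Poisson kernel over the rotations by the [N]-th roots of unity
    gives [N] times the Poisson kernel at the [N]-th power, which is bounded as
    soon as [|v| ^+ N <= 1 / 2]. *)
Lemma poisson_sum_unity (v : C) (y : R) : 0 < y -> normc v <= 1 - y -> 1 <= y * N%:R ->
  \sum_(l < N) (1 - normc v ^+ 2) / normc (1 - unity_root l * v) ^+ 2 <= 4 * N%:R.
Proof.
move=> y0 vy yN; have v0 := normc_ge0 v; have v1 : normc v < 1 by lra.
have vN : normc v ^+ N <= 1 / 2.
  apply: (@le_trans _ _ ((1 + y * N%:R)^-1)); last first.
    rewrite -[1 / 2]invrK invf_div divr1 lef_pV2 ?posrE//; lra.
  apply: (@le_trans _ _ ((1 + y) ^- N)).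
    rewrite -exprVn ler_pXn2r ?nnegrE ?invr_ge0 ?addr_ge0 ?(ltW y0)//.
    by rewrite -div1r ler_pdivlMr; [nra|lra].
  rewrite lef_pV2 ?posrE ?exprn_gt0//; [|lra|lra].
  elim: (N) => [|n ih]; first by rewrite mulr0 addr0 expr0.
  rewrite exprS -natr1 mulrDr mulr1.
  apply: (@le_trans _ _ ((1 + y) * (1 + y * n%:R))); last by rewrite ler_wpM2l//; lra.
  have : 0 <= y * (y * n%:R) by rewrite !mulr_ge0// ltW.
  lra.
have lv l : unity_root l * v != 1.
  apply/eqP => e; have := congr1 (@normc R) e.
  by rewrite normcM normc_unity_root mul1r normc1 => h; rewrite h ltxx in v1.
have term (l : nat) : (1 - normc v ^+ 2) / normc (1 - unity_root l * v) ^+ 2 =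
    2 * complex.Re (1 - unity_root l * v)^-1 - 1.
  by rewrite -Re_resolvent// normcM normc_unity_root mul1r.
rewrite (eq_bigr _ (fun (l : 'I_N) _ => term l)) big_split/= -mulr_sumr.
have Re_sum' : \sum_(l < N) complex.Re (1 - unity_root l * v)^-1 =
    complex.Re (\sum_(l < N) (1 - unity_root l * v)^-1).
  apply: (big_ind2 (fun x z => x = complex.Re z)) => // p [p1 p2] q [q1 q2] -> ->.
  by [].
rewrite Re_sum' unity_resolvent_sum// sumr_const card_ord.
have e : complex.Re (N%:R / (1 - v ^+ N)) <= 2 * N%:R.
  apply: le_trans (ler_norm _) _; apply: le_trans (normc_Re _) _.
  rewrite normc_div normc_natr ler_pdivrMr.
    have : 1 / 2 <= normc (1 - v ^+ N).
      by have := normc_lower 1 (v ^+ N); rewrite normc1 normcX; lra.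
    by move=> h; have := ler_wpM2l (ltW N0) h; lra.
  have := normc_lower 1 (v ^+ N); rewrite normc1 normcX; lra.
have : (- 1) *+ N <= 0 :> R by rewrite mulrn_wle0.
lra.
Qed.

End RootsOfUnity.

Section Lattice.
Variable R : realType.
Local Notation C := R[i].
Variables (N : nat) (y : R).
Hypotheses (y_gt0 : 0 < y) (y_le1 : y <= 1) (yN : 1 <= y * N%:R).

Definition lattice_point (l : nat) : C := (1 - y)%:C%C * unity_root R N l.

Lemma lattice_N_gt0 : (0 < N)%N.
Proof. by case: N yN => // ; rewrite mulr0 ler10. Qed.

Lemma normc_lattice_point l : normc (lattice_point l) = 1 - y.
Proof.
by rewrite normcM normc_unity_root mulr1 normc_real ger0_norm// subr_ge0.
Qed.

(** For a point of height [h] this bounds the sum of [1 - rho ^ 2] over one circle of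
    the lattice by a multiple of [h N]. *)
Lemma lattice_kernel_sum (w : C) : normc w <= 1 ->
  \sum_(l < N) y / normc (1 - ((lattice_point l)^*)%C * w) ^+ 2 <= 4 * N%:R.
Proof.
move=> w1; pose v : C := (1 - y)%:C%C * (w^*)%C.
have nv : normc v = (1 - y) * normc w.
  by rewrite normcM normc_conj normc_real ger0_norm// subr_ge0.
have vy : normc v <= 1 - y by rewrite nv ler_piMr// subr_ge0.
apply: le_trans (poisson_sum_unity lattice_N_gt0 y_gt0 vy yN).
apply: ler_sum => l _.
have -> : normc (1 - ((lattice_point l)^*)%C * w) = normc (1 - unity_root R N l * v).
  rewrite -normc_conj rmorphB rmorph1 rmorphM /= conjcK.
  by rewrite /lattice_point /v; congr (normc (1 - _)); ring.
rewrite ler_wpM2r ?invr_ge0 ?sqr_ge0//.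
have v0 := normc_ge0 v.
have : normc v ^+ 2 <= normc v * (1 - y) by rewrite expr2 ler_wpM2l.
have : 0 <= y * (1 - y) by rewrite mulr_ge0 ?subr_ge0// ltW.
have : normc v * (1 - y) <= (1 - y) * (1 - y) by rewrite ler_wpM2r ?subr_ge0.
have := y_gt0; lra.
Qed.

(** The points of a circle of radius [1 - y] within [d] of a boundary point are
    counted by the kernel at the interior point at distance [d] below it. *)
Lemma lattice_count (x : C) (d : R) : normc x = 1 -> 0 < d ->
  \sum_(l < N | normc (lattice_point l - x) < d) 1 <= 16 * N%:R * d.
Proof.
move=> x1 d0; have N0 : (0 : R) < N%:R by rewrite ltr0n lattice_N_gt0.
have y0 := y_gt0; have y1 := y_le1.
have [d1|d1] := leP 1 d.
  apply: (@le_trans _ _ (\sum_(l < N) 1)).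
    by rewrite big_mkcond/=; apply: ler_sum => l _; case: ifP.
  rewrite sumr_const card_ord -[leLHS]mulr1.
  have : N%:R * 1 <= N%:R * d :> R by rewrite ler_wpM2l// ltW.
  lra.
pose v : C := (1 - y)%:C%C * (1 - d)%:C%C * (x^*)%C.
have xx : x * (x^*)%C = 1.
  have := normc_sqr x; rewrite x1; case: (x) => p q /= h; simpc.
  by congr (_ +i* _)%C; [rewrite -!expr2 -h expr1n|ring].
have nv : normc v = (1 - y) * (1 - d).
  rewrite !normcM normc_conj x1 mulr1 !normc_real !ger0_norm// subr_ge0//.
  exact: ltW.
have vy : normc v <= 1 - y by rewrite nv ler_piMr ?subr_ge0//; lra.
have dv : d <= 1 - normc v ^+ 2.
  have v0 := normc_ge0 v.
  have : normc v <= 1 - d by rewrite nv ler_piMl ?subr_ge0 ?(ltW d1)//; lra.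
  by move: (normc v) v0 => u u0 ud; nra.
have := poisson_sum_unity lattice_N_gt0 y_gt0 vy yN.
rewrite -(ler_pM2l (_ : 0 < 4 * d)); last by rewrite mulr_gt0.
move=> h; apply: (@le_trans _ _ (4 * d * (4 * N%:R))); last by lra.
apply: le_trans h; rewrite mulr_sumr big_mkcond/=; apply: ler_sum => l _.
have lx : normc (1 - unity_root R N l * v) = normc (x - (1 - d)%:C%C * lattice_point l).
  have -> : normc (1 - unity_root R N l * v) = normc (x * (1 - unity_root R N l * v)).
    by rewrite normcM x1 mul1r.
  congr normc.
  rewrite mulrBr mulr1 /v /lattice_point; congr (_ - _).
  rewrite -[RHS]mulr1 -xx; ring.
rewrite lx; case: ifP => [ld|_]; last first.
  apply: mulr_ge0; first by rewrite mulr_ge0// ltW.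
  apply: divr_ge0; last exact: sqr_ge0.
  by apply: le_trans dv; exact: ltW.
have dpos : 0 < normc (x - (1 - d)%:C%C * lattice_point l).
  apply: lt_le_trans (circle_sub_lower _ x1).
  rewrite normcM normc_lattice_point normc_real ger0_norm ?subr_ge0 ?(ltW d1)//.
  have : (1 - d) * (1 - y) <= 1 - d by rewrite ler_piMr ?subr_ge0 ?(ltW d1)//; lra.
  lra.
rewrite mulrA ler_pdivlMr ?exprn_gt0// mul1r.
apply: (@le_trans _ _ ((2 * d) ^+ 2)).
  rewrite ler_pXn2r ?nnegrE ?normc_ge0 ?mulr_ge0 ?(ltW d0)//.
  have := normc_dist_triangle (lattice_point l) x ((1 - d)%:C%C * lattice_point l).
  have -> : lattice_point l - (1 - d)%:C%C * lattice_point l = d%:C%C * lattice_point l.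
    rewrite rmorphB rmorph1; ring.
  rewrite normcM normc_real ger0_norm ?(ltW d0)// normc_lattice_point.
  rewrite (normc_distC x (lattice_point l)).
  have : d * (1 - y) <= d by rewrite ler_piMr ?(ltW d0)//; lra.
  lra.
by rewrite expr2; have := ler_wpM2l (ltW d0) dv; lra.
Qed.

(** The radial and the angular distances are bounded separately, the latter by
    rounding the angle of [z] down. *)
Lemma lattice_dense (z : C) : 0 < normc z ->
  exists2 l, (l < N)%N & normc (z - lattice_point l) <=
    `|y - (1 - normc z)| + 64 / N%:R.
Proof.
move=> z0; have N0 : (0 : R) < N%:R by rewrite ltr0n lattice_N_gt0.
have u1 : normc (z / (normc z)%:C%C) = 1.
  by rewrite normc_div normc_real ger0_norm ?(ltW z0)// divff ?gt_eqF.
have [t /andP[t0 t2] ut] := circle_angle u1.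
have pp : 0 < pi *+ 2 :> R by rewrite mulrn_wgt0 ?pi_gt0.
pose r := t * N%:R / (pi *+ 2).
have r0 : 0 <= r by rewrite divr_ge0 ?mulr_ge0// ltW.
have rN : r < N%:R by rewrite ltr_pdivrMr// mulrC ltr_pM2l.
pose l := Num.truncn r.
have /andP[l1 l2] : l%:R <= r < l.+1%:R by rewrite truncn_itv.
exists l; first by rewrite -(ltr_nat R); exact: le_lt_trans rN.
have zE : z = (normc z)%:C%C * cis t.
  rewrite -ut mulrC divfK//; apply/eqP => h.
  by have := normc_real (normc z); rewrite h normc0 ger0_norm ?(ltW z0)// => e; rewrite -e ltxx in z0.
have -> : z - lattice_point l = (normc z - (1 - y))%:C%C * cis t +
    (1 - y)%:C%C * (cis t - unity_root R N l).
  rewrite {1}zE /lattice_point rmorphB; ring.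
apply: le_trans (normc_triangle _ _) _; rewrite !normcM normc_cis mulr1 !normc_real.
rewrite lerD//.
  by rewrite distrC; have -> : 1 - y - normc z = - (y - (1 - normc z)); [ring|rewrite normrN].
apply: (@le_trans _ _ (normc (cis t - unity_root R N l))).
  rewrite ler_piMl ?normc_ge0// ger0_norm ?subr_ge0//; have := y_gt0; lra.
rewrite unity_root_angle; apply: le_trans (cis_dist_le _ _) _.
have -> : t - pi *+ 2 * l%:R / N%:R = (r - l%:R) * (pi *+ 2 / N%:R).
  have gen (p : R) : 0 < p -> t - p * l%:R / N%:R = (t * N%:R / p - l%:R) * (p / N%:R).
    by move=> p0; field; rewrite !gt_eqF.
  exact: gen.
rewrite normrM [X in _ * (_ * X)]ger0_norm; last by rewrite divr_ge0// ltW.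
have rl : `|r - l%:R| <= 1.
  rewrite ger0_norm ?subr_ge0//; move: l2; rewrite -natr1 => l2; lra.
have p8 : pi *+ 2 <= 8 :> R.
  by have := @pihalf_lt2 R; rewrite (mulr2n pi) => h; lra.
apply: (@le_trans _ _ (4 * (1 * (8 / N%:R)))).
  by rewrite ler_wpM2l// ler_pM// ?divr_ge0 ?(ltW pp)// ler_wpM2r ?invr_ge0 ?(ltW N0).
rewrite mul1r mulrA ler_wpM2r ?invr_ge0 ?(ltW N0)//; lra.
Qed.

End Lattice.

(** * Boundary points that avoid the atoms *)

Section AlmostEvery.
Variable R : realType.
Local Notation C := R[i].

(** The set of the [t] within [e * r s] of some [c s] has measure at most
    [2 e \sum r]; the exceptional set is contained in it for every [e > 0]. *)
Lemma ae_avoid (c r : nat -> R) : (forall s, 0 <= r s) -> summable_seq r ->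
  {ae @lebesgue_measure R, forall t : R,
    exists2 e, 0 < e & forall s, e * r s <= `|t - c s|}.
Proof.
move=> r0 [M rM].
pose I j s : set R := `[c s - j.+1%:R^-1 * r s, c s + j.+1%:R^-1 * r s]%classic.
pose E j := \bigcup_s I j s.
have mI j s : measurable (I j s) by exact: measurable_itv.
have mE j : measurable (E j) by exact: bigcupT_measurable.
have iv (j : nat) : (0 : R) < j.+1%:R^-1 by rewrite invr_gt0.
have muI j s : (lebesgue_measure (I j s) <= (2 * j.+1%:R^-1 * r s)%:E)%E.
  have e0 : 0 <= 2 * j.+1%:R^-1 * r s by rewrite !mulr_ge0 ?(ltW (iv j)).
  rewrite lebesgue_measure_itv; case: ifPn => _; last by rewrite lee_fin.
  rewrite /= -EFinB lee_fin; move: (_^-1) => v; rewrite le_eqVlt; apply/orP; left.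
  by apply/eqP; ring.
have muE j : (lebesgue_measure (E j) <= (2 * j.+1%:R^-1 * M)%:E)%E.
  apply: (@le_trans _ _ (\sum_(0 <= s <oo) lebesgue_measure (I j s))%E).
    have H := @measure_sigma_subadditive _ _ _ (@lebesgue_measure R) (E j) (I j) (mI j) (mE j).
    exact: H (@subset_refl _ (E j)).
  apply: lime_le; first exact: is_cvg_nneseries.
  apply: nearW => n; apply: (@le_trans _ _ (\sum_(0 <= s < n) (2 * j.+1%:R^-1 * r s)%:E)%E).
    by apply: lee_sum => s _; exact: muI.
  by rewrite sumEFin lee_fin -mulr_sumr ler_wpM2l// mulr_ge0// ltW.
have M0 : 0 <= M by apply: le_trans (rM 0%N); rewrite big_geq.
exists (\bigcap_j E j); split.
- exact: bigcapT_measurable.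
- apply/eqP; rewrite -measure_le0; apply/lee_addgt0Pr => e e0; rewrite add0e.
  pose j := Num.bound (2 * M / e).
  apply: (@le_trans _ _ (lebesgue_measure (E j))).
    apply: le_measure; rewrite ?inE; [exact: bigcapT_measurable|exact: mE|].
    exact: bigcap_inf.
  apply: (le_trans (muE j)); rewrite lee_fin mulrAC ler_pdivrMr//.
  have X0 : 0 <= 2 * M / e by rewrite divr_ge0 ?mulr_ge0// ltW.
  have := archi_boundP X0; rewrite ltr_pdivrMr// => h.
  apply: (le_trans (ltW h)); rewrite mulrC ler_wpM2l ?(ltW e0)// ler_nat.
  exact: leqnSn.
- move=> t /= nt j _; apply: contrapT => nE; apply: nt.
  exists j.+1%:R^-1; first exact: iv.
  move=> s; rewrite leNgt; apply/negP => h; apply: nE; exists s => //.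
  by rewrite /I /= in_itv/= -ler_distl ltW.
Qed.

(** Angles in a fundamental interval are compared up to one turn in either
    direction. *)
Lemma cis_near (t u : R) (d : R) : 0 <= t < pi *+ 2 -> 0 <= u < pi *+ 2 ->
  normc (cis t - cis u) < d ->
  [\/ `|t - u| < 8 * d, `|t - (u + pi *+ 2)| < 8 * d | `|t - (u - pi *+ 2)| < 8 * d].
Proof.
move=> /andP[t0 t2] /andP[u0 u2] tu.
have sym (v : R) : normc (cis (- v) - 1) = normc (cis v - 1).
  have -> : cis (- v) - 1 = - (cis (- v) * (cis v - 1)).
    by rewrite mulrBr -cisD addNr mulr1 /cis cos0 sin0 opprB.
  by rewrite normc_opp normcM normc_cis mul1r.
have tu1 : normc (cis (t - u) - 1) < d.
  have e : cis t - cis u = cis u * (cis (t - u) - 1).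
    by rewrite mulrBr -cisD mulr1 (addrC u) subrK.
  by rewrite e normcM normc_cis mul1r in tu.
have key (v : R) : - pi <= v <= pi -> normc (cis v - 1) < d -> `|v| < 8 * d.
  move=> /andP[v1 v2] h; have [v0|v0] := leP 0 v.
    have := cis_chord_lower (t := v); rewrite v0 v2 => /(_ isT) h1.
    by rewrite ger0_norm//; lra.
  have := cis_chord_lower (t := - v); rewrite oppr_ge0 (ltW v0) lerNl v1 => /(_ isT).
  by rewrite sym => h1; rewrite ltr0_norm//; lra.
have [h1|h1] := leP (t - u) pi; last first.
  constructor 2; have -> : t - (u + pi *+ 2) = (t - u) - pi *+ 2 by ring.
  apply: key; last by rewrite cis_periodic.
  by move: t2 h1 u0; rewrite (mulr2n pi) => *; apply/andP; split; lra.
have [h2|h2] := leP (- pi) (t - u); first by constructor 1; apply: key => //; rewrite h2.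
constructor 3; have -> : t - (u - pi *+ 2) = (t - u) + pi *+ 2 by ring.
apply: key; last by rewrite cisD cis_2pi mulr1.
by move: t0 h2 u2; rewrite (mulr2n pi) => *; apply/andP; split; lra.
Qed.

Lemma ae_circle_avoid (x : nat -> C) (r : nat -> R) : (forall s, normc (x s) = 1) ->
  (forall s, 0 <= r s) -> summable_seq r ->
  {ae @lebesgue_measure R, forall t : R, 0 <= t < 2 * pi ->
    exists2 e, 0 < e <= 1 & forall s, e * r s <= normc (cis t - x s)}.
Proof.
move=> x1 r0 rM.
have angle s : exists v, 0 <= v < pi *+ 2 /\ x s = cis v.
  by have [v v1 v2] := circle_angle (x1 s); exists v.
have [u Hu] := choice angle.
have A0 := ae_avoid u r0 rM.
have A1 := ae_avoid (fun s => u s + pi *+ 2) r0 rM.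
have A2 := ae_avoid (fun s => u s - pi *+ 2) r0 rM.
move: A0 A1 A2; apply: (@filterS3 _ _ (ae_filter_ringOfSetsType _)).
move=> t [e0 e00 h0] [e1 e10 h1] [e2 e20 h2] tI.
have {}tI : 0 <= t < pi *+ 2 by rewrite -mulr_natl.
pose e := Num.min 1 (Num.min e0 (Num.min e1 e2)).
have e_gt0 : 0 < e by rewrite !lt_min ltr01 e00 e10 e20.
exists (e / 8).
  have : e <= 1 by rewrite /e ge_min lexx.
  by move=> e1'; apply/andP; split; lra.
move=> s; rewrite leNgt; apply/negP => h.
have [us xs] := Hu s; rewrite xs in h.
have le_e (d : R) : e <= d -> e * r s <= d * r s by move=> ed; rewrite ler_wpM2r.
have ee : 8 * (e / 8 * r s) = e * r s by field.
case: (cis_near tI us h); rewrite ee ltNge => /negP; apply.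
- by apply: le_trans (h0 s); apply: le_e; rewrite /e !ge_min lexx ?orbT.
- by apply: le_trans (h1 s); apply: le_e; rewrite /e !ge_min lexx ?orbT.
- by apply: le_trans (h2 s); apply: le_e; rewrite /e !ge_min lexx ?orbT.
Qed.

End AlmostEvery.

(** * Sums over the lattice points with large Poisson sum *)

Section GeometricSums.
Variable R : realType.

Lemma geometric_sum_le (Q c : R) I : 0 < Q < 1 -> 0 < c ->
  \sum_(0 <= i < I | Q ^+ i < c) Q ^+ i <= c / (1 - Q).
Proof.
move=> /andP[Q0 Q1] c0; have q0 : 0 < 1 - Q by rewrite subr_gt0.
have tele j : (1 - Q) * (\sum_(j <= i < I) Q ^+ i) <= Q ^+ j.
  elim: I => [|I ih]; first by rewrite big_geq// mulr0 exprn_ge0// ltW.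
  have [jI|Ij] := leqP j I; last by rewrite big_geq// mulr0 exprn_ge0// ltW.
  suff -> : (1 - Q) * (\sum_(j <= i < I.+1) Q ^+ i) = Q ^+ j - Q ^+ I.+1.
    by rewrite gerBl exprn_ge0// ltW.
  elim: I jI {ih} => [|I ih]; first by rewrite leqn0 => /eqP->; rewrite big_nat1 expr0 expr1 mulr1.
  rewrite leq_eqVlt => /predU1P[->|jI].
    by rewrite big_nat1 [Q ^+ I.+2]exprS; ring.
  rewrite big_nat_recr; last exact: ltnW.
  rewrite /= mulrDr (ih jI) [Q ^+ I.+2]exprS; move: (Q ^+ I.+1) (Q ^+ j) => q p; ring.
have [[j0 Qj0]|no] := pselect (exists j, Q ^+ j < c); last first.
  rewrite big_pred0; first by rewrite divr_ge0// ltW.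
  by move=> i; apply/negbTE/negP => h; apply: no; exists i.
case: (ex_minnP (ex_intro (fun j => Q ^+ j < c) j0 Qj0)) => j Qj jmin.
apply: (@le_trans _ _ (\sum_(j <= i < I) Q ^+ i)); last first.
  rewrite ler_pdivlMr// mulrC; apply: (le_trans (tele j)); exact: ltW.
have pos i : 0 <= Q ^+ i by rewrite exprn_ge0// ltW.
have [Ij|jI] := leqP I j.
  rewrite [leRHS]big_geq// big_nat_cond big_pred0// => i.
  apply/negbTE; rewrite leq0n/=; apply/negP => /andP[iI /jmin ji].
  by have := leq_ltn_trans ji iI; rewrite ltnNge Ij.
rewrite (@big_cat_nat _ _ _ j)//=; last exact: ltnW.
rewrite big_nat_cond big_pred0 ?add0r; last first.
  move=> i; apply/negbTE; rewrite leq0n/=; apply/negP => /andP[ij /jmin ji].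
  by have := leq_ltn_trans ji ij; rewrite ltnn.
by rewrite big_mkcond/=; apply: ler_sum => i _; case: ifP.
Qed.

(** Up to the factor [1 / (1 - q)] the sum is at most its last term, which is at
    most [1 / c]. *)
Lemma geometric_inv_sum_le (q c : R) I : 0 < q < 1 -> 0 < c ->
  \sum_(0 <= i < I | c < q ^+ i) (q ^+ i)^-1 <= (c * (1 - q))^-1.
Proof.
move=> /andP[q0 q1] c0; have q'0 : 0 < 1 - q by rewrite subr_gt0.
have full n : \sum_(0 <= i < n.+1) (q ^+ i)^-1 <= (q ^+ n * (1 - q))^-1.
  elim: n => [|n ih].
    by rewrite big_nat1 expr0 mul1r lef_pV2 ?posrE//; lra.
  rewrite big_nat_recr//=; apply: (le_trans (lerD ih (lexx _))).
  rewrite le_eqVlt; apply/orP; left; apply/eqP; rewrite exprS; field.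
  by rewrite !gt_eqF// exprn_gt0.
elim: I => [|I ih]; first by rewrite big_geq// invr_ge0 mulr_ge0// ltW.
rewrite big_mkcond/= big_nat_recr//= -big_mkcond/=.
case: ifPn => cI; last by rewrite addr0.
apply: (@le_trans _ _ (\sum_(0 <= i < I.+1) (q ^+ i)^-1)).
  rewrite big_nat_recr//= lerD2r big_mkcond/=; apply: ler_sum => i _.
  by case: ifP => // _; rewrite invr_ge0 exprn_ge0// ltW.
apply: (le_trans (full I)).
by rewrite lef_pV2 ?posrE ?mulr_gt0 ?exprn_gt0// ler_wpM2r ?(ltW q'0)// ltW.
Qed.

End GeometricSums.

Section LatticeSums.
Variable R : realType.
Local Notation C := R[i].
Variables (b : nat -> R) (K : R) (L : nat) (x : nat -> C).
Hypothesis b_gt0 : forall s, 0 < b s.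
Hypothesis b_anti : forall i j, (i <= j)%N -> b j <= b i.
Hypothesis K_ge1 : 1 <= K.
Hypothesis b_tail : forall s n, \sum_(s <= k < n) b k <= K * b s.
Hypothesis L_gt0 : (0 < L)%N.
Let be := beta b.
Hypothesis beta_half : forall s, be (s + L) <= be s / 2.
Hypothesis x_circle : forall s, normc (x s) = 1.

Let be0 s : 0 < be s. Proof. exact: beta_gt0. Qed.

(** The bookkeeping for one circle. Each selected point [l] is charged to an atom [s]
    at distance less than [theta * be s ^+ 5 * Y ^+ 3]; the number of points charged
    to the same atom is at most a multiple of [N] times this distance, and the bound
    on [t l] in terms of [u s] is normalized so that this number disappears. *)
Lemma level_sum (Y n theta : R) (N m : nat) (sel : nat -> bool) (t u : nat -> R) :
  0 < Y <= 1 -> 0 < n -> 1 <= Y ^+ 8 * N%:R -> N%:R * Y ^+ 8 <= 2 * n -> 0 < theta ->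
  (forall s, 0 <= u s) ->
  (forall l, (l < N)%N -> sel l -> exists s, [/\ (s < m)%N, Y < be s,
     normc (lattice_point N (Y ^+ 8) l - x s) < theta * (be s ^+ 5 * Y ^+ 3) &
     32 * n * theta * be s ^+ 5 * t l <= Y ^+ 6 * u s]) ->
  \sum_(l < N | sel l) t l <= \sum_(0 <= s < m | Y < be s) Y * u s.
Proof.
move=> /andP[Y0 Y1] n0 YN NY th0 u0 Hsel.
have y0 : 0 < Y ^+ 8 by rewrite exprn_gt0.
have y1 : Y ^+ 8 <= 1 by rewrite exprn_ile1// ltW.
pose d s := theta * (be s ^+ 5 * Y ^+ 3).
have d0 s : 0 < d s by rewrite !mulr_gt0 ?exprn_gt0.
pose c s := Y ^+ 6 * u s / (32 * n * theta * be s ^+ 5).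
have k0 s : 0 < 32 * n * theta * be s ^+ 5 by rewrite !mulr_gt0 ?exprn_gt0.
have c0 s : 0 <= c s by rewrite divr_ge0 ?(ltW (k0 s))// mulr_ge0// exprn_ge0// ltW.
pose D l s := normc (lattice_point N (Y ^+ 8) l - x s) < d s.
apply: (@le_trans _ _ (\sum_(l < N) \sum_(0 <= s < m | Y < be s) (if D l s then c s else 0))).
  rewrite big_mkcond/=; apply: ler_sum => l _; case: ifPn => [sl|_]; last first.
    by apply: sumr_ge0 => s _; case: ifP.
  have [s [sm Ys Ds ts]] := Hsel l (ltn_ord l) sl.
  apply: (@le_trans _ _ (c s)); first by rewrite ler_pdivlMr// mulrC.
  rewrite big_mkord (bigD1 (Ordinal sm))//= /D Ds lerDl sumr_ge0// => s' _.
  by case: ifP.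
rewrite exchange_big/=; rewrite big_nat_cond [leRHS]big_nat_cond.
apply: ler_sum => s /andP[_ Ys].
have -> : \sum_(l < N) (if D l s then c s else 0) = c s * \sum_(l < N | D l s) 1.
  by rewrite mulr_sumr [RHS]big_mkcond/=; apply: eq_bigr => l _; rewrite mulr1.
apply: (@le_trans _ _ (c s * (16 * N%:R * d s))).
  by rewrite ler_wpM2l//; exact: lattice_count.
rewrite /c /d.
have -> : Y ^+ 6 * u s / (32 * n * theta * be s ^+ 5) *
    (16 * N%:R * (theta * (be s ^+ 5 * Y ^+ 3))) =
    (Y * u s) * (N%:R * Y ^+ 8) / (2 * n).
  by field; rewrite !gt_eqF ?exprn_gt0 ?be0.
by rewrite ler_pdivrMr ?mulr_gt0// ler_wpM2l// mulr_ge0// ltW.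
Qed.

Variables (Q n theta : R) (N : nat -> nat).
Hypotheses (Q_in : 0 < Q < 1) (n_gt0 : 0 < n) (theta_gt0 : 0 < theta).
Let Y i := Q ^+ i.
Hypothesis N_low : forall i, 1 <= Y i ^+ 8 * (N i)%:R.
Hypothesis N_up : forall i, (N i)%:R * Y i ^+ 8 <= 2 * n.

Let Q0 : 0 < Q. Proof. by case/andP: Q_in. Qed.
Let Q1 : Q < 1. Proof. by case/andP: Q_in. Qed.
Let Y0 i : 0 < Y i. Proof. by rewrite exprn_gt0. Qed.
Let Y1 i : Y i <= 1. Proof. by rewrite exprn_ile1 ?ltW. Qed.
Let Y_anti i j : (i <= j)%N -> Y j <= Y i.
Proof. by move=> ij; rewrite ler_wiXn2l ?ltW. Qed.

Definition level_point i l : C := lattice_point (N i) (Y i ^+ 8) l.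

Lemma level_point_gap i l : 1 - normc (level_point i l) = Y i ^+ 8.
Proof. by rewrite /level_point normc_lattice_point ?subKr// exprn_ile1// ltW. Qed.

Lemma level_point_disc i l : normc (level_point i l) < 1.
Proof. by rewrite -subr_gt0 level_point_gap exprn_gt0. Qed.

(** Summing over the circles: an atom is charged only at the levels with
    [Y i < be s], where the factors [Y i] form a geometric series of sum at most
    [be s / (1 - Q)]. *)
Lemma lattice_sum (I m : nat) (sel : nat -> nat -> bool) (t : nat -> nat -> R)
    (u : nat -> R) :
  (forall s, 0 <= u s) ->
  (forall i l, (i < I)%N -> (l < N i)%N -> sel i l -> exists s,
     [/\ (s < m)%N, Y i < be s,
     normc (level_point i l - x s) < theta * (be s ^+ 5 * Y i ^+ 3) &
     32 * n * theta * be s ^+ 5 * t i l <= Y i ^+ 6 * u s]) ->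
  \sum_(0 <= i < I) \sum_(l < N i | sel i l) t i l <=
  (\sum_(0 <= s < m) u s * be s) / (1 - Q).
Proof.
move=> u0 Hsel.
apply: (@le_trans _ _ (\sum_(0 <= i < I) \sum_(0 <= s < m | Y i < be s) Y i * u s)).
  rewrite big_nat_cond [leRHS]big_nat_cond; apply: ler_sum => i /andP[/andP[_ iI] _].
  apply: (@level_sum (Y i) n theta); rewrite ?Y0 ?Y1//.
  by move=> l lN sl; exact: Hsel.
have -> : \sum_(0 <= i < I) \sum_(0 <= s < m | Y i < be s) Y i * u s =
    \sum_(0 <= s < m) u s * \sum_(0 <= i < I | Y i < be s) Y i.
  under eq_bigr => i _ do rewrite big_mkcond.
  rewrite exchange_big/=; apply: eq_bigr => s _.
  rewrite mulr_sumr [RHS]big_mkcond/=; apply: eq_bigr => i _.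
  by case: ifP => _; rewrite // mulrC.
rewrite mulr_suml; apply: ler_sum => s _; rewrite -mulrA ler_wpM2l//.
exact: geometric_sum_le.
Qed.

(** Finitely many atoms can be charged at the levels below a given one, as the
    eighth roots are summable. *)
Lemma beta_eventually_small (c : R) : 0 < c -> exists m, forall s, c < be s -> (s < m)%N.
Proof.
move=> c0; have [W HW] : exists W, forall m, \sum_(0 <= s < m) be s <= W.
  by exists (2 * L%:R * be 0%N) => m; exact: (sum_beta_le b_gt0 b_anti L_gt0 beta_half).
have W0 : 0 <= W by apply: le_trans (HW 0%N); rewrite big_geq.
have X0 : 0 <= W / c by rewrite divr_ge0// ltW.
exists (Num.bound (W / c)) => s cs; rewrite ltnNge; apply/negP => ms.
have : s.+1%:R * c <= W.
  apply: le_trans (HW s.+1).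
  apply: (@le_trans _ _ (\sum_(0 <= k < s.+1) c)).
    by rewrite sumr_const_nat subn0 mulr_natl.
  rewrite big_nat_cond [leRHS]big_nat_cond; apply: ler_sum => k /andP[/andP[_ ks] _].
  by apply: (le_trans (ltW cs)); exact: beta_anti.
rewrite -ler_pdivlMr// leNgt => /negP; apply.
by apply: (lt_le_trans (archi_boundP X0)); rewrite ler_nat ltnW.
Qed.

Hypothesis theta_le : theta <= K^-1.
(* The threshold for which a point with Poisson sum above [tau / 2] lies within
   [theta * be s ^+ 5 * Y i ^+ 3] of a heavy atom. *)
Let tau := 16 * L%:R / theta ^+ 2.

Lemma tau_ge : 8 * K <= tau.
Proof.
have K1 := K_ge1; have L1 : (1 : R) <= L%:R by rewrite ler1n.
rewrite /tau ler_pdivlMr ?exprn_gt0//.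
have th1 : theta <= 1 by rewrite (le_trans theta_le)// invf_le1//; lra.
have Kth : K * theta <= 1 by rewrite mulrC -ler_pdivlMr ?div1r//; lra.
have : K * theta * theta <= 1 * 1 by rewrite ler_pM ?(ltW theta_gt0)// mulr_ge0 ?(ltW theta_gt0)//; lra.
by rewrite expr2; lra.
Qed.

Lemma theta_le1 : theta <= 1.
Proof. by rewrite (le_trans theta_le)// invf_le1//; have K1 := K_ge1; lra. Qed.

(** The terms are nonnegative, so comparing partial sums with the threshold compares
    the Poisson integral with it. *)
Definition high (a : C) := `[< exists p, tau < \sum_(0 <= s < p) b s * poisson a (x s) >].

(** Half of the threshold is enough, which leaves room for discarding a part of the
    atoms. *)
Lemma heavy_atom_level i l (G : pred nat) p :
  tau / 2 < \sum_(0 <= s < p | G s) b s * poisson (level_point i l) (x s) ->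
  exists s, [/\ G s, Y i < be s &
    normc (level_point i l - x s) < theta * (be s ^+ 5 * Y i ^+ 3)].
Proof.
move=> big; have t4 : 4 * K <= tau / 2 by have := tau_ge; lra.
have [s [_ Gs Ys D]] := heavy_atom b_gt0 b_anti L_gt0 beta_half K_ge1 b_tail
  x_circle (Y0 i) (level_point_gap i l) t4 big.
exists s; split => //.
have e : 8 * L%:R / (tau / 2) = theta ^+ 2.
  by rewrite /tau; field; rewrite !gt_eqF ?ltr0n.
rewrite -/be e -exprMn in D.
rewrite -(@ltr_pXn2r _ 2) ?nnegrE ?normc_ge0// mulr_ge0 ?(ltW theta_gt0)//.
by rewrite mulr_ge0// exprn_ge0// ltW.
Qed.

(** An interpolation: depending on whether [Yi ^ 2] or [B H] is larger, one of the
    two hypotheses gives the claim. It provides the power of [Yi] that is needed for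
    the sum over the levels. *)
Lemma kernel_near_lower (M H D B Yi : R) : 1 <= M -> 0 < H -> 0 < B -> 0 < Yi ->
  B ^+ 8 * H ^+ 8 <= 16 * M * D ^+ 2 -> Yi ^+ 16 <= D ^+ 2 ->
  B ^+ 7 * H ^+ 7 * Yi ^+ 2 <= 16 * M * D ^+ 2.
Proof.
move=> M1 H0 B0 Yi0 h1 h2.
have BH0 : 0 < B * H by rewrite mulr_gt0.
have [le|lt] := leP (Yi ^+ 2) (B * H).
  apply: le_trans h1.
  have -> : B ^+ 8 * H ^+ 8 = B ^+ 7 * H ^+ 7 * (B * H) by ring.
  by rewrite ler_wpM2l// mulr_ge0// exprn_ge0// ltW.
apply: (@le_trans _ _ (D ^+ 2)); last by rewrite ler_peMl ?sqr_ge0//; lra.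
apply: le_trans h2.
have -> : Yi ^+ 16 = (Yi ^+ 2) ^+ 7 * Yi ^+ 2 by ring.
rewrite -exprMn ler_wpM2r ?sqr_ge0// ler_pXn2r ?nnegrE ?sqr_ge0 ?(ltW BH0)//.
exact: ltW.
Qed.

Section Interior.
Variables (z : C) (H M : R).
Hypotheses (H_gt0 : 0 < H) (zH : 1 - normc z = H ^+ 8) (M_ge1 : 1 <= M).
Hypothesis zM : forall p, \sum_(0 <= s < p) b s * poisson z (x s) <= M.

Let z1 : normc z < 1. Proof. by rewrite -subr_gt0 zH exprn_gt0. Qed.

(* The modulus of the kernel; it dominates the heights of [z] and of the point, and
   plays the role of the distance between them. *)
Let D i l := normc (1 - ((level_point i l)^*)%C * z).

Let DH i l : H ^+ 8 <= D i l.
Proof. by rewrite -zH; apply: kernel_lower; exact: ltW (level_point_disc i l). Qed.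

Let DY i l : Y i ^+ 8 <= D i l.
Proof. by rewrite /D kernel_sym -(level_point_gap i l); apply: kernel_lower; exact: ltW. Qed.

Let D0 i l : 0 < D i l.
Proof. by apply: lt_le_trans (DH i l); rewrite exprn_gt0. Qed.

Lemma rho_term i l : 1 - rho z (level_point i l) ^+ 2 <= 4 * H ^+ 8 * (Y i ^+ 8 / D i l ^+ 2).
Proof.
rewrite rho_sqr ?level_point_disc// -/(D i l) mulrA.
rewrite ler_wpM2r ?invr_ge0 ?sqr_ge0//.
have g (w : C) (h : R) : normc w < 1 -> 1 - normc w = h ->
    0 <= 1 - normc w ^+ 2 <= 2 * h.
  move=> w1 <-; have w0 := normc_ge0 w; move: (normc w) w0 w1 => v v0 v1.
  by apply/andP; split; nra.
have /andP[a0 a1] := g z _ z1 zH.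
have /andP[b0 b1] := g _ _ (level_point_disc i l) (level_point_gap i l).
apply: (le_trans (ler_pM a0 b0 a1 b1)).
by rewrite le_eqVlt; apply/orP; left; apply/eqP; ring.
Qed.

(* At the other levels, the atoms whose distance to [z] is large compared with the
   kernel contribute at most [tau / 2] to the Poisson sum at the lattice point. *)
Let far i := tau * H ^+ 8 / (8 * M) < Y i ^+ 8.

(** These levels are higher than [z] by a factor of order [tau], and one circle at
    height [y] costs about [n] times the ratio of the heights; so all points of these
    levels can be counted, and the large threshold makes their sum small. *)
Lemma far_levels_sum I :
  \sum_(0 <= i < I | far i) \sum_(l < N i) (1 - rho z (level_point i l) ^+ 2) <=
  n / (1 - Q) * (256 * M / tau).
Proof.
have M1 := M_ge1; have h0 : 0 < H ^+ 8 by rewrite exprn_gt0.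
have tau0 : 0 < tau by rewrite divr_gt0 ?exprn_gt0// mulr_gt0// ltr0n.
have q0 : 0 < 1 - Q by rewrite subr_gt0.
have c0 : 0 < tau * H ^+ 8 / (8 * M).
  by apply: divr_gt0; [exact: mulr_gt0|lra].
have nh0 : 0 <= 32 * n * H ^+ 8.
  by have : 0 < n * H ^+ 8; [exact: mulr_gt0 | lra].
have Q8 : Q ^+ 8 <= Q by rewrite exprS ler_piMr ?(ltW Q0)// exprn_ile1 ?ltW.
have Q80 : 0 < Q ^+ 8 by rewrite exprn_gt0.
apply: (@le_trans _ _ (\sum_(0 <= i < I | far i) 32 * n * H ^+ 8 * ((Q ^+ 8) ^+ i)^-1)).
  apply: ler_sum => i _.
  have yi0 : 0 < Y i ^+ 8 by rewrite exprn_gt0.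
  have -> : (Q ^+ 8) ^+ i = Y i ^+ 8 by rewrite exprAC.
  apply: (@le_trans _ _ (4 * H ^+ 8 * \sum_(l < N i) (Y i ^+ 8 / D i l ^+ 2))).
    by rewrite mulr_sumr; apply: ler_sum => l _; exact: rho_term.
  apply: (@le_trans _ _ (4 * H ^+ 8 * (4 * (N i)%:R))).
    rewrite ler_wpM2l//; first by lra.
    have y1 : Y i ^+ 8 <= 1 by rewrite exprn_ile1// ltW.
    exact: (lattice_kernel_sum yi0 y1 (N_low i) (ltW z1)).
  rewrite ler_pdivlMr//; have := ler_wpM2l (ltW h0) (N_up i); lra.
rewrite -mulr_sumr.
apply: (@le_trans _ _ (32 * n * H ^+ 8 * (tau * H ^+ 8 / (8 * M) * (1 - Q ^+ 8))^-1)).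
  rewrite ler_wpM2l ?nh0//.
  have e i : far i = (tau * H ^+ 8 / (8 * M) < (Q ^+ 8) ^+ i) by rewrite /far exprAC.
  rewrite (eq_bigl _ _ e); apply: geometric_inv_sum_le => //.
  by rewrite Q80 (le_lt_trans Q8).
have -> : n / (1 - Q) * (256 * M / tau) =
    32 * n * H ^+ 8 * (tau * H ^+ 8 / (8 * M) * (1 - Q))^-1.
  by field; rewrite !gt_eqF//; lra.
rewrite ler_wpM2l ?nh0//.
have q80 : 0 < 1 - Q ^+ 8 by lra.
rewrite lef_pV2 ?posrE ?(mulr_gt0 c0 q80) ?(mulr_gt0 c0 q0)//.
by rewrite ler_wpM2l ?(ltW c0)//; lra.
Qed.

(** Atoms with [|x s - z| > 4 D] are seen from [z] almost as from the lattice point,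
    hence contribute at most a multiple of [(Y / H) ^ 8 M], that is at most [tau / 2].
    So one of the other atoms confines the point. As it is close to [z] too, its mass
    is limited by [M]: [be s ^ 8 * H ^ 8] is at most a multiple of [M * D ^ 2]. The
    charges [u s] are then estimated in two cases, according to whether the atom
    is heavier than the height of [z]. *)
Lemma near_levels_sum I :
  \sum_(0 <= i < I | ~~ far i) \sum_(l < N i | high (level_point i l))
    (1 - rho z (level_point i l) ^+ 2) <=
  n / (1 - Q) * (theta * (4096 * M * L%:R + 128 * K)).
Proof.
have M1 := M_ge1; have h0 : 0 < H ^+ 8 by rewrite exprn_gt0.
have tau0 : 0 < tau by rewrite divr_gt0 ?exprn_gt0// mulr_gt0// ltr0n.
have [m Hm] := beta_eventually_small (Y0 I).
pose u s := if H < be s then 2048 * M * n * theta * H / be s ^+ 2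
  else 128 * n * theta * be s ^+ 7 / H ^+ 8.
have nt0 : 0 <= n * theta by rewrite mulr_ge0// ltW.
have u0 s : 0 <= u s.
  have B0 := be0 s; rewrite /u; case: ifP => _; (apply: divr_ge0; last by rewrite exprn_ge0// ltW).
    have : 0 <= n * theta * (M * H) by apply: mulr_ge0 => //; apply: mulr_ge0; [lra|exact: ltW].
    by lra.
  have : 0 <= n * theta * be s ^+ 7 by apply: mulr_ge0 => //; rewrite exprn_ge0// ltW.
  by lra.
have -> : \sum_(0 <= i < I | ~~ far i) \sum_(l < N i | high (level_point i l))
    (1 - rho z (level_point i l) ^+ 2) =
    \sum_(0 <= i < I) \sum_(l < N i | ~~ far i && high (level_point i l))
    (1 - rho z (level_point i l) ^+ 2).
  rewrite big_mkcond/=; apply: eq_bigr => i _; case: ifP => // _.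
  by rewrite big_pred0.
apply: le_trans (@lattice_sum I m (fun i l => ~~ far i && high (level_point i l))
  (fun i l => 1 - rho z (level_point i l) ^+ 2) u u0 _) _.
  move=> i l iI lN /andP[nfar /asboolP[p Hp]].
  have yi0 : 0 < Y i ^+ 8 by rewrite exprn_gt0.
  (* The atoms of [G] are those that are not distant from [z]. *)
  pose G s := normc (x s - z) <= 4 * D i l.
  have farsum : \sum_(0 <= s < p | ~~ G s) b s * poisson (level_point i l) (x s) <= tau / 2.
    apply: (@le_trans _ _ (4 * (Y i ^+ 8 / H ^+ 8) * M)); last first.
      move: nfar; rewrite /far -leNgt ler_pdivlMr; last by lra.
      move=> nfar; rewrite mulrAC mulrA ler_pdivrMr//; lra.
    apply: (@le_trans _ _ (4 * (Y i ^+ 8 / H ^+ 8) * \sum_(0 <= s < p) b s * poisson z (x s))).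
      rewrite mulr_sumr big_mkcond/=; apply: ler_sum => s _.
      have ps0 : 0 <= b s * poisson z (x s) by rewrite mulr_ge0 ?poisson_ge0 ?(ltW (b_gt0 s)).
      have r0 : 0 <= 4 * (Y i ^+ 8 / H ^+ 8) by rewrite mulr_ge0// divr_ge0 ?ltW.
      case: ifPn => [|_]; last exact: mulr_ge0.
      rewrite /G -ltNge => xs.
      rewrite [leRHS]mulrCA ler_wpM2l ?(ltW (b_gt0 s))// /poisson.
      have xz0 : 0 < normc (x s - z) by rewrite circle_sub_gt0.
      have az : normc (level_point i l - z) <= D i l.
        rewrite -(@ler_pXn2r _ 2) ?nnegrE ?normc_ge0// /D kernel_sym normc_kernelE lerDl.
        by rewrite mulr_ge0// subr_ge0 expr_le1 ?normc_ge0// ltW ?level_point_disc.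
      have xa : 3 / 4 * normc (x s - z) <= normc (x s - level_point i l).
        by have := normc_dist_triangle (level_point i l) (x s) z; lra.
      have xa0 : 0 < normc (x s - level_point i l).
        by rewrite circle_sub_gt0 ?level_point_disc.
      have aY : 1 - normc (level_point i l) ^+ 2 <= 2 * Y i ^+ 8.
        have := level_point_gap i l; have := normc_ge0 (level_point i l).
        by move: (normc (level_point i l)) => v v0 <-; have := sqr_ge0 (1 - v); rewrite !expr2; lra.
      have zH2 : H ^+ 8 <= 1 - normc z ^+ 2.
        have := zH; have := normc_ge0 z; move: (normc z) z1 => v v1 v0 <-; nra.
      rewrite ler_pdivrMr ?exprn_gt0//; apply: (le_trans aY).
      have -> : 4 * (Y i ^+ 8 / H ^+ 8) * ((1 - normc z ^+ 2) / normc (x s - z) ^+ 2) *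
         normc (x s - level_point i l) ^+ 2 =
         2 * Y i ^+ 8 * ((1 - normc z ^+ 2) / H ^+ 8 *
           (2 * normc (x s - level_point i l) ^+ 2 / normc (x s - z) ^+ 2)).
        by field; rewrite !gt_eqF.
      rewrite ler_peMr//; first by lra.
      rewrite -[leLHS]mulr1; apply: ler_pM => //; first by rewrite ler_pdivlMr// mul1r.
      rewrite ler_pdivlMr ?exprn_gt0// mul1r.
      have : (3 / 4 * normc (x s - z)) ^+ 2 <= normc (x s - level_point i l) ^+ 2.
        by rewrite ler_pXn2r ?nnegrE ?normc_ge0// mulr_ge0// ltW.
      by rewrite exprMn; have := sqr_ge0 (normc (x s - z)); lra.
    by rewrite ler_wpM2l ?zM// mulr_ge0// divr_ge0 ?ltW.
  have nearsum : tau / 2 < \sum_(0 <= s < p | G s) b s * poisson (level_point i l) (x s).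
    by move: Hp; rewrite (bigID G)/=; lra.
  have [s [Gs Ys Ds]] := heavy_atom_level nearsum.
  exists s; split => //.
    by apply: Hm; apply: le_lt_trans Ys; apply: Y_anti; exact: ltnW.
  have D2 : 0 < D i l ^+ 2 by rewrite exprn_gt0.
  have D16 : Y i ^+ 16 <= D i l ^+ 2.
    have -> : Y i ^+ 16 = (Y i ^+ 8) ^+ 2 by ring.
    by rewrite ler_pXn2r ?nnegrE ?(ltW yi0) ?(ltW (D0 i l)) ?DY.
  have DH2 : H ^+ 16 <= D i l ^+ 2.
    have -> : H ^+ 16 = (H ^+ 8) ^+ 2 by ring.
    by rewrite ler_pXn2r ?nnegrE ?(ltW h0) ?(ltW (D0 i l)).
  have bM : be s ^+ 8 * H ^+ 8 <= 16 * M * D i l ^+ 2.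
    have xz0 : 0 < normc (x s - z) by rewrite circle_sub_gt0.
    have : b s * poisson z (x s) <= M.
      apply: le_trans (zM s.+1); rewrite big_nat_recr//= lerDr sumr_ge0// => k _.
      by rewrite mulr_ge0 ?poisson_ge0 ?(ltW (b_gt0 k)).
    rewrite -(beta8 b_gt0) -/be /poisson mulrA ler_pdivrMr ?exprn_gt0// => h.
    have zH2 : H ^+ 8 <= 1 - normc z ^+ 2.
      have := zH; have := normc_ge0 z; move: (normc z) z1 => v v1 v0 <-; nra.
    apply: (@le_trans _ _ (be s ^+ 8 * (1 - normc z ^+ 2))).
      by rewrite ler_wpM2l// exprn_ge0// ltW.
    apply: (le_trans h).
    have -> : 16 * M * D i l ^+ 2 = M * (4 * D i l) ^+ 2 by ring.
    rewrite ler_wpM2l//; first by lra.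
    by rewrite ler_pXn2r ?nnegrE ?normc_ge0// mulr_ge0// ltW.
  have B0 := be0 s; have Yi := Y0 i.
  have nt5 : 0 <= n * theta * be s ^+ 5 by rewrite mulr_ge0// exprn_ge0// ltW.
  have nth : 0 <= n * theta * H by rewrite mulr_ge0// ltW.
  apply: (@le_trans _ _ (32 * n * theta * be s ^+ 5 * (4 * H ^+ 8 * (Y i ^+ 8 / D i l ^+ 2)))).
    by apply: ler_wpM2l; [lra|exact: rho_term].
  have -> : 32 * n * theta * be s ^+ 5 * (4 * H ^+ 8 * (Y i ^+ 8 / D i l ^+ 2)) =
     Y i ^+ 6 * (128 * n * theta * be s ^+ 5 * H ^+ 8 * Y i ^+ 2 / D i l ^+ 2) by ring.
  rewrite ler_wpM2l ?exprn_ge0 ?(ltW Yi) ?(ltW Q0)// ler_pdivrMr// /u; case: ifPn => [HB|HB].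
    have key := kernel_near_lower M1 H_gt0 B0 Yi bM D16.
    rewrite [leRHS]mulrAC ler_pdivlMr ?exprn_gt0//.
    have -> : 128 * n * theta * be s ^+ 5 * H ^+ 8 * Y i ^+ 2 * be s ^+ 2 =
       128 * n * theta * H * (be s ^+ 7 * H ^+ 7 * Y i ^+ 2) by ring.
    have -> : 2048 * M * n * theta * H * D i l ^+ 2 =
       128 * n * theta * H * (16 * M * D i l ^+ 2) by ring.
    by apply: ler_wpM2l; [lra|].
  rewrite [leRHS]mulrAC ler_pdivlMr//.
  have -> : 128 * n * theta * be s ^+ 5 * H ^+ 8 * Y i ^+ 2 * H ^+ 8 =
     128 * n * theta * be s ^+ 5 * (Y i ^+ 2 * H ^+ 16) by ring.
  have -> : 128 * n * theta * be s ^+ 7 * D i l ^+ 2 =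
     128 * n * theta * be s ^+ 5 * (be s ^+ 2 * D i l ^+ 2) by ring.
  apply: ler_wpM2l; first by lra.
  rewrite ler_pM ?exprn_ge0 ?(ltW Yi) ?(ltW Q0) ?(ltW H_gt0)//.
  by rewrite ler_pXn2r ?nnegrE ?(ltW Yi) ?(ltW Q0) ?(ltW B0)// ltW.
rewrite [leRHS]mulrAC ler_wpM2r ?invr_ge0 ?subr_ge0 ?(ltW Q1)//.
rewrite (bigID (fun s => H < be s))/=.
have h1 : \sum_(0 <= s < m | H < be s) u s * be s <= 2048 * M * n * theta * (2 * L%:R).
  apply: (@le_trans _ _ (\sum_(0 <= s < m | H < be s) 2048 * M * n * theta * (H / be s))).
    apply: ler_sum => s Hs; rewrite /u Hs le_eqVlt; apply/orP; left; apply/eqP.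
    by field; rewrite gt_eqF ?be0.
  rewrite -mulr_sumr; apply: ler_wpM2l; last exact: (sum_ratio_le b_gt0 b_anti L_gt0 beta_half).
  have : 0 <= n * theta * M by apply: mulr_ge0 => //; lra.
  by lra.
have h2 : \sum_(0 <= s < m | ~~ (H < be s)) u s * be s <= 128 * n * theta * K.
  apply: (@le_trans _ _ (\sum_(0 <= s < m | b s <= H ^+ 8) 128 * n * theta / H ^+ 8 * b s)).
    rewrite big_mkcond [leRHS]big_mkcond/=; apply: ler_sum => s _.
    rewrite -(beta8 b_gt0) -/be ler_pXn2r ?nnegrE ?(ltW H_gt0) ?(ltW (be0 s))// -leNgt.
    case: ifPn => // Hs; rewrite /u ltNge Hs /= le_eqVlt; apply/orP; left; apply/eqP.
    by ring.
  rewrite -mulr_sumr; apply: (@le_trans _ _ (128 * n * theta / H ^+ 8 * (K * H ^+ 8))).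
    apply: ler_wpM2l; last exact: (sum_small_le b_gt0 K_ge1 b_tail _ (ltW h0)).
    by apply: divr_ge0; [lra|exact: ltW].
  by rewrite le_eqVlt; apply/orP; left; apply/eqP; field; rewrite gt_eqF.
lra.
Qed.

Lemma interior_sum I :
  \sum_(0 <= i < I) \sum_(l < N i | high (level_point i l))
    (1 - rho z (level_point i l) ^+ 2) <=
  n / (1 - Q) * theta * (4096 * M * L%:R + 128 * K + 256 * M).
Proof.
have M1 := M_ge1.
have tau0 : 0 < tau by rewrite divr_gt0 ?exprn_gt0// mulr_gt0// ltr0n.
have nq0 : 0 <= n / (1 - Q) by rewrite divr_ge0 ?(ltW n_gt0)// subr_ge0 ltW.
rewrite (bigID far)/= addrC.
have h1 := near_levels_sum I.
have h2 : \sum_(0 <= i < I | far i) \sum_(l < N i | high (level_point i l))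
    (1 - rho z (level_point i l) ^+ 2) <= n / (1 - Q) * (theta * (256 * M)).
  apply: (@le_trans _ _ (n / (1 - Q) * (256 * M / tau))).
    apply: le_trans (far_levels_sum I); apply: ler_sum => i _.
    rewrite big_mkcond/=; apply: ler_sum => l _; case: ifP => // _.
    by rewrite subr_ge0 expr_le1 ?rho_ge0 ?rho_le1 ?level_point_disc.
  rewrite ler_wpM2l// mulrC ler_wpM2r//; first by lra.
  rewrite -div1r ler_pdivrMr// /tau mulrA ler_pdivlMr ?exprn_gt0// mul1r expr2 mulrA.
  have L1 : (1 : R) <= L%:R by rewrite ler1n.
  have := theta_le1; have : theta * theta <= theta * 1 by rewrite ler_wpM2l ?(ltW theta_gt0)// theta_le1.
  have : theta * 1 <= theta * L%:R by rewrite ler_wpM2l ?(ltW theta_gt0).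
  have := theta_gt0; lra.
lra.
Qed.

End Interior.

(** Frostman's sums at a boundary point that stays away from the atoms. Either the
    point charged to [x s] is much closer to [x s] than [zeta] is, and the distance
    from [zeta] is at least half of [c * be s]; or the disc at [x s] reaches [zeta],
    and then [c] is bounded by [be s ^ 4 * Y i ^ 3], which compensates for the trivial
    bound one of the quotient. *)
Lemma boundary_sum (zeta : C) (c Bd : R) I : normc zeta = 1 -> 0 < c <= 1 -> 1 <= Bd ->
  (forall s, be s <= Bd) -> (forall s, c * be s <= normc (zeta - x s)) ->
  \sum_(0 <= i < I) \sum_(l < N i | high (level_point i l))
    (1 - normc (level_point i l)) / normc (zeta - level_point i l) <=
  n / (1 - Q) * theta * (256 * L%:R * Bd ^+ 14 / c ^+ 2).
Proof.
move=> ze1 /andP[c0 c1] Bd1 beB far.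
have tau0 : 0 < tau by rewrite divr_gt0 ?exprn_gt0// mulr_gt0// ltr0n.
have [m Hm] := beta_eventually_small (Y0 I).
have Bd0 : 0 < Bd by lra.
pose A := 128 * n * theta * Bd ^+ 12 / c ^+ 2.
have A0 : 0 <= A.
  by rewrite divr_ge0 ?sqr_ge0// !mulr_ge0 ?exprn_ge0 ?(ltW n_gt0) ?(ltW theta_gt0) ?(ltW Bd0).
have u0 s : 0 <= A * be s by rewrite mulr_ge0// ltW.
apply: le_trans (@lattice_sum I m (fun i l => high (level_point i l))
  (fun i l => (1 - normc (level_point i l)) / normc (zeta - level_point i l))
  (fun s => A * be s) u0 _) _.
  move=> i l iI lN /asboolP[p Hp].
  have half : tau / 2 < \sum_(0 <= s < p | predT s) b s * poisson (level_point i l) (x s) by lra.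
  have [s [_ Ys Ds]] := heavy_atom_level half.
  exists s; split => //.
    by apply: Hm; apply: le_lt_trans Ys; apply: Y_anti; exact: ltnW.
  have B0 := be0 s; have Yi := Y0 i; have Yi1 := Y1 i; have BB := beB s.
  have yi0 : 0 < Y i ^+ 8 by rewrite exprn_gt0.
  rewrite level_point_gap.
  have za : Y i ^+ 8 <= normc (zeta - level_point i l).
    by rewrite -(level_point_gap i l); exact: circle_sub_lower.
  have za0 := lt_le_trans yi0 za.
  have nt : 0 <= 32 * n * theta * be s ^+ 5.
    by rewrite !mulr_ge0 ?exprn_ge0 ?(ltW n_gt0) ?(ltW theta_gt0) ?(ltW B0).
  have B12 k : (k <= 12)%N -> be s ^+ k <= Bd ^+ 12.
    move=> k12; apply: (@le_trans _ _ (Bd ^+ k)).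
      by apply: lerXn2r; rewrite ?nnegrE ?(ltW B0) ?(ltW Bd0).
    exact: ler_weXn2l.
  have [near|nfar] := leP (2 * (theta * (be s ^+ 5 * Y i ^+ 3))) (c * be s).
    apply: (@le_trans _ _ (32 * n * theta * be s ^+ 5 * (2 * Y i ^+ 8 / (c * be s)))).
      rewrite ler_wpM2l//.
      have za2 : c * be s / 2 <= normc (zeta - level_point i l).
        by have := normc_dist_triangle (level_point i l) zeta (x s); have := far s; lra.
      have cB : 0 < c * be s by rewrite mulr_gt0.
      rewrite ler_pdivrMr// mulrAC ler_pdivlMr//.
      have := ler_wpM2l (ltW yi0) za2; lra.
    have -> : 32 * n * theta * be s ^+ 5 * (2 * Y i ^+ 8 / (c * be s)) =
       Y i ^+ 6 * (64 * n * theta * be s * (be s ^+ 3 * Y i ^+ 2 * c) / c ^+ 2).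
      by field; rewrite !gt_eqF.
    rewrite ler_wpM2l ?exprn_ge0 ?(ltW Yi) ?(ltW Q0)// /A [leRHS]mulrAC ler_wpM2r ?invr_ge0 ?sqr_ge0//.
    have -> : 128 * n * theta * Bd ^+ 12 * be s = 64 * n * theta * be s * (2 * Bd ^+ 12) by ring.
    rewrite ler_wpM2l//; first by rewrite !mulr_ge0 ?(ltW n_gt0) ?(ltW theta_gt0) ?(ltW B0).
    have h3 := B12 3%N isT.
    have e0 : 0 <= be s ^+ 3 by rewrite exprn_ge0// ltW.
    have Y21 : Y i ^+ 2 <= 1 by rewrite exprn_ile1// ltW.
    have : be s ^+ 3 * Y i ^+ 2 * c <= be s ^+ 3 * 1 * 1.
      by rewrite ler_pM ?(ltW c0) ?mulr_ge0 ?exprn_ge0 ?(ltW Yi) ?(ltW Q0) ?(ltW B0)// ler_wpM2l.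
    lra.
  have t1 : Y i ^+ 8 / normc (zeta - level_point i l) <= 1 by rewrite ler_pdivrMr// mul1r.
  apply: (@le_trans _ _ (32 * n * theta * be s ^+ 5 * 1)); first by rewrite ler_wpM2l.
  have c4 : c <= 2 * (be s ^+ 4 * Y i ^+ 3).
    have : c * be s <= 2 * (1 * (be s ^+ 5 * Y i ^+ 3)).
      apply: (le_trans (ltW nfar)); rewrite ler_wpM2l// ler_wpM2r ?theta_le1//.
      by rewrite mulr_ge0 ?exprn_ge0 ?(ltW Yi) ?(ltW Q0) ?(ltW B0).
    have -> : 2 * (1 * (be s ^+ 5 * Y i ^+ 3)) = 2 * (be s ^+ 4 * Y i ^+ 3) * be s by ring.
    by rewrite ler_pM2r.
  have c42 : c ^+ 2 <= (2 * (be s ^+ 4 * Y i ^+ 3)) ^+ 2.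
    by rewrite ler_pXn2r ?nnegrE ?(ltW c0)// !mulr_ge0 ?exprn_ge0 ?(ltW Yi) ?(ltW Q0) ?(ltW B0).
  rewrite mulr1 /A.
  have -> : Y i ^+ 6 * (128 * n * theta * Bd ^+ 12 / c ^+ 2 * be s) =
     32 * n * theta * be s * (4 * Y i ^+ 6 * Bd ^+ 12) / c ^+ 2 by ring.
  rewrite ler_pdivlMr ?exprn_gt0//.
  have -> : 32 * n * theta * be s ^+ 5 * c ^+ 2 = 32 * n * theta * be s * (be s ^+ 4 * c ^+ 2) by ring.
  rewrite ler_wpM2l ?mulr_ge0 ?(ltW n_gt0) ?(ltW theta_gt0) ?(ltW B0)//.
  apply: (@le_trans _ _ (be s ^+ 4 * (2 * (be s ^+ 4 * Y i ^+ 3)) ^+ 2)).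
    by rewrite ler_wpM2l// exprn_ge0// ltW.
  have -> : be s ^+ 4 * (2 * (be s ^+ 4 * Y i ^+ 3)) ^+ 2 = 4 * Y i ^+ 6 * be s ^+ 12 by ring.
  by rewrite ler_wpM2l ?B12// mulr_ge0// exprn_ge0// ltW.
have -> : n / (1 - Q) * theta * (256 * L%:R * Bd ^+ 14 / c ^+ 2) =
  n * theta * (256 * L%:R * Bd ^+ 14 / c ^+ 2) / (1 - Q) by ring.
rewrite ler_wpM2r ?invr_ge0 ?subr_ge0 ?(ltW Q1)//.
apply: (@le_trans _ _ (\sum_(0 <= s < m) A * Bd * be s)).
  by apply: ler_sum => s _; rewrite ler_wpM2r ?(ltW (be0 s))// ler_wpM2l.
rewrite -mulr_sumr; apply: (@le_trans _ _ (A * Bd * (2 * L%:R * Bd))).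
  rewrite ler_wpM2l//; first exact: mulr_ge0 A0 (ltW Bd0).
  apply: (le_trans (sum_beta_le b_gt0 b_anti L_gt0 beta_half 0 m)).
  by rewrite ler_wpM2l ?mulr_ge0.
by rewrite /A le_eqVlt; apply/orP; left; apply/eqP; ring.
Qed.

End LatticeSums.

(** * Light tails imply wepability *)

Section TripleSums.
Variable R : realType.

(** An enumeration of a countable type by [pickle_inv] visits each triple once, and
    finitely many triples fit in a box. *)
Lemma triple_sum_box (f : nat * nat * nat -> R) (N : nat -> nat -> nat) m :
  (forall t, 0 <= f t) -> (forall j i l, (N j i <= l)%N -> f (j, i, l) = 0) ->
  exists A, \sum_(0 <= k < m) oapp f 0 (pickle_inv k) <=
    \sum_(0 <= j < A) \sum_(0 <= i < A) \sum_(l < N j i) f (j, i, nat_of_ord l).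
Proof.
move=> f0 fN; pose s : seq (nat * nat * nat) := pmap pickle_inv (index_iota 0 m).
have us : uniq s by apply: (pmap_uniq (@pickle_invK _)); exact: iota_uniq.
have es : \sum_(0 <= k < m) oapp f 0 (pickle_inv k) = \sum_(t <- s) f t.
  rewrite /s; elim: (index_iota 0 m) => [|k r ih]; first by rewrite !big_nil.
  by rewrite big_cons ih /=; case: (pickle_inv k) => [t|]/=; rewrite ?big_cons ?add0r.
pose A := (\sum_(t <- s) (t.1.1 + t.1.2).+1)%N.
have sA t : t \in s -> (t.1.1 < A)%N /\ (t.1.2 < A)%N.
  by move=> ts; rewrite /A (big_rem t ts)/=; split; lia.
pose bx : seq (nat * nat * nat) :=
  [seq (p, l) | p <- [seq (j, i) | j <- index_iota 0 A, i <- index_iota 0 A],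
     l <- index_iota 0 (N p.1 p.2)].
have ubx : uniq bx.
  apply: allpairs_uniq_dep; rewrite ?iota_uniq//.
    by apply: allpairs_uniq; rewrite ?iota_uniq// => -[? ?] [? ?] _ _ [-> ->].
  - by move=> p _; rewrite iota_uniq.
  - by move=> [p l] [p' l'] _ _ /= [-> ->].
exists A; rewrite es.
have -> : \sum_(0 <= j < A) \sum_(0 <= i < A) \sum_(l < N j i) f (j, i, nat_of_ord l) =
    \sum_(t <- bx) f t.
  rewrite /bx big_allpairs_dep big_allpairs_dep; apply: eq_bigr => j _; apply: eq_bigr => i _.
  by rewrite big_mkord.
rewrite [leLHS](bigID (fun t => t \in bx))/= [X in _ + X]big1_seq ?addr0; last first.
  move=> [[j i] l] /andP[nbx ts]; apply: fN; rewrite leqNgt; apply/negP => lN.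
  move/negP: nbx; apply; have /= [jA iA] := sA _ ts.
  apply/allpairsPdep; exists (j, i), l; split=> //=; last by rewrite mem_index_iota.
  by apply/allpairsPdep; exists j, i; rewrite !mem_index_iota.
have -> : \sum_(t <- s | t \in bx) f t = \sum_(t <- bx | t \in s) f t.
  rewrite -!(big_filter _ (fun t => t \in _)); apply: perm_big; apply: uniq_perm.
  - exact: filter_uniq.
  - exact: filter_uniq.
  by move=> t; rewrite !mem_filter andbC.
by rewrite big_mkcond; apply: ler_sum => t _; case: ifP.
Qed.

Lemma half_sum_le A : \sum_(0 <= j < A) (1 / 2 : R) ^+ j <= 2.
Proof.
suff -> : \sum_(0 <= j < A) (1 / 2 : R) ^+ j = 2 - 2 * (1 / 2) ^+ A.
  by rewrite gerBl mulr_ge0// exprn_ge0// divr_ge0.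
elim: A => [|A ih]; first by rewrite big_geq// expr0; lra.
by rewrite big_nat_recr//= ih exprS; lra.
Qed.

Lemma triple_sum_le (f : nat * nat * nat -> R) (N : nat -> nat -> nat) c m :
  (forall t, 0 <= f t) -> (forall j i l, (N j i <= l)%N -> f (j, i, l) = 0) -> 0 <= c ->
  (forall j I, \sum_(0 <= i < I) \sum_(l < N j i) f (j, i, nat_of_ord l) <= (1 / 2) ^+ j * c) ->
  \sum_(0 <= k < m) oapp f 0 (pickle_inv k) <= 2 * c.
Proof.
move=> f0 fN c0 fc; have [A hA] := triple_sum_box m f0 fN.
apply: (le_trans hA); apply: (@le_trans _ _ (\sum_(0 <= j < A) (1 / 2) ^+ j * c)).
  by apply: ler_sum => j _.
by rewrite -mulr_suml ler_wpM2r// half_sum_le.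
Qed.

End TripleSums.

Section NonVanishing.
Variable R : realType.
Local Notation C := R[i].

(** From [1 / (1 - t) = 1 + t / (1 - t) <= exp (t / (1 - t))]. *)
Lemma expRN_le1B (t e : R) : 0 < e -> 0 <= t -> e <= 1 - t -> expR (- (t / e)) <= 1 - t.
Proof.
move=> e0 t0 te; have d0 : 0 < 1 - t by lra.
rewrite expRN -[leRHS]invrK lef_pV2 ?posrE ?invr_gt0 ?expR_gt0//.
apply: le_trans (expR_ge1Dx _).
apply: (@le_trans _ _ (1 + t / (1 - t))).
  by rewrite le_eqVlt; apply/orP; left; apply/eqP; field; lra.
by rewrite lerD2l ler_wpM2l// lef_pV2 ?posrE.
Qed.

Lemma one_sub_exp_le (q : R) n : 0 <= q <= 1 -> 1 - q ^+ n <= n%:R * (1 - q).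
Proof.
move=> /andP[q0 q1]; elim: n => [|n ih]; first by rewrite expr0 subrr mul0r.
have : q * (1 - q ^+ n) <= 1 - q ^+ n by rewrite ler_piMl// subr_ge0 exprn_ile1.
by rewrite exprS -natr1; lra.
Qed.

(** Converse to the upper bound: away from all zeros, each factor [rho] is at least
    its square, which is at least [exp (- (1 - rho ^ 2) / e ^ 2)]. *)
Lemma blaschke_lower (a : nat -> option C) (B : C -> C) (z : C) (e W : R) :
  (forall n w, a n = Some w -> normc w < 1) -> normc z < 1 ->
  (\prod_(0 <= n < N) opt_factor (a n) z) @[N --> \oo] --> B z ->
  0 < e -> (forall n w, a n = Some w -> e <= rho z w) ->
  (forall m, \sum_(0 <= n < m) (if a n is Some w then 1 - rho z w ^+ 2 else 0) <= W) ->
  expR (- (W / e ^+ 2)) <= normc (B z).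
Proof.
move=> ad z1 Bl e0 ae aW; have e20 : 0 < e ^+ 2 by rewrite exprn_gt0.
rewrite -lerN2; apply: (lim_le_bound (cvgN (normc_cvg Bl))) => m /=.
rewrite lerN2 normc_prod; set t := fun n => if a n is Some w then 1 - rho z w ^+ 2 else 0.
apply: (@le_trans _ _ (expR (- ((\sum_(0 <= n < m) t n) / e ^+ 2)))).
  by rewrite ler_expR lerN2 ler_wpM2r ?invr_ge0 ?(ltW e20).
elim: m => [|m ih]; first by rewrite !big_geq// mul0r oppr0 expR0.
rewrite !big_nat_recr//= mulrDl opprD expRD ler_pM ?expR_ge0//.
rewrite /t /opt_factor; case E: (a m) => [w|]; last by rewrite mul0r oppr0 expR0 normc1.
have w1 := ad _ _ E; have r1 := rho_le1 z1 w1; have r0 := rho_ge0 z w.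
have er := ae _ _ E; rewrite normc_blaschke_factor.
apply: (@le_trans _ _ (rho z w ^+ 2)); last by rewrite expr2 ler_piMr.
rewrite -[leRHS](subKr 1); apply: expRN_le1B => //.
  by rewrite subr_ge0 expr_le1.
by rewrite subKr ler_pXn2r// nnegrE// ltW.
Qed.

(** Harnack's inequality for the Poisson kernel, between two points that are close
    with respect to the height of the higher one. *)
Lemma poisson_harnack (a z xi : C) : normc a < 1 -> normc z < 1 -> normc xi = 1 ->
  1 - normc z <= 1 - normc a -> normc (z - a) <= (1 - normc a) / 2 ->
  poisson z xi <= 8 * poisson a xi.
Proof.
move=> a1 z1 x1 za d; have xa := circle_sub_lower a x1.
have xa0 := circle_sub_gt0 a1 x1; have xz0 := circle_sub_gt0 z1 x1.
have xz : normc (xi - a) <= 2 * normc (xi - z).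
  by have := normc_dist_triangle z xi a; lra.
have na := normc_ge0 a; have nz := normc_ge0 z.
rewrite /poisson ler_pdivrMr ?exprn_gt0//.
have -> : 8 * ((1 - normc a ^+ 2) / normc (xi - a) ^+ 2) * normc (xi - z) ^+ 2 =
  2 * (1 - normc a ^+ 2) * ((2 * normc (xi - z)) ^+ 2 / normc (xi - a) ^+ 2).
  by ring.
have h : 1 <= (2 * normc (xi - z)) ^+ 2 / normc (xi - a) ^+ 2.
  by rewrite ler_pdivlMr ?exprn_gt0// mul1r ler_pXn2r// nnegrE ltW// mulr_gt0.
have h2 : 1 - normc z ^+ 2 <= 2 * (1 - normc a ^+ 2).
  have : normc a ^+ 2 <= normc a by rewrite expr2 ler_piMr// ltW.
  have := sqr_ge0 (1 - normc z); rewrite sqrrB expr1n; lra.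
have h3 : 0 <= 2 * (1 - normc a ^+ 2).
  have : normc a ^+ 2 <= 1 by rewrite expr_le1// ltW.
  lra.
by apply: (le_trans h2); rewrite ler_peMr.
Qed.

End NonVanishing.

Section LightTails.
Variable R : realType.
Local Notation C := R[i].
Variables (b : nat -> R) (K : R) (L : nat) (x : nat -> C).
Hypothesis b_gt0 : forall s, 0 < b s.
Hypothesis b_anti : forall i j, (i <= j)%N -> b j <= b i.
Hypothesis K_ge1 : 1 <= K.
Hypothesis b_tail : forall s n, \sum_(s <= k < n) b k <= K * b s.
Hypothesis L_gt0 : (0 < L)%N.
Hypothesis beta_half : forall s, beta b (s + L) <= beta b s / 2.
Hypothesis x_circle : forall s, normc (x s) = 1.

(* The lattice [j] has circles of heights [ratio j ^+ (8 * i)], each with about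
   [mesh j] divided by its height points: every point of the disc is within a
   pseudo-hyperbolic distance of order [1 / mesh j] of it. The parameter
   [strength j] decides by how much the Poisson sum has to be large for a point of
   this lattice to become a zero; it is chosen such that the sums over the lattices
   form a geometric series. *)
Definition mesh (j : nat) : R := j.+1%:R.
Definition ratio (j : nat) : R := mesh j / (mesh j + 1).
Definition strength (j : nat) : R := K^-1 * (1 / 2) ^+ j * ((1 - ratio j) / mesh j).
Definition level_size (j i : nat) : nat := (Num.truncn (mesh j / (ratio j ^+ i) ^+ 8)).+1.

Lemma mesh_ge1 j : 1 <= mesh j. Proof. by rewrite ler1n. Qed.
Let mesh_gt0 j : 0 < mesh j. Proof. by rewrite ltr0n. Qed.

Lemma ratio_in j : 0 < ratio j < 1.
Proof.
have n0 := mesh_gt0 j; have n1 : 0 < mesh j + 1 by lra.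
by rewrite divr_gt0//= ltr_pdivrMr// mul1r ltrDl.
Qed.
Let ratio_gt0 j : 0 < ratio j. Proof. by case/andP: (ratio_in j). Qed.
Let ratio_lt1 j : ratio j < 1. Proof. by case/andP: (ratio_in j). Qed.

Lemma ratio_gap j : mesh j * (1 - ratio j) <= 1.
Proof.
have n0 := mesh_gt0 j; have n1 : 0 < mesh j + 1 by lra.
have -> : mesh j * (1 - ratio j) = mesh j / (mesh j + 1) by rewrite /ratio; field; lra.
by rewrite ler_pdivrMr// mul1r lerDl.
Qed.

Let height_gt0 j i : 0 < (ratio j ^+ i) ^+ 8.
Proof. by rewrite !exprn_gt0. Qed.
Let height_le1 j i : (ratio j ^+ i) ^+ 8 <= 1.
Proof. by rewrite !exprn_ile1 ?exprn_ge0 ?ltW. Qed.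

Lemma level_size_low j i : mesh j <= (ratio j ^+ i) ^+ 8 * (level_size j i)%:R.
Proof.
rewrite mulrC -ler_pdivrMr// ltW//.
have h : 0 <= mesh j / (ratio j ^+ i) ^+ 8 by rewrite divr_ge0 ?ltW.
by have /andP[] := truncn_itv h.
Qed.

Lemma level_size_up j i : (level_size j i)%:R * (ratio j ^+ i) ^+ 8 <= 2 * mesh j.
Proof.
rewrite -ler_pdivlMr//.
have h : 0 <= mesh j / (ratio j ^+ i) ^+ 8 by rewrite divr_ge0 ?ltW.
have /andP[t1 _] := truncn_itv h.
have h1 : 1 <= mesh j / (ratio j ^+ i) ^+ 8.
  by rewrite ler_pdivlMr// mul1r (le_trans (height_le1 j i))// mesh_ge1.
rewrite /level_size -addn1 natrD -mulrA; lra.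
Qed.

Let size_low j i : 1 <= (ratio j ^+ i) ^+ 8 * (level_size j i)%:R.
Proof. exact: le_trans (mesh_ge1 j) (level_size_low j i). Qed.

Lemma strength_gt0 j : 0 < strength j.
Proof.
have K1 := K_ge1; have q := ratio_lt1 j.
by rewrite !mulr_gt0 ?exprn_gt0 ?divr_gt0 ?invr_gt0//; lra.
Qed.

Lemma strength_le j : strength j <= K^-1.
Proof.
have K1 := K_ge1; have K0 : 0 < K^-1 by rewrite invr_gt0; lra.
have q := ratio_lt1 j; have q0 := ratio_gt0 j.
rewrite /strength -mulrA ler_piMr ?(ltW K0)// mulr_ile1 ?exprn_ge0 ?divr_ge0 ?exprn_ile1//; try lra.
by rewrite ler_pdivrMr// mul1r (le_trans _ (mesh_ge1 j))//; lra.
Qed.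

Lemma strength_weight j : mesh j / (1 - ratio j) * strength j <= (1 / 2) ^+ j.
Proof.
have K1 := K_ge1; have q := ratio_lt1 j; have n0 := mesh_gt0 j.
have -> : mesh j / (1 - ratio j) * strength j = K^-1 * (1 / 2) ^+ j.
  by rewrite /strength; field; rewrite !gt_eqF//; lra.
by rewrite ler_piMl ?exprn_ge0 ?divr_ge0// invf_le1//; lra.
Qed.

Definition net_point j i l : C := level_point (ratio j) (level_size j) i l.

(** The zeros of the Blaschke product: the points of all the lattices where the
    Poisson sum exceeds the threshold of the lattice. Repetitions are harmless. *)
Definition net_zero (t : nat * nat * nat) : option C :=
  let: (j, i, l) := t in
  if (l < level_size j i)%N && high b L x (strength j) (net_point j i l)
  then Some (net_point j i l) else None.

Definition net_zeros (k : nat) : option C := obind net_zero (pickle_inv k).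

Lemma net_point_disc j i l : normc (net_point j i l) < 1.
Proof. exact: level_point_disc (ratio_in j) _ _. Qed.

Lemma net_zeros_disc k w : net_zeros k = Some w -> normc w < 1.
Proof.
rewrite /net_zeros; case: (pickle_inv k) => [[[j i] l]|]//=.
by case: ifP => // _ [<-]; exact: net_point_disc.
Qed.

(** All thresholds are larger than one: this is the condition that the zeros lie
    where the singular function is smaller than a constant [m < 1]. *)
Lemma net_zeros_high k w : net_zeros k = Some w ->
  exists p, 1 < \sum_(0 <= s < p) b s * poisson w (x s).
Proof.
have K1 := K_ge1.
rewrite /net_zeros; case: (pickle_inv k) => [[[j i] l]|]//=.
case: ifP => // /andP[_ /asboolP[p hp]] [<-]; exists p.
by have := tau_ge K_ge1 L_gt0 (strength_gt0 j) (strength_le j); lra.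
Qed.

Lemma net_zeros_mem j i l : (l < level_size j i)%N ->
  high b L x (strength j) (net_point j i l) ->
  net_zeros (pickle (j, i, l)) = Some (net_point j i l).
Proof. by move=> lN h; rewrite /net_zeros pickleK_inv /= lN h. Qed.

(** The reduction of sums over all zeros to sums over the lattices one by one. *)
Lemma net_sum_le (F : C -> R) c m : (forall w, normc w < 1 -> 0 <= F w) -> 0 <= c ->
  (forall j I, \sum_(0 <= i < I)
     \sum_(l < level_size j i | high b L x (strength j) (net_point j i l)) F (net_point j i l)
     <= mesh j / (1 - ratio j) * strength j * c) ->
  \sum_(0 <= k < m) (if net_zeros k is Some w then F w else 0) <= 2 * c.
Proof.
move=> F0 c0 Fc; pose f t := if net_zero t is Some w then F w else 0.
have f0 t : 0 <= f t.
  case: t => [[j i] l]; rewrite /f /=; case: ifP => // _; exact: F0 (net_point_disc _ _ _).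
have fN j i l : (level_size j i <= l)%N -> f (j, i, l) = 0.
  by rewrite /f /= ltnNge => ->.
apply: le_trans (triple_sum_le m f0 fN c0 _).
  apply: ler_sum => k _; rewrite /net_zeros /f; by case: (pickle_inv k).
move=> j I; apply: (le_trans (le_trans _ (Fc j I))); last first.
  by rewrite ler_wpM2r// strength_weight.
apply: ler_sum => i _; rewrite [leRHS]big_mkcond; apply: ler_sum => l _.
by rewrite /f /= ltn_ord /=; case: ifP.
Qed.

Lemma net_interior_sum (z : C) (M : R) m : normc z < 1 -> 1 <= M ->
  (forall p, \sum_(0 <= s < p) b s * poisson z (x s) <= M) ->
  \sum_(0 <= k < m) (if net_zeros k is Some w then 1 - rho z w ^+ 2 else 0) <=
  2 * (4096 * M * L%:R + 128 * K + 256 * M).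
Proof.
move=> z1 M1 zM; have K1 := K_ge1.
have L0 : (0 : R) <= L%:R by rewrite ler0n.
apply: net_sum_le.
- by move=> w w1; rewrite subr_ge0 expr_le1 ?rho_ge0 ?rho_le1.
- by have : 0 <= M * L%:R by [apply: mulr_ge0 => //; lra]; lra.
move=> j I; have h0 : 0 < 1 - normc z by rewrite subr_gt0.
exact: (interior_sum b_gt0 b_anti K_ge1 b_tail L_gt0 beta_half x_circle (ratio_in j)
  (mesh_gt0 j) (strength_gt0 j) (size_low j) (level_size_up j) (strength_le j)
  (eighth_root_gt0 h0) (esym (eighth_rootK (ltW h0))) M1 zM I).
Qed.

Lemma net_boundary_sum (zeta : C) (e : R) m : normc zeta = 1 -> 0 < e <= 1 ->
  (forall s, e * beta b s <= normc (zeta - x s)) ->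
  \sum_(0 <= k < m) (if net_zeros k is Some w then (1 - normc w) / normc (zeta - w) else 0) <=
  2 * (256 * L%:R * (1 + beta b 0) ^+ 14 / e ^+ 2).
Proof.
move=> ze1 e01 far; have e0 : 0 < e by case/andP: e01.
have b0 := beta_gt0 b_gt0 0.
have B0 : 0 <= 1 + beta b 0 by lra.
have L0 : (0 : R) <= L%:R by rewrite ler0n.
apply: net_sum_le.
- by move=> w w1; rewrite divr_ge0 ?normc_ge0// subr_ge0 ltW.
- apply: divr_ge0; last exact: sqr_ge0.
  by apply: mulr_ge0; [lra|exact: exprn_ge0].
move=> j I; apply: (boundary_sum b_gt0 b_anti K_ge1 b_tail L_gt0 beta_half x_circle (ratio_in j)
  (mesh_gt0 j) (strength_gt0 j) (size_low j) (level_size_up j) (strength_le j)) => //.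
- by lra.
- move=> s; have := beta_anti b_gt0 b_anti (leq0n s); lra.
Qed.

(** The circle is the last one whose height is not below that of [z]; the next height
    is smaller by a factor close to one, so the radial distance is of order
    [1 / mesh j] times the height, like the spacing of the points. *)
Lemma net_dense j (z : C) : normc z < 1 -> exists i l,
  [/\ (l < level_size j i)%N, 1 - normc z <= 1 - normc (net_point j i l) &
      normc (z - net_point j i l) <= 72 / mesh j * (1 - normc (net_point j i l))].
Proof.
move=> z1; have n0 := mesh_gt0 j; have q1 := ratio_lt1 j; have q0 := ratio_gt0 j.
have gap i l : 1 - normc (net_point j i l) = (ratio j ^+ i) ^+ 8.
  exact: level_point_gap (ratio_in j) _ _.
have [z0|z0] := eqVneq (normc z) 0.
  have e : net_point j 0 0 = 0.
    have := gap 0%N 0%N; rewrite expr0 expr1n => h.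
    by apply/eqP; rewrite -normc_eq0; apply/eqP; lra.
  exists 0%N, 0%N; split => //; rewrite e normc0 subr0 ?z0 ?subr0//.
  by rewrite mulr1 divr_ge0// ltW.
have zp : 0 < normc z by rewrite lt_neqAle eq_sym z0 normc_ge0.
have h0 : 0 < 1 - normc z by rewrite subr_gt0.
have [i0 hi0] : exists i, (ratio j ^+ i) ^+ 8 < 1 - normc z.
  have /cvgrPdist_lt/(_ _ h0)[i _ Hi] : (fun i => ratio j ^+ i) @ \oo --> (0 : R).
    by apply: cvg_expr; rewrite ger0_norm ?ltW.
  exists i; have := Hi i (leqnn i); rewrite /= sub0r normrN ger0_norm ?exprn_ge0 ?(ltW q0)//.
  apply: le_lt_trans; rewrite exprS ler_piMr ?exprn_ge0 ?(ltW q0)//.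
  by rewrite !exprn_ile1 ?exprn_ge0 ?ltW.
case: (ex_minnP (ex_intro (fun i => (ratio j ^+ i) ^+ 8 < 1 - normc z) i0 hi0)) => i hi imin.
(* The circle of index zero has height one, so the first index below [z] is a
   successor. *)
case: i hi imin => [|i] hi imin.
  by exfalso; move: hi; rewrite expr0 expr1n; lra.
have yh : 1 - normc z <= (ratio j ^+ i) ^+ 8.
  by rewrite leNgt; apply/negP => /imin; rewrite ltnn.
have [l lN d] := lattice_dense (height_gt0 j i) (height_le1 j i) (size_low j i) zp.
exists i, l; split => //; first by rewrite gap.
rewrite gap; apply: (le_trans d).
have y0 := height_gt0 j i; have low := level_size_low j i.
set y := (ratio j ^+ i) ^+ 8 in y0 low yh *.
have N0 : (0 : R) < (level_size j i)%:R by rewrite ltr0n.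
have h64 : 64 / (level_size j i)%:R <= 64 / mesh j * y.
  rewrite ler_pdivrMr//.
  have -> : 64 / mesh j * y * (level_size j i)%:R = 64 * (y * (level_size j i)%:R / mesh j) by ring.
  have : 1 <= y * (level_size j i)%:R / mesh j by rewrite ler_pdivlMr// mul1r.
  by move: (y * _ / _) => v; lra.
have h8 : `|y - (1 - normc z)| <= 8 / mesh j * y.
  rewrite ger0_norm ?subr_ge0//.
  have yS : (ratio j ^+ i.+1) ^+ 8 = ratio j ^+ 8 * y by rewrite [ratio j ^+ i.+1]exprS exprMn.
  rewrite yS in hi; clear yS; clearbody y.
  have q8 : 1 - ratio j ^+ 8 <= 8 * (1 - ratio j).
    by apply: (one_sub_exp_le 8); rewrite (ltW q0) (ltW q1).
  have gq : 1 - ratio j <= 1 / mesh j.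
    by rewrite ler_pdivlMr// mulrC ratio_gap.
  have : (1 - ratio j ^+ 8) * y <= 8 / mesh j * y.
    rewrite ler_wpM2r ?(ltW y0)//; apply: (le_trans q8).
    have -> : 8 / mesh j = 8 * (1 / mesh j) by ring.
    by rewrite ler_wpM2l.
  rewrite mulrBl mul1r; apply: le_trans; rewrite lerD2l lerN2; exact: ltW.
have -> : 72 / mesh j * y = 8 / mesh j * y + 64 / mesh j * y by ring.
exact: lerD.
Qed.

(** In a lattice that is fine compared with [e], a point far from the zeros has a
    neighbour that is not a zero. There the Poisson sum is at most the threshold of
    that lattice, and Harnack's inequality transfers the bound. *)
Lemma net_poisson_bound (e : R) : 0 < e -> exists2 M, 1 <= M &
  forall z, normc z < 1 -> (forall k w, net_zeros k = Some w -> e < rho z w) ->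
  forall p, \sum_(0 <= s < p) b s * poisson z (x s) <= M.
Proof.
move=> e0; have K1 := K_ge1.
have X0 : 0 <= 72 / e + 144 by rewrite addr_ge0// divr_ge0// ltW.
pose j := Num.bound (72 / e + 144).
have jX : 72 / e + 144 < mesh j.
  by apply: (lt_trans (archi_boundP X0)); rewrite ltr_nat.
have n0 := mesh_gt0 j.
have e72 : 0 < 72 / e by rewrite divr_gt0.
have n144 : 144 < mesh j by lra.
have ne : 72 / mesh j < e.
  have : 72 / e < mesh j by lra.
  by rewrite !ltr_pdivrMr// mulrC.
clearbody j; clear X0 jX.
pose tau := 16 * L%:R / strength j ^+ 2.
have tau8 : 8 * K <= tau := tau_ge K_ge1 L_gt0 (strength_gt0 j) (strength_le j).
exists (8 * tau); first by lra.
move=> z z1 zfar p; have [i [l [lN za d]]] := net_dense j z1.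
have a1 := net_point_disc j i l; set a := net_point j i l in za d a1 *.
have a0 : 0 < 1 - normc a by rewrite subr_gt0.
have den : 1 - normc a <= normc (1 - (a^*)%C * z).
  by rewrite kernel_sym; apply: kernel_lower; exact: ltW.
have ra : rho z a < e.
  rewrite /rho normc_div ltr_pdivrMr; last exact: lt_le_trans den.
  apply: (le_lt_trans d); apply: (@lt_le_trans _ _ (e * (1 - normc a))).
    by rewrite ltr_pM2r.
  by rewrite ler_wpM2l// ltW.
have low : ~~ high b L x (strength j) a.
  apply/negP => ha; have := zfar _ _ (net_zeros_mem lN ha).
  by apply/negP; rewrite -leNgt ltW.
have half : normc (z - a) <= (1 - normc a) / 2.
  apply: (le_trans d); rewrite mulrC ler_wpM2l ?(ltW a0)//.
  by rewrite ler_pdivrMr//; lra.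
apply: (@le_trans _ _ (8 * \sum_(0 <= s < p) b s * poisson a (x s))).
  rewrite mulr_sumr; apply: ler_sum => s _; rewrite [leRHS]mulrCA ler_wpM2l ?(ltW (b_gt0 s))//.
  exact: poisson_harnack.
rewrite ler_wpM2l// leNgt; apply/negP => h.
by move/negP: low; apply; apply/asboolP; exists p.
Qed.

Lemma b_summable_of_tail : summable_seq b.
Proof. by exists (K * b 0) => n; exact: b_tail. Qed.

Let b_ge0 s : 0 <= b s. Proof. exact: ltW. Qed.

(** At the origin [1 - rho ^ 2] is [1 - |w| ^ 2], so the Blaschke condition is a case
    of the interior estimate. *)
Lemma net_gap_summable : summable_seq (@opt_gap R \o net_zeros).
Proof.
have K1 := K_ge1; have z1 : normc (0 : C) < 1 by rewrite normc0.
have b00 := b_ge0 0%N.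
have M1 : 1 <= 1 + K * b 0 by rewrite lerDl mulr_ge0//; lra.
have PM p : \sum_(0 <= s < p) b s * poisson 0 (x s) <= 1 + K * b 0.
  apply: le_trans (_ : \sum_(0 <= s < p) b s <= _).
    apply: ler_sum => s _; rewrite /poisson normc0 subr0 x_circle expr1n expr0n /=.
    by rewrite subr0 divr1 mulr1.
  by apply: (le_trans (b_tail 0 p)); rewrite lerDr.
exists (2 * (4096 * (1 + K * b 0) * L%:R + 128 * K + 256 * (1 + K * b 0))) => m.
apply: le_trans (net_interior_sum m z1 M1 PM); apply: ler_sum => k _.
rewrite /opt_gap /=; case E: (net_zeros k) => [w|//].
have w1 := net_zeros_disc E.
have -> : rho 0 w = normc w.
  by rewrite /rho mulr0 subr0 divr1 sub0r normc_opp.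
by rewrite lerD2l lerN2 expr2 ler_piMr ?normc_ge0// ltW.
Qed.

Section Wepability.
Variables (S B : C -> C).
Hypothesis S_lim : forall z, normc z < 1 ->
  (\prod_(0 <= s < n) atom_factor b x s z) @[n --> \oo] --> S z.
Hypothesis S_modulus : forall z, normc z < 1 -> exists2 P : R,
  (fun n => \sum_(0 <= s < n) b s * poisson z (x s)) @ \oo --> P &
  normc (S z) = expR (- P).
Hypothesis B_lim : forall z, normc z < 1 ->
  (\prod_(0 <= n < N) opt_factor (net_zeros n) z) @[N --> \oo] --> B z.

Lemma beta_summable : summable_seq (beta b).
Proof.
by exists (2 * L%:R * beta b 0) => n; exact: (sum_beta_le b_gt0 b_anti L_gt0 beta_half).
Qed.

(** The mass [b s] is the eighth power of [beta b s], of which one power is spent on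
    the distance to [u] and one on summability. *)
Lemma singular_radial (u : C) (e : R) : normc u = 1 -> 0 < e ->
  (forall s, e * beta b s <= normc (u - x s)) ->
  exists2 l : C, normc l = 1 & S (r%:C%C * u) @[r --> (1 : R)^'-] --> l.
Proof.
move=> u1 e0 far; have be0 s : 0 < beta b s := beta_gt0 b_gt0 s.
apply: (singular_radial_limit b_ge0 x_circle S_lim u1).
  move=> s; apply/eqP => xu; have := far s; rewrite xu subrr normc0 leNgt.
  by rewrite mulr_gt0.
apply: summable_le (summable_scale (r := beta b 0 ^+ 6 / e) _ beta_summable); last first.
  by rewrite divr_ge0 ?exprn_ge0// ltW.
move=> s; have eb : 0 < e * beta b s by rewrite mulr_gt0.
rewrite normc_distC ler_pdivrMr; last exact: lt_le_trans (far s).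
rewrite -(beta8 b_gt0).
apply: (@le_trans _ _ (beta b 0 ^+ 6 / e * beta b s * (e * beta b s))); last first.
  by rewrite ler_wpM2l ?far// mulr_ge0 ?divr_ge0 ?exprn_ge0 ?ltW.
have -> : beta b 0 ^+ 6 / e * beta b s * (e * beta b s) = beta b 0 ^+ 6 * beta b s ^+ 2.
  by field; rewrite gt_eqF.
rewrite (_ : beta b s ^+ 8 = beta b s ^+ 6 * beta b s ^+ 2); last by rewrite -exprD.
rewrite ler_wpM2r ?sqr_ge0// lerXn2r ?nnegrE ?(ltW (be0 _))//.
exact: beta_anti.
Qed.

Lemma ae_circle_far : {ae @lebesgue_measure R, forall t : R, 0 <= t < 2 * pi ->
  exists2 e, 0 < e <= 1 & forall s, e * beta b s <= normc (cis t - x s)}.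
Proof.
by apply: ae_circle_avoid beta_summable => // s; exact: ltW (beta_gt0 b_gt0 s).
Qed.

Lemma singular_inner : inner S.
Proof.
split.
- move=> z; exact: (singular_derivable b_ge0 b_summable_of_tail x_circle S_lim).
- by exists 1 => z; exact: (singular_le1 b_ge0 x_circle S_lim).
- apply: (@filterS _ _ (ae_filter_ringOfSetsType _)) ae_circle_far => t far tI.
  have [e /andP[e0 _] he] := far tI.
  exact: singular_radial (normc_cis t) e0 he.
Qed.

(** Both factors have unimodular radial limits at every boundary point that avoids
    the atoms. *)
Lemma product_inner : inner (fun z => S z * B z).
Proof.
have S1 z : normc z < 1 -> normc (S z) <= 1 by exact: (singular_le1 b_ge0 x_circle S_lim).
have B1 z : normc z < 1 -> normc (B z) <= 1 by exact: (blaschke_le1 net_zeros_disc B_lim).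
split.
- move=> z z1; apply: derivableM.
    exact: (singular_derivable b_ge0 b_summable_of_tail x_circle S_lim).
  exact: (blaschke_derivable net_zeros_disc net_gap_summable B_lim).
- by exists 1 => z z1; rewrite normcM mulr_ile1 ?normc_ge0 ?S1 ?B1.
- apply: (@filterS _ _ (ae_filter_ringOfSetsType _)) ae_circle_far => t far tI.
  have [e e01 he] := far tI; have u1 := normc_cis t; have /andP[e0 _] := e01.
  have [l1 n1 c1] := singular_radial u1 e0 he.
  have bs : summable_seq (fun k => if net_zeros k is Some w
      then (1 - normc w) / normc (cis t - w) else 0).
    by eexists => m; exact: (net_boundary_sum m u1 e01 he).
  have [l2 n2 c2] := blaschke_radial_limit net_zeros_disc B_lim u1 bs.
  exists (l1 * l2); first by rewrite /unit_circle /= normcM n1 n2 mulr1.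
  have Bb (r : R) : 0 <= r < 1 -> normc (B (r%:C%C * cis t)) <= 1.
    by move=> /andP[r0 r1]; apply: B1; rewrite normc_circle_scale.
  by apply: (radial_limitM Bb _ c1 c2); rewrite n1.
Qed.

(** Far from the zeros the Poisson sum is bounded; this bounds [S] from below, and
    then [B] through the sum of [1 - rho ^ 2]. *)
Lemma product_wep : WEP (fun z => S z * B z).
Proof.
split; first exact: product_inner.
move=> eps eps0; pose e := Num.min eps 1.
have e0 : 0 < e by rewrite lt_min eps0 ltr01.
have [M M1 HM] := net_poisson_bound e0.
pose W := 2 * (4096 * M * L%:R + 128 * K + 256 * M).
apply: (@lt_le_trans _ _ (expR (- M) * expR (- (W / e ^+ 2)))%:E).
  by rewrite lte_fin mulr_gt0 ?expR_gt0.
apply/ereal_infP => _ [z [z1 far] <-]; rewrite lee_fin normcM.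
have zfar k w : net_zeros k = Some w -> e < rho z w.
  move=> E; have w1 := net_zeros_disc E.
  have : (eps%:E < (rho z w)%:E)%E.
    apply: (lt_le_trans far); apply: ereal_inf_lbound; exists w => //; split => //.
    apply/eqP; rewrite mulf_eq0; apply/orP; right; apply/eqP.
    by apply/(blaschke_zeroP net_zeros_disc net_gap_summable B_lim w1); exists k.
  by rewrite lte_fin; apply: le_lt_trans; rewrite ge_min lexx.
have PM := HM z z1 zfar.
apply: ler_pM; rewrite ?expR_ge0//.
  have [P cP ->] := S_modulus z1.
  by rewrite ler_expR lerN2; exact: lim_le_bound cP PM.
apply: (blaschke_lower net_zeros_disc z1 (B_lim z1) e0).
  by move=> k w /zfar /ltW.
by move=> m; exact: net_interior_sum.
Qed.

End Wepability.

(** The Blaschke product has its zeros at all sufficiently fine lattice points where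
    [S] is sufficiently small; the geometric decay of the masses makes such points
    rare enough for the product to be bounded below away from its zeros. *)
Theorem light_tails_wepable (S : C -> C) (mu : {measure set borelC R -> \bar R}) :
  is_atomic_measure b x mu ->
  (forall z, unit_disc z -> S z = singular_function mu z) -> easily_wepable S.
Proof.
move=> mub SE.
have S_lim z : normc z < 1 -> (\prod_(0 <= s < n) atom_factor b x s z) @[n --> \oo] --> S z.
  by move=> z1; rewrite SE//; exact: (singular_prod_cvg b_ge0 b_summable_of_tail x_circle).
have S_modulus z : normc z < 1 -> exists2 P : R,
    (fun n => \sum_(0 <= s < n) b s * poisson z (x s)) @ \oo --> P &
    normc (S z) = expR (- P).
  move=> z1; rewrite SE//.
  exact: (normc_singular b_ge0 b_summable_of_tail x_circle mub z1).
have /choice[B B_lim] z : exists l : C, normc z < 1 ->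
    (\prod_(0 <= n < N) opt_factor (net_zeros n) z) @[N --> \oo] --> l.
  have [z1|z1] := ltP (normc z) 1; last by exists 0.
  have [l hl] := opt_factor_cvg net_zeros_disc net_gap_summable z1.
  by exists l.
split; first exact: singular_inner S_lim.
exists (expR (-1)), B; split.
- by rewrite -[ltRHS]expR0 ltr_expR; lra.
- exists net_zeros; split.
  + by move=> n w; exact: net_zeros_disc.
  + apply: summable_cvg net_gap_summable => k.
    exact: (opt_gap_ge0 net_zeros_disc).
  + exact: B_lim.
- exact: product_wep.
- move=> z [z1 Bz]; split => //.
  have [k E] := (blaschke_zeroP net_zeros_disc net_gap_summable B_lim z1).1 Bz.
  have [p hp] := net_zeros_high E; have [P cP ->] := S_modulus z z1.
  rewrite ltr_expR ltrN2; apply: (lt_le_trans hp).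
  by apply: series_le_lim cP => s; rewrite mulr_ge0// poisson_ge0.
Qed.

End LightTails.

(** * The equivalence *)

Section TailCondition.
Variable R : realType.

(** The series of extended reals is the supremum of its partial sums, which are
    real. *)
Lemma tail_sums_le (b : nat -> R) (K : R) s : (forall k, 0 < b k) ->
  (\sum_(s <= k <oo) (b k)%:E <= (K * b s)%:E)%E <->
  (forall n, \sum_(s <= k < n) b k <= K * b s).
Proof.
move=> b0; split=> h.
  move=> n; rewrite -lee_fin; apply: le_trans h; rewrite -sumEFin.
  by apply: nneseries_lim_ge => k _ _; rewrite lee_fin ltW.
apply: lime_le.
  by apply: is_cvg_nneseries => k _ _; rewrite lee_fin ltW.
by near=> n; rewrite sumEFin lee_fin.
Unshelve. all: by end_near. Qed.

End TailCondition.

Unset Implicit Arguments.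

Theorem theorem3 (R : realType) (b : nat -> R)
    (b_gt0 : forall s, 0 < b s)
    (b_nonincreasing : nonincreasing_seq b)
    (b_summable : cvgn (series b)) :
  (forall S : R[i] -> R[i], atomic_singular_inner b S -> easily_wepable S) <->
  (exists2 K : R, 0 < K &
     forall s : nat, (\sum_(s <= k <oo) (b k)%:E <= (K * b s)%:E)%E).
Proof.
have b_sum : summable_seq b by apply: cvg_summable => // s; exact: ltW.
have b_anti i j : (i <= j)%N -> b j <= b i by move=> ij; exact: b_nonincreasing.
split=> [wepable|[K K0 tail]].
- apply: contrapT => light.
  have heavy K : 0 < K -> exists s n, K * b s < \sum_(s <= k < n) b k.
    move=> K0; apply: contrapT => no; apply: light; exists K => // s.
    apply/(tail_sums_le _ _ b_gt0) => n; rewrite leNgt; apply/negP => h.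
    by apply: no; exists s, n.
  have [S [Sb]] := heavy_tails_not_wepable b_gt0 b_sum b_anti heavy.
  by apply; exact: wepable.
- move=> S [x [mu [x_circle _ mub SE]]].
  pose K' := Num.max K 1; have K1 : 1 <= K' by rewrite le_max lexx orbT.
  have tail' s n : \sum_(s <= k < n) b k <= K' * b s.
    apply: le_trans (_ : K * b s <= _).
      exact: (tail_sums_le K s b_gt0).1 (tail s) n.
    by rewrite ler_wpM2r ?(ltW (b_gt0 s))// le_max lexx.
  have [L L0 half] := beta_halving b_gt0 b_anti K1 tail'.
  exact: (light_tails_wepable b_gt0 b_anti K1 tail' L0 half x_circle mub SE).
Qed.
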